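(* Fix $\ell\ge 3$ and for each $m$ let $\mathbf D_m=(D^{(1)}(m),\dots,D^{(\ell)}(m))$ be a collection of $\ell$ independent random dice, with $D^{(k)}(m)$ having $n_k(m)=f_k(m)\,m\le m$ faces. Suppose that for each $k=1,\dots,\ell$, as $m\to\infty$, (i) $f_k(m)\to f_k(\infty)\in(0,1]$; (ii) $\mathbf p_k(m)\to\mathbf p_k(\infty)\in(0,1]$, $\sigma_k(m)\to\sigma_k(\infty)\in(0,\infty)$, and $\gamma_k(m)\to\gamma_k(\infty)\in[-1,1]$. Let $\widetilde N_k(m)=\dfrac{N_k-\mathbb E(N_k)}{\sqrt{\operatorname{Var}(N_k)}}$, $k=1,\dots,\ell$. Then, as $m\to\infty$, the random vector $(\widetilde N_1(m),\dots,\widetilde N_\ell(m))$ converges in distribution to a centered Gaussian vector $(X_1,\dots,X_\ell)$ with covariance matrix $$\Sigma=\begin{pmatrix} 1&\gamma_2(\infty)&0&\cdots&0&\gamma_1(\infty)\\ \gamma_2(\infty)&1&\gamma_3(\infty)&\cdots&0&0\\ 0&\gamma_3(\infty)&1&\cdots&0&0\\ \vdots&\vdots&\vdots&\ddots&\vdots&\vdots\\ 0&0&0&\cdots&1&\gamma_\ell(\infty)\\ \gamma_1(\infty)&0&0&\cdots&\gamma_\ell(\infty)&1 \end{pmatrix},$$ that is, $\Sigma_{kk}=1$, $\Sigma_{k-1,k}=\Sigma_{k,k-1}=\gamma_k(\infty)$ (indices modulo $\ell$), and all other entries are $0$.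
   Context: Indices of dice are cyclic modulo $\ell$: $D^{(0)}=D^{(\ell)}$, $D^{(\ell+1)}=D^{(1)}$, and likewise for all quantities indexed by $k$. A random die with $n$ faces and law $\mathcal L$ is a vector $D=(D_1,\dots,D_n)$ of i.i.d. real random variables with law $\mathcal L$. Dice in a collection are independent if all the random variables $\{D^{(k)}_i\}_{k,i}$ are mutually independent. For each $m$, the die $D^{(k)}=D^{(k)}(m)$ has some law $\mathcal L^{(k)}_m$, which may depend on both $k$ and $m$, and $n_k=n_k(m)\le m$ faces; $f_k=f_k(m)=n_k/m$. Dependence on $m$ is often omitted. Definitions: $N_k=\sum_{i=1}^{n_k}\sum_{j=1}^{n_{k+1}}\mathbf 1_{\{D^{(k)}_i>D^{(k+1)}_j\}}$. In the following four probabilities, $D^{(k)}_1,D^{(k)}_2$ stand for independent variables with law $\mathcal L^{(k)}_m$ (independent across dice): $\mathbf p_k=\mathbb P(D^{(k)}_1>D^{(k+1)}_1)$; $\mathbf q_k=\mathbb P(D^{(k)}_1>D^{(k+1)}_1,\ D^{(k)}_2>D^{(k+1)}_1)$; $\mathbf r_k=\mathbb P(D^{(k)}_1>D^{(k+1)}_1,\ D^{(k)}_1>D^{(k+1)}_2)$; $\mathbf s_k=\mathbb P(D^{(k-1)}_1>D^{(k)}_1>D^{(k+1)}_1)$. $\sigma_k=\big[f_kf_{k+1}\big(f_k(\mathbf q_k-\mathbf p_k^2)+f_{k+1}(\mathbf r_k-\mathbf p_k^2)\big)\big]^{1/2}$ and $\gamma_k=\dfrac{1}{\sigma_{k-1}\sigma_k}f_{k-1}f_kf_{k+1}(\mathbf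 s_k-\mathbf p_{k-1}\mathbf p_k)$. All of these depend on $m$. *)

(* Defs.v *)
From HB Require Import structures.
From mathcomp Require Import all_boot all_order all_algebra.
From mathcomp Require Import all_classical all_reals all_analysis.
Import Order.TTheory GRing.Theory Num.Theory.
Import numFieldNormedType.Exports.

Set Implicit Arguments.
Unset Strict Implicit.
Unset Printing Implicit Defensive.

Local Open Scope classical_set_scope.
Local Open Scope ring_scope.
Local Open Scope ereal_scope.

(* Measures are total functions on [set T]; laws are only compared on
   measurable sets. *)
Definition has_law {d} {T : measurableType d} {R : realType}
    (P : probability T R) (X : {RV P >-> R}) (L : probability R R) : Prop :=
  forall A : set R, measurable A -> distribution P X A = L A.

Definition mutually_independent {d} {T : measurableType d} {R : realType}
    (P : probability T R) (I : finType) (X : I -> {RV P >-> R}) : Prop :=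
  forall (J : {set I}) (A : I -> set R),
    (forall i, measurable (A i)) ->
    P (\bigcap_(i in [set` J]) (X i @^-1` A i)) =
    \prod_(i in J) P (X i @^-1` A i).

(* Die k has [n k] faces, indexed by ['I_(n k)]; the faces of all the dice
   together form a family indexed by the sigma type. *)
Definition independent_random_dice {d} {T : measurableType d} {R : realType}
    (P : probability T R) (l : nat) (n : 'I_l -> nat)
    (L : 'I_l -> probability R R)
    (D : forall k : 'I_l, 'I_(n k) -> {RV P >-> R}) : Prop :=
  (forall k i, has_law (D k i) (L k)) /\
  mutually_independent
    (fun c : {k : 'I_l & 'I_(n k)} => D (tag c) (tagged c)).

(* Dice are numbered 0, ..., l-1 and [ordS k], [ord_pred k] are k+1, k-1
   modulo l. *)
Definition N_ {T : Type} {R : realType} (l : nat) (n : 'I_l -> nat)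
    (D : forall k : 'I_l, 'I_(n k) -> T -> R) (k : 'I_l) (w : T) : R :=
  (\sum_(i < n k) \sum_(j < n (ordS k))
     ((D (ordS k) j w < D k i w)%R : nat)%:R)%R.

Definition standardize {d} {T : measurableType d} {R : realType}
    (P : probability T R) (Y : T -> R) (w : T) : R :=
  ((Y w - fine 'E_P[Y]) / Num.sqrt (fine 'V_P[Y]))%R.

Section parameters.
Context {R : realType} {l : nat}.
Implicit Types (L : 'I_l -> probability R R) (f : 'I_l -> R) (k : 'I_l).

(* Independent variables with laws L1, L2, ... are the coordinates of the
   product measure; [x.1.1], [x.1.2], [x.2] are the three coordinates. *)
Definition p_ L k : R :=
  fine ((L k \x L (ordS k)) [set x | (x.2 < x.1)%R]).

(* coordinates: D^(k)_1, D^(k)_2, D^(k+1)_1 *)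
Definition q_ L k : R :=
  fine (((L k \x L k) \x L (ordS k))
          [set x | (x.2 < x.1.1)%R /\ (x.2 < x.1.2)%R]).

(* coordinates: D^(k)_1, D^(k+1)_1, D^(k+1)_2 *)
Definition r_ L k : R :=
  fine (((L k \x L (ordS k)) \x L (ordS k))
          [set x | (x.1.2 < x.1.1)%R /\ (x.2 < x.1.1)%R]).

(* coordinates: D^(k-1)_1, D^(k)_1, D^(k+1)_1 *)
Definition s_ L k : R :=
  fine (((L (ord_pred k) \x L k) \x L (ordS k))
          [set x | (x.1.2 < x.1.1)%R /\ (x.2 < x.1.2)%R]).

Definition sigma_ L f k : R :=
  Num.sqrt (f k * f (ordS k) *
    (f k * (q_ L k - p_ L k ^+ 2) + f (ordS k) * (r_ L k - p_ L k ^+ 2)))%R.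

Definition gamma_ L f k : R :=
  (1 / (sigma_ L f (ord_pred k) * sigma_ L f k) *
   (f (ord_pred k) * f k * f (ordS k) *
    (s_ L k - p_ L (ord_pred k) * p_ L k)))%R.

(* For 3 <= l the three cases are disjoint. *)
Definition cyclic_cov (g : 'I_l -> R) : 'M[R]_l :=
  (\matrix_(i, j)
    if j == i then 1
    else if j == ordS i then g j
    else if i == ordS j then g i
    else 0)%R.

End parameters.

(* Univariate normal law with standard deviation s, including the degenerate
   case s = 0, which is not the Dirac mass in [normal_prob]. *)
Definition gaussian_law {R : realType} (mu s : R) : set R -> \bar R :=
  if s == 0%R then dirac mu else normal_prob mu s.

Definition gaussian_rv {d} {T : measurableType d} {R : realType}
    (P : probability T R) (Y : T -> R) : Prop :=
  exists mu s : R, (0 <= s)%R /\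
    forall A : set R, measurable A -> P (Y @^-1` A) = gaussian_law mu s A.

Definition centered_gaussian_vector {d} {T : measurableType d} {R : realType}
    (P : probability T R) (l : nat) (X : 'I_l -> {RV P >-> R})
    (S : 'M[R]_l) : Prop :=
  [/\ forall t : 'I_l -> R,
        gaussian_rv P (fun w => \sum_(k < l) t k * X k w)%R,
      forall k, 'E_P[X k] = 0 &
      forall i j, covariance P (X i) (X j) = (S i j)%:E].

(* The random vectors Y m may live on different probability spaces. *)
Definition cvg_in_distribution {R : realType} (l : nat)
    (d : nat -> measure_display) (T : forall m, measurableType (d m))
    (P : forall m, probability (T m) R) (Y : forall m, 'I_l -> T m -> R)
    (d' : measure_display) (T' : measurableType d') (P' : probability T' R)
    (X : 'I_l -> T' -> R) : Prop :=
  forall g : 'rV[R]_l -> R, continuous g -> bounded_fun g ->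
    'E_(P m)[fun w => g (\row_k Y m k w)%R] @[m --> \oo] -->
    'E_P'[fun w => g (\row_k X k w)%R].

(* Main.v *)
(* Conditioning on one face at a time (Hoeffding), 1_(y < x) - p_k is a function
   of x plus a function of y plus a doubly degenerate kernel. Summing over the
   faces, N_k - E N_k is its Hajek projection, a sum of independent centered
   terms of size O(m), plus a remainder which is orthogonal to all projections.
   The projection has variance m^3 sigma_k^2 and the remainder has variance
   O(m^2), so that the standardized N_k is within O(m^(-1/2)) in mean of the
   normalized projection; the correlations of the projections are the gamma_k.

   The limit of the transforms E cos(t.Y + b) follows by replacing the
   independent terms of t.Y one at a time. These transforms determine the limit
   in distribution: the second moments give tightness, and on a box a continuous
   function is uniformly close to a trigonometric polynomial (a Bernstein
   polynomial in the variables (1 + sin(a x_k)) / 2). The Gaussian vector is the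
   image of independent standard normal variables under a Cholesky factor of
   the covariance matrix, which is positive semidefinite as a limit of
   correlation matrices. *)
Require Import Defs.
From HB Require Import structures.
From mathcomp Require Import all_boot all_order all_algebra.
From mathcomp Require Import all_classical all_reals all_analysis.
From mathcomp Require Import measurable_realfun zify ring lra.
Import Order.TTheory GRing.Theory Num.Theory.
Import numFieldNormedType.Exports.

Set Implicit Arguments.
Unset Strict Implicit.
Unset Printing Implicit Defensive.

Local Open Scope classical_set_scope.
Local Open Scope ring_scope.

(** * Bounded random variables *)

Section bounded_measurable.
Context {d} {T : measurableType d} {R : realType}.
Implicit Types (X Y : T -> R) (P : probability T R).

(** All dice variables are bounded, so the work is done with [bmf] functions, on which [Ex] is
    real-valued and linear with integrability for free. Only the Gaussian limit is unbounded, and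
    its moments are recovered from its transforms. The pairs of faces counted by [N_k] overlap, so
    the terms are dependent; passing to a sum over single faces is what makes a limit theorem for
    independent terms available. The laws change with [m], which excludes a theorem for one fixed
    law: the estimates are explicit and see the laws only through a bound on the summands and the
    total variance. A face contributes at most [2 m], against a standard deviation of order
    [m^(3/2)]. Independence is given for events only. Its extension to expectations, including what
    would be conditioning on all faces but one, goes through a single uniqueness statement,
    [weighted_law_unique]. Transforms are real cosines with a free phase: a shift by [pi / 2]
    produces the sine, so the addition formula stays within the family and no complex numbers
    occur. *)

Definition bmf X := measurable_fun setT X /\ exists C : R, forall w, `|X w| <= C.

Definition Ex P X : R := \int[P]_w X w.

Lemma eq_bmf X Y : X =1 Y -> bmf X -> bmf Y.
Proof. by move=> /funext ->. Qed.

Lemma eq_Ex P X Y : X =1 Y -> Ex P X = Ex P Y.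
Proof. by move=> /funext ->. Qed.

Lemma bmf_cst c : bmf (cst c).
Proof. by split=> //; exists `|c|. Qed.

Lemma bmfD X Y : bmf X -> bmf Y -> bmf (fun w => X w + Y w).
Proof.
move=> [mX [C hC]] [mY [K hK]]; split; first exact: measurable_funD.
by exists (C + K) => w; rewrite (le_trans (ler_normD _ _))// lerD.
Qed.

Lemma bmfM X Y : bmf X -> bmf Y -> bmf (fun w => X w * Y w).
Proof.
move=> [mX [C hC]] [mY [K hK]]; split; first exact: measurable_funM.
by exists (C * K) => w; rewrite normrM ler_pM.
Qed.

Lemma bmfZ c X : bmf X -> bmf (fun w => c * X w).
Proof. exact: (bmfM (bmf_cst c)). Qed.

Lemma bmfN X : bmf X -> bmf (fun w => - X w).
Proof.
have -> : (fun w => - X w) = (fun w => -1 * X w).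
  by apply/funext => w; rewrite mulN1r.
exact: bmfZ.
Qed.

Lemma bmfB X Y : bmf X -> bmf Y -> bmf (fun w => X w - Y w).
Proof. by move=> hX hY; apply: bmfD => //; exact: bmfN. Qed.

Lemma bmf_sum (I : Type) (s : seq I) (p : pred I) (F : I -> T -> R) :
  (forall i, p i -> bmf (F i)) -> bmf (fun w => \sum_(i <- s | p i) F i w).
Proof.
move=> hF; elim: s => [|i s IHs].
  by apply: (eq_bmf _ (bmf_cst 0)) => w; rewrite big_nil.
apply: (@eq_bmf (fun w => if p i then F i w + \sum_(j <- s | p j) F j w
                         else \sum_(j <- s | p j) F j w)).
  by move=> w; rewrite big_cons.
by case: (boolP (p i)) => [pi|//]; apply: bmfD => //; exact: hF.
Qed.

Lemma bmf_prod (I : Type) (s : seq I) (p : pred I) (F : I -> T -> R) :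
  (forall i, p i -> bmf (F i)) -> bmf (fun w => \prod_(i <- s | p i) F i w).
Proof.
move=> hF; elim: s => [|i s IHs].
  by apply: (eq_bmf _ (bmf_cst 1)) => w; rewrite big_nil.
apply: (@eq_bmf (fun w => if p i then F i w * \prod_(j <- s | p j) F j w
                         else \prod_(j <- s | p j) F j w)).
  by move=> w; rewrite big_cons.
by case: (boolP (p i)) => [pi|//]; apply: bmfM => //; exact: hF.
Qed.

Lemma bmf_indic (A : set T) : measurable A -> bmf \1_A.
Proof.
move=> mA; split; first exact: measurable_indic.
by exists 1 => w; rewrite indicE; case: (_ \in _); rewrite ?normr1 ?normr0.
Qed.

Lemma bmf_cos X : measurable_fun setT X -> bmf (fun w => cos (X w)).
Proof.
move=> mX; split.
  by apply: measurableT_comp => //; apply: continuous_measurable_fun;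
    exact: continuous_cos.
by exists 1 => w; rewrite ler_norml cos_geN1 cos_le1.
Qed.

Lemma bmf_sin X : measurable_fun setT X -> bmf (fun w => sin (X w)).
Proof.
move=> mX; split.
  by apply: measurableT_comp => //; apply: continuous_measurable_fun;
    exact: continuous_sin.
by exists 1 => w; rewrite ler_norml sin_geN1 sin_le1.
Qed.

Lemma bmf_norm X : bmf X -> bmf (fun w => `|X w|).
Proof.
move=> [mX [C hC]]; split; first exact: measurableT_comp.
by exists C => w; rewrite normr_id.
Qed.

Lemma bmf_integrable P X : bmf X -> P.-integrable setT (EFin \o X).
Proof.
move=> [mX [C hC]]; apply: measurable_bounded_integrable => //.
  by rewrite (@le_lt_trans _ _ 1%E) ?ltry// probability_le1.
exists C; split; first by rewrite num_real.
by move=> x Cx w _ /=; rewrite (le_trans (hC w))// ltW.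
Qed.

Lemma EFin_Ex P X : bmf X -> (\int[P]_w (X w)%:E)%E = (Ex P X)%:E.
Proof.
by move=> hX; rewrite /Ex /Rintegral fineK// integrable_fin_num//;
  exact: bmf_integrable.
Qed.

Lemma ExD P X Y : bmf X -> bmf Y -> Ex P (fun w => X w + Y w) = Ex P X + Ex P Y.
Proof. by move=> hX hY; rewrite /Ex RintegralD//; exact: bmf_integrable. Qed.

Lemma ExB P X Y : bmf X -> bmf Y -> Ex P (fun w => X w - Y w) = Ex P X - Ex P Y.
Proof. by move=> hX hY; rewrite /Ex RintegralB//; exact: bmf_integrable. Qed.

Lemma ExZ P c X : bmf X -> Ex P (fun w => c * X w) = c * Ex P X.
Proof. by move=> hX; rewrite /Ex RintegralZl//; exact: bmf_integrable. Qed.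

Lemma Ex_cst P c : Ex P (cst c) = c.
Proof.
have P1 : P setT = 1%E by exact: probability_setT.
by rewrite /Ex Rintegral_cst// [X in fine X]P1 mulr1.
Qed.

Lemma Ex_sum P (I : Type) (s : seq I) (p : pred I) (F : I -> T -> R) :
  (forall i, p i -> bmf (F i)) ->
  Ex P (fun w => \sum_(i <- s | p i) F i w) = \sum_(i <- s | p i) Ex P (F i).
Proof.
move=> hF; elim: s => [|i s IHs].
  by rewrite big_nil -[RHS](Ex_cst P); apply: eq_Ex => w; rewrite big_nil.
transitivity (Ex P (fun w => if p i then F i w + \sum_(j <- s | p j) F j w
                         else \sum_(j <- s | p j) F j w)).
  by apply: eq_Ex => w; rewrite big_cons.
rewrite big_cons -IHs; case: (boolP (p i)) => [pi|//].
by rewrite ExD//; [exact: hF|exact: bmf_sum].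
Qed.

Lemma le_Ex P X Y : bmf X -> bmf Y -> (forall w, X w <= Y w) -> Ex P X <= Ex P Y.
Proof. by move=> hX hY XY; apply: le_Rintegral => //; exact: bmf_integrable. Qed.

Lemma Ex_ge0 P X : (forall w, 0 <= X w) -> 0 <= Ex P X.
Proof. by move=> X0; apply: Rintegral_ge0. Qed.

Lemma Ex_norm P X : bmf X -> `|Ex P X| <= Ex P (fun w => `|X w|).
Proof. by move=> hX; apply: le_normr_Rintegral => //; exact: bmf_integrable. Qed.

Lemma Ex_norm_le P X c : bmf X -> (forall w, `|X w| <= c) -> `|Ex P X| <= c.
Proof.
move=> hX Xc; rewrite (le_trans (Ex_norm P hX))// -[leRHS](Ex_cst P).
by apply: le_Ex => //; [exact: bmf_norm|exact: bmf_cst].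
Qed.

Lemma Ex_indic P (A : set T) : measurable A -> Ex P \1_A = fine (P A).
Proof. by move=> mA; rewrite /Ex /Rintegral integral_indic// setIT. Qed.

Lemma expectationEx P X : bmf X -> ('E_P[X] = (Ex P X)%:E)%E.
Proof. by move=> hX; rewrite unlock EFin_Ex. Qed.

End bounded_measurable.

Lemma bmf_comp d d' (T : measurableType d) (T' : measurableType d')
    (R : realType) (V : T -> T') (h : T' -> R) :
  measurable_fun setT V -> bmf h -> bmf (fun w => h (V w)).
Proof.
move=> mV [mh [C hC]]; split; first exact: (measurableT_comp mh mV).
by exists C.
Qed.

(** The range of [h] is cut into half-open cells of width [e], finitely many because [h] is bounded.
    The error is uniform in [w], so it survives multiplication by a bounded weight and integration
    under any probability. *)
Lemma bmf_simple_approx d (T : measurableType d) (R : realType) (h : T -> R)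
    (e : R) : bmf h -> 0 < e ->
  exists (n : nat) (a : 'I_n -> R) (A : 'I_n -> set T),
    (forall i, measurable (A i)) /\
    forall w, `|h w - \sum_(i < n) a i * \1_(A i) w| <= e.
Proof.
move=> [mh [C hC]] e0.
(* [2 N] cells of width [e], starting at [- N e], cover the whole range of [h]. *)
have [N NC] : exists N : nat, C < N%:R * e.
  exists (Num.trunc (`|C| / e)).+1; rewrite -ltr_pdivrMr//.
  rewrite (le_lt_trans (ler_norm _))// normrM normfV (gtr0_norm e0).
  by have /andP[] := truncn_itv (divr_ge0 (normr_ge0 C) (ltW e0)).
pose lo (i : nat) : R := - (N%:R * e) + i%:R * e.
exists (N + N)%N, (fun i => lo i), (fun i => h @^-1` `[lo i, lo i.+1[%classic).
split=> [i|w].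
  by rewrite -[X in measurable X]setTI; apply: mh => //; exact: measurable_itv.
have /andP[h1 h2] : - (N%:R * e) <= h w < N%:R * e.
  have := hC w; rewrite ler_norml => /andP[? ?]; apply/andP; split; lra.
have x0 : 0 <= (h w + N%:R * e) / e by rewrite divr_ge0//; lra.
have /andP[k1 k2] := truncn_itv x0; set k := Num.trunc _ in k1 k2.
have kN : (k < N + N)%N.
  rewrite -(ltr_nat R) (le_lt_trans k1)// ltr_pdivrMr// natrD mulrDl; lra.
move: k1 k2; rewrite ler_pdivlMr// ltr_pdivrMr// => k1 k2.
rewrite (bigD1 (Ordinal kN))//= big1 => [|i ik].
  rewrite addr0 indicE mem_set ?mulr1; last first.
    by rewrite /= in_itv/= /lo; apply/andP; split; lra.
  rewrite ler_norml /lo; move: k2; rewrite -natr1 mulrDl mul1r => k2.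
  apply/andP; split; lra.
rewrite indicE memNset ?mulr0//= in_itv/= /lo => /andP[i1 i2].
move/eqP: ik; apply; apply: val_inj => /=.
have ik1 : (i < k.+1)%N.
  by rewrite -(ltr_nat R) -(ltr_pM2r e0); lra.
have ik2 : (k < i.+1)%N.
  by rewrite -(ltr_nat R) -(ltr_pM2r e0); lra.
by apply/eqP; rewrite eqn_leq; apply/andP; split; rewrite -ltnS.
Qed.

(* The two weighted laws of V1 and V2, which are finite signed measures, agree
   as soon as they agree on a generating pi-system. *)
Lemma weighted_law_unique d1 d2 d (T1 : measurableType d1)
    (T2 : measurableType d2) (E : measurableType d) (R : realType)
    (P1 : probability T1 R) (P2 : probability T2 R)
    (V1 : T1 -> E) (V2 : T2 -> E) (G1 : T1 -> R) (G2 : T2 -> R)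
    (GG : set (set E)) :
  @measurable _ E = <<s GG >> -> setI_closed GG -> GG setT ->
  measurable_fun setT V1 -> measurable_fun setT V2 -> bmf G1 -> bmf G2 ->
  (forall A, GG A -> Ex P1 (fun w => \1_A (V1 w) * G1 w) =
                     Ex P2 (fun w => \1_A (V2 w) * G2 w)) ->
  forall h, bmf h -> Ex P1 (fun w => h (V1 w) * G1 w) =
                     Ex P2 (fun w => h (V2 w) * G2 w).
Proof.
move=> mGG GGI GGT mV1 mV2 hG1 hG2 eqGG.
have ind d0 (T0 : measurableType d0) (V : T0 -> E) A :
    measurable_fun setT V -> measurable A -> bmf (fun w => \1_A (V w) : R).
  by move=> mV mA; apply: bmf_comp => //; exact: bmf_indic.
have eqA A : measurable A -> Ex P1 (fun w => \1_A (V1 w) * G1 w) =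
                     Ex P2 (fun w => \1_A (V2 w) * G2 w).
  rewrite [in X in X -> _]mGG; move: A; apply: dynkin_induction => //.
  - exact: eqGG.
  - move=> S mS IH.
    (* The complement is reached by subtraction from the total weight; the two totals agree because
       [setT] belongs to [GG]. *)
    have cE d0 (T0 : measurableType d0) (P : probability T0 R) (V : T0 -> E) G :
        measurable_fun setT V -> bmf G ->
        Ex P (fun w => \1_(~` S) (V w) * G w) =
        Ex P (fun w => \1_setT (V w) * G w) - Ex P (fun w => \1_S (V w) * G w).
      move=> mV hG; rewrite -ExB; [|by apply: bmfM => //; exact: ind..].
      congr Ex; apply/funext => w; rewrite -mulrBl; congr (_ * _).
      rewrite !indicE in_setC in_setT; case: (_ \in _) => /=; lra.
    by rewrite !cE// IH eqGG.
  - move=> F mF tF IH.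
    have cF d0 (T0 : measurableType d0) (P : probability T0 R) (V : T0 -> E) G :
        measurable_fun setT V -> bmf G ->
        (\sum_(i < n) Ex P (fun w => \1_(F i) (V w) * G w)) @[n --> \oo] -->
        Ex P (fun w => \1_(\bigcup_k F k) (V w) * G w).
      move=> mV hG.
      have mU : measurable (\bigcup_k F k) by exact: bigcupT_measurable.
      have hs n : bmf (fun w => \sum_(i < n) \1_(F i) (V w) * G w).
        by apply: bmf_sum => i _; apply: bmfM => //; exact: ind.
      have -> : (fun n : nat => \sum_(i < n) Ex P (fun w => \1_(F i) (V w) * G w))
           = (fun n : nat => Ex P (fun w => \sum_(i < n) \1_(F i) (V w) * G w)).
        by apply/funext => n; rewrite Ex_sum// => i _; apply: bmfM => //; exact: ind.
      have hU : bmf (fun w => \1_(\bigcup_k F k) (V w) * G w).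
        by apply: bmfM => //; exact: ind.
      have [|||||_ _] := @dominated_convergence _ T0 R P setT measurableT
        (fun n w => (\sum_(i < n) \1_(F i) (V w) * G w)%:E)
        (fun w => (\1_(\bigcup_k F k) (V w) * G w)%:E) (fun w => `|G w|%:E).
      - by move=> n; apply/measurable_EFinP; have [] := hs n.
      - by apply/measurable_EFinP; have [] := hU.
      - apply: aeW => w _; apply: cvg_EFin; first exact: nearW.
        apply: cvg_near_cst.
        have [[k _ FkV]|nF] := pselect ((\bigcup_k F k) (V w)).
          exists k.+1 => // n /= kn; rewrite (bigD1 (Ordinal kn))//= big1 => [|i ik].
            by rewrite addr0 !indicE !mem_set//; exists k.
          rewrite indicE memNset ?mul0r// => FiV.
          move/eqP: ik; apply; apply: val_inj; apply: contrapT => /eqP ik.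
          move/trivIsetP : tF => /(_ i k I I ik) /seteqP[] /(_ (V w)) + _.
          by apply.
        near=> n; rewrite /= big1 => [|i _].
          by rewrite indicE memNset ?mul0r.
        by rewrite indicE memNset ?mul0r// => FiV; apply: nF; exists i.
      - exact: bmf_integrable (bmf_norm hG).
      - apply: aeW => w n _; rewrite lee_fin -mulr_suml normrM ler_piMl//.
        (* By disjointness at most one of the indicators is 1, so [|G|] dominates all partial
           sums. *)
        have tF' : \sum_(i < n) \1_(F i) (V w) = \1_(\bigcup_(i < n) F i) (V w) :> R.
          have [[k /= kn FkV]|nF] := pselect ((\bigcup_(i < n) F i) (V w)).
            rewrite (bigD1 (Ordinal kn))//= big1 => [|i ik].
              by rewrite addr0 !indicE !mem_set//; exists k.
            rewrite indicE memNset// => FiV.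
            move/eqP: ik; apply; apply: val_inj; apply: contrapT => /eqP ik.
            move/trivIsetP : tF => /(_ i k I I ik) /seteqP[] /(_ (V w)) + _.
            by apply.
          rewrite big1 => [|i _]; first by rewrite indicE memNset.
          by rewrite indicE memNset// => FiV; apply: nF; exists i => /=.
        by rewrite tF' indicE; case: (_ \in _); rewrite ?normr1 ?normr0.
      - by rewrite EFin_Ex// => /fine_cvgP[_].
    have c1 := cF _ _ P1 _ _ mV1 hG1.
    have c2 := cF _ _ P2 _ _ mV2 hG2.
    apply: cvg_unique c1 _ => //.
    rewrite (_ : (fun n : nat => _) = (fun n : nat => \sum_(i < n)
      Ex P2 (fun w => \1_(F i) (V2 w) * G2 w)))//.
    by apply/funext => n; apply: eq_bigr => i _; exact: IH.
move=> h hh; apply/eqP; rewrite -subr_eq0 -normr_eq0 eq_le normr_ge0 andbT.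
have [[_ [K1 hK1]] [_ [K2 hK2]]] := (hG1, hG2).
have K0 : 0 <= `|K1| + `|K2| by rewrite addr_ge0.
apply/ler_addgt0Pl => e e0; rewrite addr0.
(* The extra 1 keeps the denominator positive when both bounds vanish. *)
pose e' := e / (`|K1| + `|K2| + 1).
have e'0 : 0 < e' by rewrite divr_gt0// ltr_wpDl.
have [n [a [A [mA hA]]]] := bmf_simple_approx hh e'0.
pose s x := \sum_(i < n) a i * \1_(A i) x.
have hs : bmf s by apply: bmf_sum => i _; apply: bmfZ; exact: bmf_indic.
have aux d0 (T0 : measurableType d0) (P : probability T0 R) (V : T0 -> E) G K :
   measurable_fun setT V -> bmf G -> (forall w, `|G w| <= K) ->
   `|Ex P (fun w => h (V w) * G w) - Ex P (fun w => s (V w) * G w)| <= e' * `|K|.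
  move=> mV hG GK; rewrite -ExB; [|by apply: bmfM => //; exact: bmf_comp..].
  apply: Ex_norm_le => [|w].
    by apply: bmfB; apply: bmfM => //; exact: bmf_comp.
  rewrite -mulrBl normrM ler_pM//.
  by rewrite (le_trans (GK w))// ler_norm.
have sE d0 (T0 : measurableType d0) (P : probability T0 R) (V : T0 -> E) G :
    measurable_fun setT V -> bmf G -> Ex P (fun w => s (V w) * G w) =
    \sum_(i < n) a i * Ex P (fun w => \1_(A i) (V w) * G w).
  move=> mV hG.
  have hi i : bmf (fun w => \1_(A i) (V w) * G w).
    by apply: bmfM => //; exact: ind.
  rewrite -[RHS](eq_bigr _ (fun i _ => ExZ _ _ (hi i))) -Ex_sum => [|i _].
    by congr Ex; apply/funext => w; rewrite mulr_suml; apply: eq_bigr => i _;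
      rewrite mulrA.
  exact: bmfZ.
have a1 := aux _ _ P1 _ _ _ mV1 hG1 hK1.
have a2 := aux _ _ P2 _ _ _ mV2 hG2 hK2.
have ss : Ex P1 (fun w => s (V1 w) * G1 w) = Ex P2 (fun w => s (V2 w) * G2 w).
  by rewrite !sE//; apply: eq_bigr => i _; rewrite eqA.
rewrite ss in a1; have {a1 a2} := lerD a1 a2.
rewrite -mulrDr => a12.
have -> : e = e' * (`|K1| + `|K2| + 1) by rewrite /e' divfK// gt_eqF// ltr_wpDl.
rewrite (le_trans _ (_ : e' * (`|K1| + `|K2|) <= _))//; last first.
  by rewrite ler_pM2l//; lra.
apply: le_trans a12; rewrite [X in _ <= _ + X]distrC.
by apply: le_trans (ler_normD _ _); rewrite addrA subrK.
Unshelve. all: by end_near. Qed.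

(** * Product measures and independence *)

Section product_probability.
Context {d1 d2} {T1 : measurableType d1} {T2 : measurableType d2}
  {R : realType} (P1 : probability T1 R) (P2 : probability T2 R).

Definition prod_prob : probability (T1 * T2)%type R := (P1 \x P2)%E.

Implicit Types F : T1 * T2 -> R.

Let bmf_int F : bmf F -> (P1 \x P2)%E.-integrable setT (EFin \o F).
Proof. exact: (bmf_integrable prod_prob). Qed.

Lemma bmf_section1 F y : bmf F -> bmf (fun x => F (x, y)).
Proof. by move=> hF; apply: bmf_comp hF; exact: measurable_fun_pair. Qed.

Lemma bmf_section2 F x : bmf F -> bmf (fun y => F (x, y)).
Proof. by move=> hF; apply: bmf_comp hF; exact: measurable_fun_pair. Qed.

Lemma bmf_Ex1 F : bmf F -> bmf (fun x => Ex P2 (fun y => F (x, y))).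
Proof.
move=> hF; split; last first.
  have [_ [C hC]] := hF; exists C => x.
  by apply: Ex_norm_le => //; exact: bmf_section2.
apply/measurable_EFinP; have := measurable_fubini_F (bmf_int hF).
congr measurable_fun; apply/funext => x /=; rewrite -EFin_Ex//.
exact: bmf_section2.
Qed.

Lemma bmf_Ex2 F : bmf F -> bmf (fun y => Ex P1 (fun x => F (x, y))).
Proof.
move=> hF; split; last first.
  have [_ [C hC]] := hF; exists C => x.
  by apply: Ex_norm_le => //; exact: bmf_section1.
apply/measurable_EFinP; have := measurable_fubini_G (bmf_int hF).
congr measurable_fun; apply/funext => x /=; rewrite -EFin_Ex//.
exact: bmf_section1.
Qed.

Lemma Ex_prod1 F : bmf F ->
  Ex prod_prob F = Ex P1 (fun x => Ex P2 (fun y => F (x, y))).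
Proof.
move=> hF; rewrite {1}/Ex /Rintegral.
have <- := integral12_prod_meas1 (bmf_int hF).
rewrite [RHS]/Ex /Rintegral; congr fine; apply: eq_integral => x _.
rewrite -EFin_Ex//; exact: bmf_section2.
Qed.

Lemma Ex_prod2 F : bmf F ->
  Ex prod_prob F = Ex P2 (fun y => Ex P1 (fun x => F (x, y))).
Proof.
move=> hF; rewrite {1}/Ex /Rintegral.
have <- := integral21_prod_meas1 (bmf_int hF).
rewrite [RHS]/Ex /Rintegral; congr fine; apply: eq_integral => x _.
rewrite -EFin_Ex//; exact: bmf_section1.
Qed.

End product_probability.

Lemma measurable_salgebra_id d (T : measurableType d) :
  @measurable _ T = <<s @measurable _ T >>.
Proof. by rewrite sigma_algebra_id//; exact: sigma_algebra_measurable. Qed.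

Lemma Ex_law d (T : measurableType d) (R : realType) (P : probability T R)
    (X : {RV P >-> R}) (L : probability R R) (h : R -> R) :
  has_law X L -> bmf h -> Ex P (fun w => h (X w)) = Ex L h.
Proof.
move=> XL hh.
transitivity (Ex P (fun w => h (X w) * cst 1 w)).
  by apply: eq_Ex => w; rewrite mulr1.
transitivity (Ex L (fun x => h x * cst 1 x)); last first.
  by apply: eq_Ex => x; rewrite mulr1.
apply: (@weighted_law_unique _ _ _ T R R R P L X id (cst 1) (cst 1) measurable) => //.
- exact: measurable_salgebra_id.
- exact: measurableI.
- exact: bmf_cst.
- exact: bmf_cst.
move=> A mA; transitivity (Ex P \1_(X @^-1` A)).
  by apply: eq_Ex => w; rewrite mulr1.
rewrite Ex_indic; last by rewrite -[X in measurable X]setTI; exact: measurable_funP.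
transitivity (Ex L \1_A); last by apply: eq_Ex => w; rewrite mulr1.
by rewrite Ex_indic// -(XL _ mA).
Qed.

Section independence.
Context {d} {T : measurableType d} {R : realType} {P : probability T R}
  {I : finType} (X : I -> {RV P >-> R}) (L : I -> probability R R).
Hypothesis indepX : mutually_independent X.
Hypothesis lawX : forall c, has_law (X c) (L c).

(** In the proof [J] holds the indices whose function may still be arbitrary, the others carrying
    indicators. For empty [J] this is the product rule for events; the induction on [#|J|] frees one
    coordinate by [weighted_law_unique], all other factors acting as a signed weight. *)
Lemma Ex_indep (h : I -> R -> R) : (forall c, bmf (h c)) ->
  Ex P (fun w => \prod_c h c (X c w)) = \prod_c Ex (L c) (h c).
Proof.
suff H (J : {set I}) : forall h : I -> R -> R, (forall c, bmf (h c)) ->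
    (forall c, c \notin J -> exists A, measurable A /\ h c = \1_A) ->
    Ex P (fun w => \prod_c h c (X c w)) = \prod_c Ex (L c) (h c).
  by move=> hh; apply: (H [set: I]%SET) => // c; rewrite inE.
move: {2}#|J| (erefl #|J|) => k; elim: k J {h} => [|k IHk] J.
  move/eqP; rewrite cards_eq0 => /eqP -> h hh hA.
  have /choice[A /all_and2[mA hE]] c : exists A, measurable A /\ h c = \1_A.
    by apply: hA; rewrite inE.
  transitivity (Ex P \1_(\bigcap_(c in [set` [set: I]%SET]) (X c @^-1` A c))).
    apply: eq_Ex => w; under eq_bigr do rewrite hE.
    have [Aw|] := pselect ((\bigcap_(c in [set` [set: I]%SET]) (X c @^-1` A c)) w).
      rewrite [RHS]indicE mem_set// big1// => c _.
      by rewrite indicE mem_set//; apply: Aw => /=; rewrite inE.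
    move=> nAw; rewrite [RHS]indicE memNset//.
    have /existsNP[c /not_implyP[_ nAc]] := nAw.
    by rewrite (bigD1 c)//= indicE memNset// mul0r.
  rewrite Ex_indic; last first.
    apply: fin_bigcap_measurable => [|c _]; first exact: finite_finset.
    by rewrite -[X in measurable X]setTI; exact: measurable_funP.
  rewrite indepX//.
  transitivity (fine (\prod_c (Ex (L c) (h c))%:E)%E).
    congr fine; apply: eq_big => [c|c _]; first by rewrite inE.
    rewrite hE Ex_indic// -(lawX _ (mA c)) fineK//.
    by apply: fin_num_measure; exact: mA.
  have -> : (\prod_c (Ex (L c) (h c))%:E = (\prod_c Ex (L c) (h c))%:E)%E.
    by elim/big_ind2 : _ => //= x y ? ? -> ->.
  by [].
move=> Jk h hh hA.
have /card_gt0P[c0 c0J] : (0 < #|J|)%N by rewrite Jk.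
pose G1 w := \prod_(c | c != c0) h c (X c w).
pose G2 : R := \prod_(c | c != c0) Ex (L c) (h c).
have hG1 : bmf G1 by apply: bmf_prod => c _; exact: bmf_comp.
transitivity (Ex P (fun w => h c0 (X c0 w) * G1 w)).
  by apply: eq_Ex => w; rewrite (bigD1 c0).
transitivity (Ex (L c0) (fun x => h c0 x * cst G2 x)); last first.
  rewrite (bigD1 c0)//= -/G2 mulrC -ExZ//.
  by apply: eq_Ex => x; rewrite mulrC.
apply: (@weighted_law_unique _ _ _ T R R R P (L c0) (X c0) id G1 (cst G2) measurable) => //.
- exact: measurable_salgebra_id.
- exact: measurableI.
- exact: bmf_cst.
move=> A mA.
(* On the generating sets the function at [c0] is an indicator, so [c0] leaves [J]. *)
pose h' c := if c == c0 then \1_A else h c.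
have hh' c : bmf (h' c) by rewrite /h'; case: ifP => // _; exact: bmf_indic.
transitivity (Ex P (fun w => \prod_c h' c (X c w))).
  apply: eq_Ex => w; rewrite [RHS](bigD1 c0)//= {1}/h' eqxx; congr (_ * _).
  by apply: eq_bigr => c /negbTE cc0; rewrite /h' cc0.
rewrite (IHk (J :\ c0)%SET)//.
- rewrite (bigD1 c0)//= {1}/h' eqxx mulrC.
  have -> : \prod_(c | c != c0) Ex (L c) (h' c) = G2.
    by apply: eq_bigr => c /negbTE cc0; rewrite /h' cc0.
  rewrite -ExZ; last exact: bmf_indic.
  by apply: eq_Ex => x; rewrite mulrC.
- by move: Jk; rewrite (cardsD1 c0) c0J add1n => -[].
- move=> c; rewrite !inE negb_and negbK /h'; case: ifP => [_ _|_ /=].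
    by exists A.
  exact: hA.
Qed.

Let seq_prod (s : seq (I * (R -> R))) w :=
  \prod_(z <- s) z.2 (X z.1 w).

(** The list may repeat an index, as can happen once [Ex_freeze] has prepended a factor at [c1].
    Factors at the same index are first merged into one function, so that [Ex_indep] applies. *)
Lemma Ex_indep_seq c0 (h : R -> R) (s : seq (I * (R -> R))) :
  bmf h -> (forall z, List.In z s -> z.1 != c0 /\ bmf z.2) ->
  Ex P (fun w => h (X c0 w) * seq_prod s w) = Ex (L c0) h * Ex P (seq_prod s).
Proof.
move=> hh hs.
pose g c := if c == c0 then cst 1 else fun x => \prod_(z <- s | z.1 == c) z.2 x.
have hprod (s' : seq (I * (R -> R))) c :
    (forall z, List.In z s' -> z.1 != c0 /\ bmf z.2) ->
    bmf (fun x => \prod_(z <- s' | z.1 == c) z.2 x).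
  elim: s' => [_|z s' IHs' hs'].
    by apply: (eq_bmf _ (bmf_cst 1)) => w; rewrite big_nil.
  apply: (@eq_bmf _ _ _ (fun w =>
      if z.1 == c then z.2 w * \prod_(j <- s' | j.1 == c) j.2 w
      else \prod_(j <- s' | j.1 == c) j.2 w)).
    by move=> w; rewrite big_cons.
  have IH := IHs' (fun y ys => hs' y (or_intror ys)).
  case: (z.1 == c) => //; apply: bmfM => //.
  by apply: (hs' _ _).2; left.
have hg c : bmf (g c).
  by rewrite /g; case: ifP => _; [exact: bmf_cst|exact: hprod].
have gE w : seq_prod s w = \prod_c g c (X c w).
  rewrite /seq_prod; have -> : \prod_c g c (X c w) =
      \prod_c \prod_(z <- s | z.1 == c) z.2 (X c w).
    apply: eq_bigr => c _; rewrite /g; case: ifP => // /eqP -> /=.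
    elim: s hs {hg g hprod} => [|z s IHs] hs; first by rewrite big_nil.
    rewrite big_cons (negbTE (hs z _).1); last by left.
    by apply: IHs => y ys; apply: hs; right.
  rewrite (exchange_big_dep xpredT)//=; apply: eq_bigr => z _.
  by rewrite (big_pred1 z.1)// => c; rewrite eq_sym.
pose h' c := if c == c0 then h else g c.
have hh' c : bmf (h' c) by rewrite /h'; case: ifP.
transitivity (Ex P (fun w => \prod_c h' c (X c w))).
  apply: eq_Ex => w; rewrite gE (bigD1 c0)//= [RHS](bigD1 c0)//= {1}/g {1}/h'.
  rewrite eqxx mul1r; congr (_ * _); apply: eq_bigr => c /negbTE cc0.
  by rewrite /h' cc0.
rewrite Ex_indep// (bigD1 c0)//= {1}/h' eqxx; congr (_ * _).
rewrite (eq_Ex _ gE) Ex_indep// [RHS](bigD1 c0)//= {1}/g eqxx Ex_cst mul1r.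
by apply: eq_bigr => c /negbTE cc0; rewrite /h' cc0.
Qed.

(** A substitute for conditioning on every variable except [X c0]. The law of [(X c0, X c1)] under
    [P] and that of [(x, X c1)] under the product of [L c0] and [P], both weighted by [seq_prod s],
    agree on rectangles by [Ex_indep_seq], hence everywhere. *)
Lemma Ex_freeze c0 c1 (F : R * R -> R) (s : seq (I * (R -> R))) :
  c1 != c0 -> bmf F -> (forall z, List.In z s -> z.1 != c0 /\ bmf z.2) ->
  Ex P (fun w => F (X c0 w, X c1 w) * seq_prod s w) =
  Ex P (fun w => Ex (L c0) (fun x => F (x, X c1 w)) * seq_prod s w).
Proof.
move=> c10 hF hs.
have hS (s' : seq (I * (R -> R))) :
    (forall z, List.In z s' -> z.1 != c0 /\ bmf z.2) -> bmf (seq_prod s').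
  elim: s' => [_|z s' IHs' hs'].
    by apply: (eq_bmf _ (bmf_cst 1)) => w; rewrite /seq_prod big_nil.
  apply: (@eq_bmf _ _ _ (fun w => z.2 (X z.1 w) * seq_prod s' w)).
    by move=> w; rewrite /seq_prod big_cons.
  apply: bmfM; last by apply: IHs' => y ys; apply: hs'; right.
  by apply: bmf_comp => //; apply: (hs' _ _).2; left.
have hSs := hS s hs.
have mV2 : measurable_fun [set: R * T] (fun z => (z.1, X c1 z.2)).
  apply: measurable_fun_pair => //.
  exact: (measurableT_comp (measurable_funPT (X c1)) measurable_snd).
have hF2 : bmf (fun z : R * T => F (z.1, X c1 z.2)) by exact: bmf_comp hF.
have hS2 : bmf (fun z : R * T => seq_prod s z.2).
  by apply: bmf_comp hSs; exact: measurable_snd.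
transitivity (Ex (prod_prob (L c0) P)
    (fun z => F (z.1, X c1 z.2) * seq_prod s z.2)); last first.
  rewrite Ex_prod2; last exact: bmfM.
  apply: eq_Ex => w /=; rewrite mulrC -ExZ; last exact: bmf_section1.
  by apply: eq_Ex => x; rewrite mulrC.
apply: (@weighted_law_unique _ _ _ T (R * T)%type (R * R)%type R P
  (prod_prob (L c0) P) (fun w => (X c0 w, X c1 w)) (fun z => (z.1, X c1 z.2))
  (seq_prod s) (fun z => seq_prod s z.2)
  [set A `*` B | A in measurable & B in measurable]) => //.
- exact: measurable_prod_measurableType.
- move=> _ _ [A1 mA1 [B1 mB1 <-]] [A2 mA2 [B2 mB2 <-]].
  exists (A1 `&` A2); first exact: measurableI.
  by exists (B1 `&` B2); [exact: measurableI|rewrite setXI].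
- by exists setT => //; exists setT => //; rewrite setXTT.
- exact: measurable_fun_pair.
move=> _ [A mA [B mB <-]].
have E12 (x y : R) : \1_(A `*` B) (x, y) = \1_A x * \1_B y :> R.
  by rewrite !indicE in_setX/=; case: (_ \in _); rewrite ?mul1r ?mul0r.
(* The second side of the rectangle becomes one more factor of the list, at index [c1]. *)
pose s' := (c1, \1_B : R -> R) :: s.
have hs' z : List.In z s' -> z.1 != c0 /\ bmf z.2.
  by move=> [<- /=|]; [split => //; exact: bmf_indic|exact: hs].
have sE w : \1_B (X c1 w) * seq_prod s w = seq_prod s' w.
  by rewrite /seq_prod big_cons.
transitivity (Ex P (fun w => \1_A (X c0 w) * seq_prod s' w)).
  by apply: eq_Ex => w; rewrite E12 -mulrA sE.
rewrite Ex_indep_seq//; last exact: bmf_indic.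
transitivity (Ex (prod_prob (L c0) P) (fun z => \1_A z.1 * seq_prod s' z.2)).
  rewrite Ex_prod1; last first.
    apply: bmfM; first by apply: bmf_comp (bmf_indic mA); exact: measurable_fst.
    by apply: bmf_comp (hS _ hs'); exact: measurable_snd.
  rewrite mulrC -ExZ; last exact: bmf_indic.
  apply: eq_Ex => x /=; rewrite ExZ; last exact: hS.
  by rewrite mulrC.
by apply: eq_Ex => z; rewrite E12 -mulrA sE.
Qed.

End independence.

(** * A quantitative central limit theorem *)

Section elementary_bounds.
Context {R : realType}.
Implicit Types x y : R.

(** Each trigonometric bound below controls a derivative by the preceding bound and then uses this
    form of the mean value theorem, valid for both signs of [x]. The constants are not sharp; only
    the powers of [x] matter. *)
Lemma mean_value0 (F dF : R -> R) x : (forall z : R, is_derive z 1 F (dF z)) ->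
  exists2 c, `|c| <= `|x| & F x - F 0 = dF c * x.
Proof.
move=> hF.
have cF : continuous F.
  move=> z; have [dFz _] := hF z.
  exact/differentiable_continuous/derivable1_diffP.
have cFw a b : {within `[a, b], continuous F} by exact: continuous_subspaceT.
have [x0|x0] := leP 0 x.
  have [c cx e] := @MVT_segment R F dF 0 x x0 (fun z _ => hF z) (cFw 0 x).
  exists c; last by rewrite e subr0.
  by move: cx; rewrite in_itv/= => /andP[c0 cx]; rewrite !ger0_norm.
have [c cx e] := @MVT_segment R F dF x 0 (ltW x0) (fun z _ => hF z) (cFw x 0).
exists c; last by rewrite -opprB e sub0r mulrN opprK.
move: cx; rewrite in_itv/= => /andP[c0 cx]; rewrite !ler0_norm//; last exact: ltW.
by rewrite lerN2.
Qed.

Lemma norm_sin_le x : `|sin x| <= `|x|.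
Proof.
have [c _] := @mean_value0 sin cos x (fun z => is_derive_sin z).
by rewrite sin0 subr0 => ->; rewrite normrM ler_piMl// ler_norml cos_geN1 cos_le1.
Qed.

Lemma norm_cosB1_le x : `|cos x - 1| <= x ^+ 2.
Proof.
have [c cx] := @mean_value0 cos (fun z => - sin z) x (fun z => is_derive_cos z).
rewrite cos0 => ->; rewrite normrM normrN -[leRHS]real_normK ?num_real// expr2.
by rewrite ler_wpM2r// (le_trans (norm_sin_le _)).
Qed.

Lemma norm_sinB_le x : `|sin x - x| <= `|x| * x ^+ 2.
Proof.
have hd (z : R) : is_derive z 1 (fun z => sin z - z) (cos z - 1).
  exact: is_deriveB.
have [c cx] := mean_value0 x hd.
rewrite sin0 !subr0 => ->; rewrite normrM mulrC ler_wpM2l//.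
rewrite (le_trans (norm_cosB1_le _))// -[leLHS]real_normK ?num_real//.
by rewrite -[leRHS]real_normK ?num_real// ler_pXn2r ?nnegrE.
Qed.

Lemma norm_cos_taylor_le x : `|cos x - 1 + x ^+ 2 / 2| <= x ^+ 4.
Proof.
have hd (z : R) : is_derive z 1 (fun z => cos z - 1 + z ^+ 2 / 2) (- sin z + z).
  by apply: is_derive_eq; rewrite !scaler0 add0r subr0 /GRing.scale/=; field.
have [c cx] := mean_value0 x hd.
rewrite cos0 expr0n/= mul0r addr0 subrr subr0 => ->.
rewrite normrM addrC distrC.
have -> : x ^+ 4 = `|x| * x ^+ 2 * `|x|.
  by rewrite -[in RHS](real_normK (num_real x)) -[in LHS](@ger0_norm _ (x ^+ 4))
    ?normrX; [ring|rewrite exprn_even_ge0].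
rewrite ler_wpM2r// (le_trans (norm_sinB_le _))// ler_pM ?sqr_ge0//.
rewrite -[leLHS]real_normK ?num_real//.
by rewrite -[leRHS]real_normK ?num_real// ler_pXn2r ?nnegrE.
Qed.

Lemma norm_expRN_taylor_le y : 0 <= y -> `|expR (- y) - 1 + y| <= y ^+ 2.
Proof.
move=> y0; have h1 := expR_ge1Dx (- y); have h2 := expR_ge1Dx y.
have h3 : expR (- y) * (1 + y) <= 1.
  by rewrite expRN mulrC ler_pdivrMr ?expR_gt0// mul1r.
have h4 : expR (- y) <= 1 - y + y ^+ 2.
  (* The inequality sought is [1 <= (1 - y + y^2) (1 + y) = 1 + y^3]. *)
  rewrite -(@ler_pM2r _ (1 + y)); last lra.
  apply: (le_trans h3); nra.
rewrite ler_norml; apply/andP; split; nra.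
Qed.

End elementary_bounds.

Section characteristic_clt.
Context {d} {T : measurableType d} {R : realType} {P : probability T R}
  {I : finType} (X : I -> {RV P >-> R}) (L : I -> probability R R).
Hypothesis indepX : mutually_independent X.
Hypothesis lawX : forall c, has_law (X c) (L c).
Variable u : I -> R -> R.
Hypothesis hu : forall c, bmf (u c).

Let S (s : seq I) w := \sum_(c <- s) u c (X c w).

Let mS s : measurable_fun setT (S s).
Proof.
have [] : bmf (S s) by apply: bmf_sum => c _; exact: bmf_comp.
by [].
Qed.

Let hcos s t : bmf (fun w => cos (S s w + t)).
Proof. by apply: bmf_cos; exact: measurable_funD. Qed.

(** Induction on [s]: the addition formula splits off the term of [c0], and its cosine or sine joins
    the product over the indices outside [s]. The phase is quantified because the sine part comes
    back as a cosine shifted by [pi / 2]. *)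
Let Ex_cos_prod s : uniq s -> forall (h : I -> R -> R) t, (forall c, bmf (h c)) ->
  Ex P (fun w => cos (S s w + t) * \prod_(c | c \notin s) h c (X c w)) =
  Ex P (fun w => cos (S s w + t)) * \prod_(c | c \notin s) Ex (L c) (h c).
Proof.
elim: s => [_ h t hh|c0 s IHs /= /andP[c0s us] h t hh].
  rewrite (eq_Ex _ (Y := fun w => cos t * \prod_c h c (X c w))); last first.
    by move=> w; rewrite /S big_nil add0r; congr (_ * _); apply: eq_bigl => c.
  rewrite ExZ; last by apply: bmf_prod => c _; exact: bmf_comp.
  rewrite (Ex_indep indepX lawX hh).
  rewrite (eq_Ex _ (Y := cst (cos t))) ?Ex_cst.
    by congr (_ * _); apply: eq_bigl => c.
  by move=> w; rewrite /S big_nil add0r.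
have step (g : I -> R -> R) : (forall c, bmf (g c)) ->
    Ex P (fun w => cos (S (c0 :: s) w + t) * \prod_(c | c \notin c0 :: s) g c (X c w)) =
    (Ex P (fun w => cos (S s w + t)) * Ex (L c0) (fun x => cos (u c0 x)) +
     Ex P (fun w => cos (S s w + (t + pi / 2))) * Ex (L c0) (fun x => sin (u c0 x)))
     * \prod_(c | c \notin c0 :: s) Ex (L c) (g c).
  move=> hg.
  have bigc (K : I -> R) : \prod_(c | c \notin s) K c =
      K c0 * \prod_(c | c \notin c0 :: s) K c.
    rewrite (bigD1 c0)//=; congr (_ * _); apply: eq_bigl => c.
    by rewrite inE negb_or andbC.
  pose g1 k c := if c == c0 then (fun x => k (u c0 x)) : R -> R else g c.
  have hg1 k c : bmf (fun x => k (u c0 x)) -> bmf (g1 k c).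
    by rewrite /g1; case: ifP.
  have bigg1 k (K : I -> (R -> R) -> R) :
      \prod_(c | c \notin s) K c (g1 k c) =
      K c0 (fun x => k (u c0 x)) * \prod_(c | c \notin c0 :: s) K c (g c).
    rewrite bigc {1}/g1 eqxx; congr (_ * _); apply: eq_bigr => c.
    by rewrite inE negb_or => /andP[/negbTE cc0 _]; rewrite /g1 cc0.
  have huc : bmf (fun x => cos (u c0 x)) by apply: bmf_cos; have [] := hu c0.
  have hus : bmf (fun x => sin (u c0 x)) by apply: bmf_sin; have [] := hu c0.
  have hgc c := hg1 _ c huc; have hgs c := hg1 _ c hus.
  have IH1 := IHs us (g1 cos) t hgc; have IH2 := IHs us (g1 sin) (t + pi / 2) hgs.
  have hP k : (forall c, bmf (g1 k c)) ->
      bmf (fun w => \prod_(c | c \notin s) g1 k c (X c w)).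
    by move=> hk; apply: bmf_prod => c _; exact: bmf_comp.
  rewrite (eq_Ex _ (Y := fun w =>
      cos (S s w + t) * \prod_(c | c \notin s) g1 cos c (X c w) +
      cos (S s w + (t + pi / 2)) * \prod_(c | c \notin s) g1 sin c (X c w))).
    rewrite ExD ?IH1 ?IH2; [|by apply: bmfM => //; exact: hP..].
    rewrite (bigg1 cos (fun c f => Ex (L c) f)) (bigg1 sin (fun c f => Ex (L c) f)).
    ring.
  move=> w.
  rewrite (bigg1 cos (fun c f => f (X c w))) (bigg1 sin (fun c f => f (X c w))).
  have -> : S (c0 :: s) w = u c0 (X c0 w) + S s w by rewrite /S big_cons.
  rewrite -addrA cosD addrA cosDpihalf.
  ring.
rewrite (step h hh); congr (_ * _).
(* With every [g] equal to 1, the same identity evaluates the bracket as the expectation for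
   [c0 :: s]. *)
have := step (fun=> cst 1) (fun=> bmf_cst 1).
rewrite [X in _ * X]big1 ?mulr1 => [<-|c _]; last by rewrite Ex_cst.
by apply: eq_Ex => w; rewrite big1 ?mulr1.
Qed.

Let Ex_cos_rec c0 s t : uniq (c0 :: s) ->
  Ex P (fun w => cos (S (c0 :: s) w + t)) =
  Ex P (fun w => cos (S s w + t)) * Ex (L c0) (fun x => cos (u c0 x)) +
  Ex P (fun w => cos (S s w + (t + pi / 2))) * Ex (L c0) (fun x => sin (u c0 x)).
Proof.
move=> /= /andP[c0s us].
have huc : bmf (fun x => cos (u c0 x)) by apply: bmf_cos; have [] := hu c0.
have hus : bmf (fun x => sin (u c0 x)) by apply: bmf_sin; have [] := hu c0.
have aux k t' : bmf (fun x => k (u c0 x)) ->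
    Ex P (fun w => cos (S s w + t') * k (u c0 (X c0 w))) =
    Ex P (fun w => cos (S s w + t')) * Ex (L c0) (fun x => k (u c0 x)).
  move=> hk.
  pose h c := if c == c0 then (fun x => k (u c0 x)) : R -> R else cst 1.
  have hh c : bmf (h c) by rewrite /h; case: ifP => // _; exact: bmf_cst.
  have hE : h c0 = fun x => k (u c0 x) by rewrite /h eqxx.
  have := Ex_cos_prod us t' hh; rewrite (bigD1 c0)//= hE.
  rewrite [X in _ * (_ * X)]big1 ?mulr1 => [<-|c /andP[_ /negbTE cc0]]; last first.
    by rewrite /h cc0 Ex_cst.
  apply: eq_Ex => w; rewrite (bigD1 c0)//= hE big1 ?mulr1//.
  by move=> c /andP[_ /negbTE cc0]; rewrite /h cc0.
rewrite -(aux cos)// -(aux sin)// -ExD.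
- apply: eq_Ex => w; have -> : S (c0 :: s) w = u c0 (X c0 w) + S s w.
    by rewrite /S big_cons.
  rewrite -addrA cosD addrA cosDpihalf.
  ring.
- by apply: bmfM => //; exact: (bmf_comp (V := X c0) _ huc).
- by apply: bmfM => //; exact: (bmf_comp (V := X c0) _ hus).
Qed.

Variable delta : R.
Hypothesis delta0 : 0 <= delta.
Hypothesis u_le : forall c x, `|u c x| <= delta.
Hypothesis Ex_u : forall c, Ex (L c) (u c) = 0.

Let v c := Ex (L c) (fun x => u c x ^+ 2).

Let hu2 c : bmf (fun x => u c x ^+ 2).
Proof.
apply: (@eq_bmf _ _ _ (fun x => u c x * u c x)) => [x|]; first by rewrite expr2.
exact: bmfM.
Qed.

Let v0 c : 0 <= v c. Proof. by apply: Ex_ge0 => x; exact: sqr_ge0. Qed.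

Let u2_le c x : u c x ^+ 2 <= delta ^+ 2.
Proof. by rewrite -real_normK ?num_real// ler_pXn2r ?nnegrE. Qed.

Let v_le c : v c <= delta ^+ 2.
Proof.
rewrite -[leRHS](Ex_cst (L c)); apply: le_Ex => //; exact: bmf_cst.
Qed.

(** Centering removes the linear term, so only the cubic Taylor error is left. *)
Let Ex_sin_le c : `|Ex (L c) (fun x => sin (u c x))| <= delta * v c.
Proof.
have hus : bmf (fun x => sin (u c x)) by apply: bmf_sin; have [] := hu c.
have -> : Ex (L c) (fun x => sin (u c x)) = Ex (L c) (fun x => sin (u c x) - u c x).
  by rewrite ExB// Ex_u subr0.
rewrite (le_trans (Ex_norm _ (bmfB hus (hu c))))// -ExZ//.
apply: le_Ex => [||x]; [exact/bmf_norm/bmfB|exact: bmfZ|].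
by rewrite (le_trans (norm_sinB_le _))// ler_wpM2r ?sqr_ge0.
Qed.

(** Both numbers are within [delta ^+ 2 * v c] of [1 - v c / 2], whence the factor 2. *)
Let Ex_cos_le c :
  `|Ex (L c) (fun x => cos (u c x)) - expR (- (v c / 2))| <= 2 * delta ^+ 2 * v c.
Proof.
have huc : bmf (fun x => cos (u c x)) by apply: bmf_cos; have [] := hu c.
have e : Ex (L c) (fun x => cos (u c x) - 1 + 2^-1 * u c x ^+ 2) =
    Ex (L c) (fun x => cos (u c x)) - 1 + v c / 2.
  rewrite ExD ?ExZ ?ExB ?(Ex_cst (L c) 1)// 1?mulrC//.
  - exact: (bmf_cst 1).
  - exact: bmfB (bmf_cst 1).
  - exact: bmfZ.
have h1 : `|Ex (L c) (fun x => cos (u c x)) - 1 + v c / 2| <= delta ^+ 2 * v c.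
  rewrite -e (le_trans (Ex_norm _ _))//.
    by apply: bmfD; [exact: bmfB (bmf_cst 1)|exact: bmfZ].
  rewrite -ExZ//; apply: le_Ex => [||x]; [|exact: bmfZ|].
    by apply: bmf_norm; apply: bmfD; [exact: bmfB (bmf_cst 1)|exact: bmfZ].
  rewrite [2^-1 * _]mulrC (le_trans (norm_cos_taylor_le _))//.
  by rewrite (exprM _ 2 2) [leLHS]expr2 ler_wpM2r ?sqr_ge0.
have h2 : `|expR (- (v c / 2)) - 1 + v c / 2| <= delta ^+ 2 * v c.
  rewrite (le_trans (norm_expRN_taylor_le _)) ?divr_ge0//.
  have := v_le c; have := v0 c; have := sqr_ge0 delta; nra.
have -> : Ex (L c) (fun x => cos (u c x)) - expR (- (v c / 2)) =
  (Ex (L c) (fun x => cos (u c x)) - 1 + v c / 2) -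
  (expR (- (v c / 2)) - 1 + v c / 2) by ring.
by rewrite (le_trans (ler_normB _ _))//; lra.
Qed.

(** Each replacement trades the cosine factor of one summand for the Gaussian factor of the same
    variance, at a cost proportional to that variance. For a bounded total variance, a small [delta]
    therefore suffices. *)
Lemma Ex_cos_sum_le t :
  `|Ex P (fun w => cos (\sum_c u c (X c w) + t)) -
    expR (- ((\sum_c v c) / 2)) * cos t| <=
  (delta + 2 * delta ^+ 2) * \sum_c v c.
Proof.
suff H s : uniq s -> forall t, `|Ex P (fun w => cos (S s w + t)) -
    expR (- ((\sum_(c <- s) v c) / 2)) * cos t| <=
    (delta + 2 * delta ^+ 2) * \sum_(c <- s) v c by exact: (H _ (index_enum_uniq _)).
elim: s => [_ {}t|c s IHs us {}t].
  rewrite big_nil mul0r oppr0 expR0 mulr0 mul1r (eq_Ex _ (Y := cst (cos t))).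
    by rewrite Ex_cst subrr normr0.
  by move=> w; rewrite /S big_nil add0r.
have us' : uniq s by case/andP : us.
have {}IHs := IHs us' t.
rewrite Ex_cos_rec// big_cons; set V := \sum_(c <- s) v c in IHs *.
rewrite (mulrDl (v c) V) opprD expRD.
have hc := Ex_cos_le c; have hs := Ex_sin_le c.
have a1 : `|Ex (L c) (fun x => cos (u c x))| <= 1.
  apply: Ex_norm_le => [|x]; first by apply: bmf_cos; have [] := hu c.
  by rewrite ler_norml cos_geN1 cos_le1.
have a2 : `|Ex P (fun w => cos (S s w + (t + pi / 2)))| <= 1.
  by apply: Ex_norm_le => [|x]//; rewrite ler_norml cos_geN1 cos_le1.
have a3 : `|expR (- (V / 2)) * cos t| <= 1.
  rewrite normrM ger0_norm ?expR_ge0// -[leRHS]mulr1 ler_pM ?expR_ge0//.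
    by rewrite -expR0 ler_expR oppr_le0 divr_ge0// sumr_ge0.
  by rewrite ler_norml cos_geN1 cos_le1.
move: hc hs IHs a1 a2 a3.
set A := Ex P _; set B := Ex P _; set C := Ex (L c) _; set D := Ex (L c) _.
set E1 := expR _; set E2 := expR _ => hc hs IHs a1 a2 a3.
(* The difference splits into the error inherited from [s], the error of the cosine factor and the
   sine term; each cofactor is at most 1 in absolute value. *)
have -> : A * C + B * D - E1 * E2 * cos t =
  (A - E2 * cos t) * C + (C - E1) * (E2 * cos t) + B * D by ring.
rewrite (le_trans (ler_normD _ _))// (le_trans (lerD (ler_normD _ _) (lexx _)))//.
rewrite !normrM.
have b1 : `|A - E2 * cos t| * `|C| <= (delta + 2 * delta ^+ 2) * V.
  by rewrite (le_trans _ IHs)// ler_piMr.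
have b2 : `|C - E1| * (`|E2| * `|cos t|) <= 2 * delta ^+ 2 * v c.
  by rewrite (le_trans _ hc)// -normrM ler_piMr.
have b3 : `|B| * `|D| <= delta * v c by rewrite (le_trans _ hs)// ler_piMl.
lra.
Qed.

End characteristic_clt.

(** * Approximation by trigonometric polynomials *)

Lemma cvg_sumr (R : numFieldType) (T : Type) (F : set_system T) (FF : Filter F) (I : Type)
    (s : seq I) (f : I -> T -> R) (a : I -> R) :
  (forall i, f i x @[x --> F] --> a i) ->
  \sum_(i <- s) f i x @[x --> F] --> \sum_(i <- s) a i.
Proof.
move=> fa; elim: s => [|i s IHs].
  rewrite big_nil (_ : (fun x => _) = cst 0); first exact: cvg_cst.
  by apply/funext => x; rewrite big_nil.
rewrite big_cons (_ : (fun x => _) = (fun x => f i x + \sum_(j <- s) f j x)).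
  exact: cvgD.
by apply/funext => x; rewrite big_cons.
Qed.

Section trigonometric_polynomials.
Context {R : realType} {l : nat}.
Implicit Types (x : 'rV[R]_l) (h g : 'rV[R]_l -> R).

(** The functions whose expectations the transforms determine by linearity. With a phase in each
    term, sines and constants are included, and products stay inside by the product-to-sum
    formula. *)
Inductive trigpoly : ('rV[R]_l -> R) -> Prop :=
| trigpoly_cos a (t : 'I_l -> R) b :
    trigpoly (fun x => a * cos (\sum_k t k * x ord0 k + b))
| trigpolyD h1 h2 :
    trigpoly h1 -> trigpoly h2 -> trigpoly (fun x => h1 x + h2 x).

Lemma eq_trigpoly h1 h2 : h1 =1 h2 -> trigpoly h1 -> trigpoly h2.
Proof. by move=> /funext ->. Qed.

Lemma trigpoly_cst c : trigpoly (cst c).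
Proof.
apply: eq_trigpoly (trigpoly_cos c (fun=> 0) 0) => x.
by rewrite big1 => [|k _]; rewrite ?mul0r// addr0 cos0 mulr1.
Qed.

Lemma trigpoly_sin (a : R) k : trigpoly (fun x => sin (a * x ord0 k)).
Proof.
apply: eq_trigpoly (trigpoly_cos 1 (fun i => a * (i == k)%:R) (- (pi / 2))) => x.
rewrite mul1r (bigD1 k)//= eqxx mulr1 big1 ?addr0 => [|i /negbTE ->]; last first.
  by rewrite mulr0 mul0r.
by rewrite -sinDpihalf subrK.
Qed.

Lemma trigpolyM h1 h2 :
  trigpoly h1 -> trigpoly h2 -> trigpoly (fun x => h1 x * h2 x).
Proof.
move=> H1; elim: H1 h2 => [a t b h2|h h' _ IH _ IH' h2 H2]; last first.
  by apply: eq_trigpoly (trigpolyD (IH _ H2) (IH' _ H2)) => x; rewrite mulrDl.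
elim=> [a' t' b'|h h' _ IH _ IH']; last first.
  by apply: eq_trigpoly (trigpolyD IH IH') => x; rewrite mulrDr.
apply: eq_trigpoly (trigpolyD
  (trigpoly_cos (a * a' / 2) (fun k => t k + t' k) (b + b'))
  (trigpoly_cos (a * a' / 2) (fun k => t k - t' k) (b - b'))) => x.
set A := \sum_k t k * x ord0 k + b; set B := \sum_k t' k * x ord0 k + b'.
have -> : \sum_k (t k + t' k) * x ord0 k + (b + b') = A + B.
  rewrite /A /B addrACA -big_split/=; congr (_ + _).
  by apply: eq_bigr => k _; rewrite mulrDl.
have -> : \sum_k (t k - t' k) * x ord0 k + (b - b') = A - B.
  rewrite /A /B opprD addrACA -sumrN -big_split/=; congr (_ + _).
  by apply: eq_bigr => k _; rewrite mulrBl.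
by rewrite cosD cosB; field.
Qed.

Lemma trigpolyZ a h : trigpoly h -> trigpoly (fun x => a * h x).
Proof. exact: trigpolyM (trigpoly_cst a). Qed.

Lemma trigpoly_sum (I : Type) (s : seq I) (F : I -> 'rV[R]_l -> R) :
  (forall i, trigpoly (F i)) -> trigpoly (fun x => \sum_(i <- s) F i x).
Proof.
move=> hF; elim: s => [|i s IHs].
  by apply: eq_trigpoly (trigpoly_cst 0) => x; rewrite big_nil.
by apply: eq_trigpoly (trigpolyD (hF i) IHs) => x; rewrite big_cons.
Qed.

Lemma trigpoly_prod (I : Type) (s : seq I) (F : I -> 'rV[R]_l -> R) :
  (forall i, trigpoly (F i)) -> trigpoly (fun x => \prod_(i <- s) F i x).
Proof.
move=> hF; elim: s => [|i s IHs].
  by apply: eq_trigpoly (trigpoly_cst 1) => x; rewrite big_nil.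
by apply: eq_trigpoly (trigpolyM (hF i) IHs) => x; rewrite big_cons.
Qed.

End trigonometric_polynomials.

(** * Binomial weights and their variance *)

Section bernstein_weights.
Context {R : realType}.
Implicit Types y c : R.

(* The binomial weights, by Pascal's rule. *)
Fixpoint bernstein (N i : nat) (y : R) : R :=
  if N is N'.+1 then
    (if i is j.+1 then y * bernstein N' j y else 0) + (1 - y) * bernstein N' i y
  else (i == 0%N)%:R.

Lemma bernstein_gt N i y : (N < i)%N -> bernstein N i y = 0.
Proof.
elim: N i => [|N IHN] [|i]//=; rewrite ltnS => Ni.
by rewrite !IHN ?mulr0 ?addr0// ltnW.
Qed.

Lemma bernstein_ge0 N i y : 0 <= y <= 1 -> 0 <= bernstein N i y.
Proof.
move=> /andP[y0 y1]; elim: N i => [|N IHN] i /=; first by rewrite ler0n.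
rewrite addr_ge0//; last by rewrite mulr_ge0 ?subr_ge0.
by case: i => // i; rewrite mulr_ge0.
Qed.

(** Conditioning on one of [N.+1] Bernoulli trials: a success shifts the argument of [F] by one. *)
Lemma bernsteinS N (F : nat -> R) y :
  \sum_(i < N.+2) F i * bernstein N.+1 i y =
  y * \sum_(i < N.+1) F i.+1 * bernstein N i y +
  (1 - y) * \sum_(i < N.+1) F i * bernstein N i y.
Proof.
have -> : \sum_(i < N.+2) F i * bernstein N.+1 i y =
  \sum_(i < N.+2) F i * (if i : nat is j.+1 then y * bernstein N j y else 0) +
  \sum_(i < N.+2) F i * ((1 - y) * bernstein N i y).
  by rewrite -big_split; apply: eq_bigr => i _ /=; rewrite mulrDr.
rewrite [X in X + _ = _]big_ord_recl/= mulr0 add0r.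
rewrite [X in _ + X = _]big_ord_recr/= (bernstein_gt _ (ltnSn N)) !mulr0 addr0.
by rewrite !mulr_sumr; congr (_ + _); apply: eq_bigr => i _; rewrite mulrCA.
Qed.

Lemma bernstein_sum N y : \sum_(i < N.+1) bernstein N i y = 1.
Proof.
have -> : \sum_(i < N.+1) bernstein N i y = \sum_(i < N.+1) 1 * bernstein N i y.
  by apply: eq_bigr => i _; rewrite mul1r.
elim: N => [|N IHN]; first by rewrite big_ord1 mul1r.
by rewrite (bernsteinS N (fun=> 1)) IHN; ring.
Qed.

(** The centre [c] is arbitrary so that the induction closes: a success amounts to replacing [c] by
    [c - 1]. *)
Lemma bernstein_moment N c y :
  \sum_(i < N.+1) (i%:R - c) ^+ 2 * bernstein N i y =
  N%:R * (y * (1 - y)) + (N%:R * y - c) ^+ 2.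
Proof.
elim: N c => [|N IHN] c; first by rewrite big_ord1/=; ring.
rewrite (bernsteinS N (fun i => (i%:R - c) ^+ 2)) IHN.
have -> : \sum_(i < N.+1) (i.+1%:R - c) ^+ 2 * bernstein N i y =
    \sum_(i < N.+1) (i%:R - (c - 1)) ^+ 2 * bernstein N i y.
  by apply: eq_bigr => i _; rewrite -natr1; congr (_ ^+ 2 * _); ring.
by rewrite IHN -natr1; ring.
Qed.

Lemma bernstein_variance N y : 0 <= y <= 1 ->
  \sum_(i < N.+2) (i%:R / N.+1%:R - y) ^+ 2 * bernstein N.+1 i y <= N.+1%:R^-1.
Proof.
move=> /andP[y0 y1]; have N0 : 0 < N.+1%:R :> R by rewrite ltr0n.
have -> : \sum_(i < N.+2) (i%:R / N.+1%:R - y) ^+ 2 * bernstein N.+1 i y =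
    (N.+1%:R ^- 2) * \sum_(i < N.+2) (i%:R - N.+1%:R * y) ^+ 2 * bernstein N.+1 i y.
  rewrite mulr_sumr; apply: eq_bigr => i _; rewrite mulrA; congr (_ * _).
  by field; rewrite gt_eqF.
rewrite bernstein_moment subrr expr0n/= addr0.
have -> : N.+1%:R ^- 2 * (N.+1%:R * (y * (1 - y))) = N.+1%:R^-1 * (y * (1 - y)) :> R.
  by field; rewrite gt_eqF.
by rewrite ler_piMr ?invr_ge0 ?ltW//; nra.
Qed.

End bernstein_weights.

(** * Uniform approximation on a box *)

Section trigonometric_approximation.
Context {R : realType} {l : nat}.
Variables (g : 'rV[R]_l -> R) (K : R).
Hypothesis cg : continuous g.
Hypothesis gK : forall x, `|g x| <= K.
Variable M : R.
Hypothesis M0 : 0 < M.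

(** This scaling maps [[- M, M]] onto [[- pi / 2, pi / 2]], where the sine is injective. *)
Let a : R := pi / (2 * M).
Let a0 : 0 < a. Proof. by rewrite divr_gt0 ?pi_gt0// mulr_gt0. Qed.
Let box := [set x : 'rV[R]_l | forall k, `[- M, M]%classic (x ord0 k)].

Let cbox : compact box.
Proof.
exact: (@rV_compact R l (fun=> `[- M, M]%classic) (fun=> @segment_compact R _ _)).
Qed.

Let sin_inj_box (s t : R) : `[- M, M]%classic s -> `[- M, M]%classic t ->
  sin (a * s) = sin (a * t) -> s = t.
Proof.
have H r : `[- M, M]%classic r -> a * r \in `[- (pi / 2), pi / 2].
  have aM : a * M = pi / 2 by rewrite /a; field; rewrite gt_eqF.
  rewrite /= !in_itv/= => /andP[r1 r2]; rewrite -aM -mulrN.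
  by rewrite !ler_pM2l// r1.
move=> hs ht /(sin_inj (H _ hs) (H _ ht)); apply: mulfI.
by rewrite gt_eqF.
Qed.

(** Pairs of box points with [|g x - g z| >= e] form a compact set. On it the sum of squared sine
    differences is positive, by injectivity of the sine, hence at least some [D p0 > 0]; there the
    crude bound [2 K] is at most [2 K / D p0] times that sum. *)
Let korovkin (e : R) : 0 < e -> exists2 C : R, 0 <= C & forall x z, box x -> box z ->
  `|g x - g z| <= e + C * \sum_k (sin (a * x ord0 k) - sin (a * z ord0 k)) ^+ 2.
Proof.
move=> e0.
pose D (p : 'rV[R]_l * 'rV[R]_l) : R :=
  \sum_k (sin (a * p.1 ord0 k) - sin (a * p.2 ord0 k)) ^+ 2.
pose G (p : 'rV[R]_l * 'rV[R]_l) : R := `|g p.1 - g p.2|.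
have c1 : continuous (fun p : 'rV[R]_l * 'rV[R]_l => g p.1).
  by move=> p; apply: continuous_comp; [exact: cvg_fst|exact: cg].
have c2 : continuous (fun p : 'rV[R]_l * 'rV[R]_l => g p.2).
  by move=> p; apply: continuous_comp; [exact: cvg_snd|exact: cg].
have cG : continuous G.
  by move=> p; apply: cvg_norm; apply: cvgB; [exact: c1|exact: c2].
have csin (f : 'rV[R]_l * 'rV[R]_l -> 'rV[R]_l) k : continuous f ->
    continuous (fun p => sin (a * f p ord0 k)).
  move=> cf.
  have cfk : continuous (fun p => f p ord0 k : R).
    move=> p; apply: (@continuous_comp _ _ _ f (fun x : 'rV[R]_l => x ord0 k)).
      exact: cf.
    exact: coord_continuous.
  have cafk : continuous (fun p => a * f p ord0 k : R).
    by move=> p; apply: cvgM; [exact: cvg_cst|exact: cfk].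
  move=> p; apply: (@continuous_comp _ _ _ (fun p => a * f p ord0 k) sin).
    exact: cafk.
  exact: continuous_sin.
have cD : continuous D.
  have cDk k : continuous (fun p : 'rV[R]_l * 'rV[R]_l =>
      (sin (a * p.1 ord0 k) - sin (a * p.2 ord0 k)) ^+ 2 : R).
    have cB : continuous (fun p : 'rV[R]_l * 'rV[R]_l =>
      sin (a * p.1 ord0 k) - sin (a * p.2 ord0 k) : R).
      move=> p; apply: cvgB.
        by apply: (csin fst) => q; exact: cvg_fst.
      by apply: (csin snd) => q; exact: cvg_snd.
    move=> p; apply: (@continuous_comp _ _ _ (fun p : 'rV[R]_l * 'rV[R]_l =>
      sin (a * p.1 ord0 k) - sin (a * p.2 ord0 k) : R) (fun r : R => r ^+ 2)).
      exact: cB.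
    exact: exprn_continuous.
  by move=> p; rewrite /D; apply: cvg_sumr => k; exact: cDk.
have D0 p : 0 <= D p by apply: sumr_ge0 => k _; exact: sqr_ge0.
have K0 : 0 <= K by apply: le_trans (gK 0).
pose B := (box `*` box) `&` [set p | e <= G p].
have cB : compact B.
  apply: compact_closedI; first exact: compact_setX.
  by move/continuous_closedP : cG => /(_ [set r | e <= r]); apply; exact: closed_ge.
have [B0|/set0P Bn0] := eqVneq B set0.
  exists 0 => // x z hx hz; rewrite mul0r addr0 leNgt; apply/negP => /ltW xz.
  by have : B (x, z) by []; rewrite B0.
have [p0 p0B p0min] := compact_EVT_min Bn0 cB (continuous_subspaceT cD).
have {}p0min x z : B (x, z) -> D p0 <= D (x, z).
  by move=> h; apply: p0min; rewrite inE.
have Dp0 : 0 < D p0.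
  rewrite lt_neqAle D0 andbT eq_sym; apply/negP => /eqP Dp00.
  move: p0B; rewrite inE => -[[h1 h2] /= eG].
  have p12 : p0.1 = p0.2.
    apply/rowP => k; apply: sin_inj_box; [exact: h1|exact: h2|].
    have /eqP := Dp00; rewrite /D psumr_eq0; last by move=> ? _; exact: sqr_ge0.
    by move=> /allP/(_ k); rewrite mem_index_enum sqrf_eq0 subr_eq0 => /(_ isT)/eqP.
  by move: eG; rewrite /G p12 subrr normr0 leNgt e0.
exists (2 * K / D p0) => [|x z hx hz]; first by rewrite divr_ge0// mulr_ge0.
have S0 : 0 <= 2 * K / D p0 * D (x, z).
  by rewrite mulr_ge0// divr_ge0// mulr_ge0.
have [xz|xz] := ltP `|g x - g z| e.
  by rewrite (le_trans (ltW xz))// lerDl.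
rewrite (@le_trans _ _ (2 * K / D p0 * D (x, z)))//; last by rewrite lerDr ltW.
rewrite (@le_trans _ _ (2 * K))//.
  rewrite (le_trans (ler_normB _ _))//.
  by have := gK x; have := gK z; lra.
rewrite -mulrA -[leLHS]mulr1 ler_wpM2l ?mulr_ge0//.
by rewrite mulrC ler_pdivlMr// mul1r; apply: p0min.
Qed.

(** The variables [y k] lie in [[0, 1]] on the whole space, so the approximant is everywhere an
    average of values of [g]. Its bound [K] thus holds outside the box as well, which is what
    controls the tails of random vectors. *)
Lemma trigpoly_approx (e : R) : 0 < e -> exists2 h : 'rV[R]_l -> R, trigpoly h &
  (forall x, `|h x| <= K) /\
  (forall x : 'rV[R]_l, (forall k, `|x ord0 k| <= M) -> `|h x - g x| <= e).
Proof.
move=> e0; have e20 : 0 < e / 2 by rewrite divr_gt0.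
have [C C0 hC] := korovkin e20.
(* The sine is [2 y - 1], so a squared difference of sines is 4 times one of [y]; there are [l]
   coordinates, each of variance at most [1 / N.+1]. *)
have [N hN] : exists N : nat, C * (4 * l%:R) / N.+1%:R <= e / 2.
  exists (Num.trunc (C * (4 * l%:R) / (e / 2))).
  have C40 : 0 <= C * (4 * l%:R) / (e / 2).
    by rewrite divr_ge0 ?mulr_ge0// ltW.
  have /andP[_] := truncn_itv C40; rewrite ltr_pdivrMr// => /ltW h.
  by rewrite ler_pdivrMr ?ltr0n// [leRHS]mulrC.
have N0 : 0 < N.+1%:R :> R by rewrite ltr0n.
pose y k (x : 'rV[R]_l) := (1 + sin (a * x ord0 k)) / 2.
have y01 k x : 0 <= y k x <= 1.
  have := sin_le1 (a * x ord0 k); have := sin_geN1 (a * x ord0 k).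
  by rewrite /y => ? ?; apply/andP; split; lra.
pose nd (i : 'I_N.+2) : R := 2 * (i%:R / N.+1%:R) - 1.
have nd1 i : -1 <= nd i <= 1.
  have h : i%:R / N.+1%:R <= 1 :> R.
    by rewrite ler_pdivrMr// mul1r ler_nat -ltnS.
  have h' : 0 <= i%:R / N.+1%:R :> R by rewrite divr_ge0.
  by move: h h'; rewrite /nd; set q := _ / _ => h h'; apply/andP; split; lra.
(* The node at which each [y k] equals [j k / N.+1]. *)
pose z (j : {ffun 'I_l -> 'I_N.+2}) : 'rV[R]_l := \row_k (asin (nd (j k)) / a).
pose w (j : {ffun 'I_l -> 'I_N.+2}) x := \prod_k bernstein N.+1 (j k) (y k x).
have w0 j x : 0 <= w j x by apply: prodr_ge0 => k _; exact: bernstein_ge0.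
have w1 x : \sum_j w j x = 1.
  rewrite -(bigA_distr_bigA (fun k (i : 'I_N.+2) => bernstein N.+1 i (y k x))).
  by rewrite big1// => k _; rewrite bernstein_sum.
have wvar x k : \sum_(j : {ffun 'I_l -> 'I_N.+2})
    ((j k)%:R / N.+1%:R - y k x) ^+ 2 * w j x <= N.+1%:R^-1.
  (* The squared deviation is put into the factor of coordinate [k], so that the sum over [j]
     becomes a product of one-dimensional sums, all equal to 1 except the one at [k]. *)
  pose F k' (i : 'I_N.+2) := (if k' == k then (i%:R / N.+1%:R - y k x) ^+ 2
    else 1) * bernstein N.+1 i (y k' x).
  have -> : \sum_(j : {ffun 'I_l -> 'I_N.+2}) ((j k)%:R / N.+1%:R - y k x) ^+ 2 * w j x =
      \sum_(j : {ffun 'I_l -> 'I_N.+2}) \prod_k' F k' (j k').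
    apply: eq_bigr => j _; rewrite /F big_split/=; congr (_ * _).
    by rewrite (bigD1 k)//= eqxx big1 ?mulr1// => k' /negPf k'k; rewrite k'k.
  rewrite -(bigA_distr_bigA F) (bigD1 k)//= [X in _ * X]big1 => [|k' /negbTE k'k]; last first.
    rewrite /F k'k -[RHS](bernstein_sum N.+1 (y k' x)).
    by apply: eq_bigr => i _; rewrite mul1r.
  by rewrite mulr1 /F eqxx; exact: bernstein_variance.
have trig_b N' i k : trigpoly (fun x => bernstein N' i (y k x)).
  have ty : trigpoly (y k).
    apply: eq_trigpoly (trigpolyZ 2^-1 (trigpolyD (trigpoly_cst 1)
      (trigpoly_sin a k))) => x.
    by rewrite mulrC.
  elim: N' i => [|N' IH] i /=; first exact: trigpoly_cst.
  apply: trigpolyD.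
    by case: i => [|i]; [exact: trigpoly_cst|exact: trigpolyM].
  apply: trigpolyM => //.
  apply: eq_trigpoly (trigpolyD (trigpoly_cst 1) (trigpolyZ (-1) ty)) => x.
  by rewrite mulN1r.
exists (fun x => \sum_j g (z j) * w j x); last split.
- apply: trigpoly_sum => j; apply: trigpolyZ; apply: trigpoly_prod => k.
  exact: trig_b.
- move=> x; rewrite (le_trans (ler_norm_sum _ _ _))// -[leRHS]mulr1 -(w1 x).
  rewrite mulr_sumr; apply: ler_sum => j _.
  by rewrite normrM (ger0_norm (w0 _ _)) ler_wpM2r.
move=> x hx.
have bx : box x by move=> k /=; rewrite in_itv/= -ler_norml.
have bz j : box (z j).
  have aM' : a * M = pi / 2 by rewrite /a; field; rewrite gt_eqF.
  have aM : M = pi / 2 / a by rewrite -aM' mulrAC divff ?mul1r// gt_eqF.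
  move=> k /=; rewrite mxE in_itv/= aM -mulNr !ler_pM2r ?invr_gt0//.
  by rewrite asin_geNpi2//= asin_lepi2.
have -> : \sum_j g (z j) * w j x - g x = \sum_j (g (z j) - g x) * w j x.
  rewrite -[in LHS](mulr1 (g x)) -(w1 x) mulr_sumr -sumrB.
  by apply: eq_bigr => j _; rewrite mulrBl.
rewrite (le_trans (ler_norm_sum _ _ _))//.
rewrite (@le_trans _ _ (\sum_(j : {ffun 'I_l -> 'I_N.+2}) (e / 2 + C * \sum_k 4 *
    ((j k)%:R / N.+1%:R - y k x) ^+ 2) * w j x))//.
  apply: ler_sum => j _; rewrite normrM (ger0_norm (w0 _ _)) ler_wpM2r//.
  rewrite (le_trans (hC _ _ (bz j) bx))// lerD2l ler_wpM2l//.
  apply: ler_sum => k _; rewrite mxE mulrCA divff ?gt_eqF// mulr1.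
  rewrite asinK ?in_itv//= /nd /y le_eqVlt; apply/orP; left; apply/eqP.
  by field; rewrite gt_eqF.
have -> : \sum_(j : {ffun 'I_l -> 'I_N.+2})
      (e / 2 + C * \sum_k 4 * ((j k)%:R / N.+1%:R - y k x) ^+ 2) * w j x =
    e / 2 + C * \sum_k 4 * \sum_(j : {ffun 'I_l -> 'I_N.+2})
      ((j k)%:R / N.+1%:R - y k x) ^+ 2 * w j x.
  under eq_bigr do rewrite mulrDl.
  rewrite big_split/= -mulr_sumr w1 mulr1; congr (_ + _).
  under eq_bigr do rewrite -mulrA mulr_suml.
  rewrite -mulr_sumr exchange_big/=; congr (_ * _).
  by apply: eq_bigr => k _; rewrite mulr_sumr; apply: eq_bigr => j _; rewrite mulrA.
rewrite [leRHS](_ : e = e / 2 + e / 2); last by lra.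
rewrite lerD2l (le_trans _ hN)// -mulrA ler_wpM2l//.
rewrite (@le_trans _ _ (\sum_(k < l) 4 * N.+1%:R^-1))//.
  by apply: ler_sum => k _; rewrite ler_wpM2l.
by rewrite sumr_const card_ord -(mulr_natr (4 / _) l) mulrAC.
Qed.

End trigonometric_approximation.

(** * Weak convergence *)

Section tails.
Context {d} {T : measurableType d} {R : realType}.
Implicit Types (P : probability T R) (X : T -> R).

Lemma bmf_bool (b : T -> bool) : measurable_fun setT b ->
  bmf (fun w => (b w)%:R : R).
Proof.
move=> mb; apply: (@eq_bmf _ _ _ \1_[set w | b w]) => [w|].
  by rewrite indicE; case bw : (b w); [rewrite mem_set|rewrite memNset//= bw].
apply: bmf_indic; rewrite -[X in measurable X]setTI.
exact: (mb measurableT [set true]).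
Qed.

Lemma bmf_tail X (M : R) : measurable_fun setT X ->
  bmf (fun w => (M < `|X w|)%R%:R : R).
Proof.
move=> mX; apply: bmf_bool; apply: measurable_fun_ltr => //.
exact: measurableT_comp.
Qed.

Lemma tight_rv P X (e : R) : measurable_fun setT X -> 0 < e ->
  exists M : R, Ex P (fun w => (M < `|X w|)%R%:R) <= e.
Proof.
move=> mX e0.
have [|||||_ _] := @dominated_convergence _ T R P setT measurableT
    (fun n w => ((n%:R < `|X w|)%R%:R)%:E) (fun=> 0%E) (fun=> 1%E).
- by move=> n; apply/measurable_EFinP; have [] := bmf_tail n%:R mX.
- by [].
- apply: aeW => w _; apply: cvg_near_cst; near=> n.
  rewrite [_ < _](_ : _ = false)//; apply/negbTE; rewrite -leNgt.
  by near: n; exact: nbhs_infty_ger.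
- exact: (bmf_integrable P (bmf_cst 1)).
- by apply: aeW => w n _; rewrite lee_fin; case: (_ < _); rewrite ?normr1 ?normr0.
rewrite integral0 => /fine_cvgP[_] /cvgrPdist_le /(_ _ e0) [N _ /(_ N (leqnn N))].
rewrite /= sub0r normrN => h; exists N%:R; apply: le_trans h.
exact: ler_norm.
Unshelve. all: by end_near. Qed.

Lemma markov_sqr P X (M : R) : bmf X -> 0 < M ->
  Ex P (fun w => (M < `|X w|)%R%:R) <= M ^- 2 * Ex P (fun w => X w * X w).
Proof.
move=> hX M0; rewrite -ExZ; last exact: bmfM.
apply: le_Ex => [||w]; first by apply: bmf_tail; have [] := hX.
  by apply: bmfZ; exact: bmfM.
case: ltP => [MX|_] /=.
  rewrite mulrC ler_pdivlMr ?exprn_gt0// mul1r -expr2 -[leRHS]real_normK ?num_real//.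
  by rewrite ler_pXn2r ?nnegrE// ltW.
by rewrite -expr2 mulr_ge0 ?sqr_ge0// invr_ge0 exprn_ge0// ltW.
Qed.

End tails.

Section trigpoly_random_vectors.
Context {R : realType} {l : nat}.

Lemma bmf_lin d (T : measurableType d) (Y : 'I_l -> T -> R) (t : 'I_l -> R) :
  (forall k, measurable_fun setT (Y k)) ->
  measurable_fun setT (fun w => \sum_k t k * Y k w).
Proof.
move=> mY; apply: measurable_sum => k; apply: measurable_funM => //.
Qed.

Lemma bmf_trigpoly d (T : measurableType d) (Y : 'I_l -> T -> R)
    (h : 'rV[R]_l -> R) : (forall k, measurable_fun setT (Y k)) ->
  trigpoly h -> bmf (fun w => h (\row_k Y k w)).
Proof.
move=> mY; elim=> [a t b|h1 h2 _ IH1 _ IH2]; last exact: bmfD.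
apply: (@eq_bmf _ _ _ (fun w => a * cos (\sum_k t k * Y k w + b))).
  by move=> w; congr (_ * cos (_ + _)); apply: eq_bigr => k _; rewrite mxE.
by apply/bmfZ/bmf_cos; apply: measurable_funD => //; exact: bmf_lin.
Qed.

(** Measurability comes from the approximation: the composite is a pointwise limit of trigonometric
    polynomials in [Y], the [n]-th being within [1 / n.+1] of [g] on the box of radius [n.+1]. *)
Lemma bmf_continuous d (T : measurableType d) (Y : 'I_l -> T -> R)
    (g : 'rV[R]_l -> R) (K : R) : (forall k, measurable_fun setT (Y k)) ->
  continuous g -> (forall x, `|g x| <= K) -> bmf (fun w => g (\row_k Y k w)).
Proof.
move=> mY cg gK; split; last by exists K.
have /choice[h hh] (n : nat) : exists h : 'rV[R]_l -> R, trigpoly h /\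
    forall x : 'rV[R]_l, (forall k, `|x ord0 k| <= n.+1%:R) ->
      `|h x - g x| <= n.+1%:R^-1.
  have n0 : 0 < n.+1%:R :> R by rewrite ltr0n.
  have n0' : 0 < n.+1%:R^-1 :> R by rewrite invr_gt0.
  by have [h th [_ hg]] := trigpoly_approx cg gK n0 n0'; exists h.
apply: (@measurable_fun_cvg _ _ _ _ (fun n w => h n (\row_k Y k w))) => [n|w _].
  by have [] := bmf_trigpoly mY (hh n).1.
apply/cvgrPdist_le => e e0; near=> n.
rewrite distrC (le_trans ((hh n).2 _ _))//.
  move=> k; rewrite mxE (@le_trans _ _ (\sum_i `|Y i w|))//.
    by rewrite (bigD1 k)//= lerDl sumr_ge0.
  rewrite (@le_trans _ _ n%:R)//; last by rewrite ler_nat.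
  by near: n; exact: nbhs_infty_ger.
rewrite invf_ple ?posrE ?ltr0n// (@le_trans _ _ n%:R)//; last by rewrite ler_nat.
by near: n; exact: nbhs_infty_ger.
Unshelve. all: by end_near. Qed.

(** When all coordinates are at most [M] the two functions differ by at most [e], otherwise by at
    most [2 K]; the sum of tails is a union bound. *)
Lemma Ex_trigpoly_dist d (T : measurableType d) (P : probability T R)
    (Y : 'I_l -> T -> R) (g h : 'rV[R]_l -> R) (K M e : R) :
  (forall k, measurable_fun setT (Y k)) ->
  continuous g -> (forall x, `|g x| <= K) -> trigpoly h -> (forall x, `|h x| <= K) ->
  (forall x : 'rV[R]_l, (forall k, `|x ord0 k| <= M) -> `|h x - g x| <= e) -> 0 <= e ->
  `|Ex P (fun w => g (\row_k Y k w)) - Ex P (fun w => h (\row_k Y k w))| <=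
  e + 2 * K * \sum_k Ex P (fun w => (M < `|Y k w|)%R%:R).
Proof.
move=> mY cg gK th hK hg e0.
have bg := bmf_continuous mY cg gK; have bh := bmf_trigpoly mY th.
have bt k : bmf (fun w => (M < `|Y k w|)%R%:R : R) by exact: bmf_tail.
have bS : bmf (fun w => \sum_k (M < `|Y k w|)%R%:R : R) by exact: bmf_sum.
have K0 : 0 <= K by apply: le_trans (gK 0).
rewrite -ExB// (le_trans (Ex_norm _ (bmfB bg bh)))//.
rewrite -Ex_sum// -ExZ// -[X in _ <= X + _](Ex_cst P e) -ExD; last 2 first.
- exact: bmf_cst.
- exact: bmfZ.
apply: le_Ex => [||w]; first exact: bmf_norm (bmfB bg bh).
  by apply: bmfD; [exact: bmf_cst|exact: bmfZ].
have [[k Mk]|nM] := pselect (exists k, M < `|Y k w|).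
  rewrite (@le_trans _ _ (2 * K))//.
    rewrite (le_trans (ler_normB _ _))//.
    by have := gK (\row_k Y k w); have := hK (\row_k Y k w); lra.
  rewrite (bigD1 k)//= Mk mulrDr mulr1 addrCA lerDl addr_ge0//.
  by rewrite mulr_ge0 ?mulr_ge0// sumr_ge0.
rewrite distrC (le_trans (hg _ _))//.
  move=> k; rewrite mxE leNgt; apply/negP => Mk; apply: nM; exists k; exact: Mk.
by rewrite lerDl mulr_ge0 ?mulr_ge0// sumr_ge0.
Qed.

Lemma cvg_Ex_trigpoly d (T : forall m : nat, measurableType (d m))
    (P : forall m, probability (T m) R) (Y : forall m, 'I_l -> T m -> R)
    d' (T' : measurableType d') (P' : probability T' R) (X : 'I_l -> T' -> R)
    (h : 'rV[R]_l -> R) :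
  (forall m k, measurable_fun setT (Y m k)) -> (forall k, measurable_fun setT (X k)) ->
  (forall t b, Ex (P m) (fun w => cos (\sum_k t k * Y m k w + b)) @[m --> \oo] -->
     Ex P' (fun w => cos (\sum_k t k * X k w + b))) ->
  trigpoly h ->
  Ex (P m) (fun w => h (\row_k Y m k w)) @[m --> \oo] -->
  Ex P' (fun w => h (\row_k X k w)).
Proof.
move=> mY mX hcos; elim=> [a t b|h1 h2 th1 IH1 th2 IH2].
  have E d0 (T0 : measurableType d0) (P0 : probability T0 R) (Z : 'I_l -> T0 -> R) :
      (forall k, measurable_fun setT (Z k)) ->
      Ex P0 (fun w => a * cos (\sum_k t k * (\row_k Z k w) ord0 k + b)) =
      a * Ex P0 (fun w => cos (\sum_k t k * Z k w + b)).
    move=> mZ; rewrite -ExZ.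
      apply: eq_Ex => w; congr (_ * cos (_ + _)).
      by apply: eq_bigr => k _; rewrite mxE.
    by apply: bmf_cos; apply: measurable_funD => //; exact: bmf_lin.
  rewrite E//; under eq_fun do rewrite E//.
  by apply: cvgM; [exact: cvg_cst|exact: hcos].
have b1 m := bmf_trigpoly (mY m) th1; have b2 m := bmf_trigpoly (mY m) th2.
rewrite ExD; [|exact: bmf_trigpoly..].
have -> : (fun m => Ex (P m) (fun w => h1 (\row_k Y m k w) + h2 (\row_k Y m k w))) =
  (fun m => Ex (P m) (fun w => h1 (\row_k Y m k w)) +
            Ex (P m) (fun w => h2 (\row_k Y m k w))).
  by apply/funext => m; rewrite ExD.
exact: cvgD.
Qed.

(* Levy's continuity theorem, tightness being assumed. *)
Theorem cvg_Ex_continuous d (T : forall m : nat, measurableType (d m))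
    (P : forall m, probability (T m) R) (Y : forall m, 'I_l -> T m -> R)
    d' (T' : measurableType d') (P' : probability T' R) (X : 'I_l -> T' -> R)
    (g : 'rV[R]_l -> R) (K : R) :
  (forall m k, measurable_fun setT (Y m k)) -> (forall k, measurable_fun setT (X k)) ->
  (forall e, 0 < e -> exists M, forall k, \forall m \near \oo,
     Ex (P m) (fun w => (M < `|Y m k w|)%R%:R) <= e) ->
  (forall t b, Ex (P m) (fun w => cos (\sum_k t k * Y m k w + b)) @[m --> \oo] -->
     Ex P' (fun w => cos (\sum_k t k * X k w + b))) ->
  continuous g -> (forall x, `|g x| <= K) ->
  Ex (P m) (fun w => g (\row_k Y m k w)) @[m --> \oo] -->
  Ex P' (fun w => g (\row_k X k w)).
Proof.
move=> mY mX tight hcos cg gK; apply/cvgrPdist_le => e e0.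
have K0 : 0 <= K by apply: le_trans (gK 0).
(* Three errors [e1] come from the two approximations by [h] and the convergence for [h]; each of
   the two comparisons adds tails of at most [2 K l e1]. *)
pose e1 : R := e / (3 + 4 * K * l%:R).
have D0 : 0 < 3 + 4 * K * l%:R :> R by rewrite ltr_pwDl// mulr_ge0// mulr_ge0.
have e10 : 0 < e1 by rewrite divr_gt0.
have [M1 hM1] := tight _ e10.
have /choice[M2 hM2] k := tight_rv P' (mX k) e10.
(* One level for the whole sequence and all coordinates of the limit; the sum of absolute values
   stands in for a maximum. *)
pose M := 1 + `|M1| + \sum_k `|M2 k|.
have M0 : 0 < M by rewrite ltr_wpDr ?sumr_ge0// ltr_wpDr.
have tailM d0 (T0 : measurableType d0) (P0 : probability T0 R) (Z : T0 -> R) M3 :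
    measurable_fun setT Z -> M3 <= M -> Ex P0 (fun w => (M3 < `|Z w|)%R%:R) <= e1 ->
    Ex P0 (fun w => (M < `|Z w|)%R%:R) <= e1.
  move=> mZ M3M; apply: le_trans; apply: le_Ex => [||w]; [exact: bmf_tail..|].
  by have [h|//] := ltP M `|Z w|; rewrite (le_lt_trans M3M h).
have tX k : Ex P' (fun w => (M < `|X k w|)%R%:R) <= e1.
  apply: tailM (hM2 k) => //; rewrite /M (bigD1 k)//= (le_trans (ler_norm _))//.
  by rewrite addrCA lerDl addr_ge0 ?addr_ge0// sumr_ge0.
have M1M : M1 <= M.
  have S0 : 0 <= \sum_k `|M2 k| by exact: sumr_ge0.
  by have := ler_norm M1; rewrite /M; lra.
have [h th [hK hg]] := trigpoly_approx cg gK M0 e10.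
have /cvgrPdist_le /(_ _ e10) ch := cvg_Ex_trigpoly mY mX hcos th.
have tY : \forall m \near \oo, forall k, Ex (P m) (fun w => (M < `|Y m k w|)%R%:R) <= e1.
  have H k : \forall m \near \oo, Ex (P m) (fun w => (M < `|Y m k w|)%R%:R) <= e1.
    by apply: filterS (hM1 k) => m; exact: tailM.
  exact: filter_forall.
near=> m.
have hm : `|Ex P' (fun w => h (\row_k X k w)) - Ex (P m) (fun w => h (\row_k Y m k w))| <= e1.
  by near: m.
have tYm : forall k, Ex (P m) (fun w => (M < `|Y m k w|)%R%:R) <= e1 by near: m.
have dX := Ex_trigpoly_dist P' mX cg gK th hK hg (ltW e10).
have dY := Ex_trigpoly_dist (P m) (mY m) cg gK th hK hg (ltW e10).
have sum_le (F : 'I_l -> R) : (forall k, F k <= e1) ->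
    2 * K * \sum_k F k <= 2 * K * (l%:R * e1).
  move=> hF; rewrite ler_wpM2l ?mulr_ge0//.
  rewrite (@le_trans _ _ (\sum_(k < l) e1))//; first exact: ler_sum.
  by rewrite sumr_const card_ord mulr_natl.
have := sum_le _ tX; have := sum_le _ tYm.
move: dX dY hm; set A := Ex P' _; set B := Ex P' _; set C := Ex (P m) _; set D := Ex (P m) _.
set S1 := \sum_k _; set S2 := \sum_k _ => dX dY hm s2 s1.
have -> : e = e1 * (3 + 4 * K * l%:R) by rewrite /e1 divfK// gt_eqF.
have -> : A - C = (A - B) + (B - D) - (C - D) by ring.
rewrite (le_trans (ler_normB _ _))// (le_trans (lerD (ler_normD _ _) (lexx _)))//.
apply: (@le_trans _ _ ((e1 + 2 * K * (l%:R * e1)) + e1 + (e1 + 2 * K * (l%:R * e1)))).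
  by apply: lerD; first apply: lerD; lra.
by rewrite le_eqVlt; apply/orP; left; apply/eqP; ring.
Unshelve. all: by end_near. Qed.

End trigpoly_random_vectors.

(** * Laws are determined by their cosine transforms *)

Section uniqueness.
Context {R : realType}.

(** The open left half-lines generate the Borel sets; [setT] is added because [weighted_law_unique]
    asks for it. *)
Let GG : set (set R) := RGenInftyO.G (R := R) `|` [set setT].

Let measurable_GG : @measurable _ R = <<s GG >>.
Proof.
rewrite [LHS](RGenInftyO.measurableE R) eqEsubset; split => A.
  apply: smallest_sub; first exact: smallest_sigma_algebra.
  by move=> B GB; apply: sub_sigma_algebra; left.
apply: smallest_sub; first exact: smallest_sigma_algebra.
move=> B [GB|->]; first exact: sub_sigma_algebra.
exact: measurableT.
Qed.

(** Applied to a constant sequence, the convergence theorem yields equality on bounded continuous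
    functions. Continuous ramps then reach the indicators of half-lines, which generate. *)
Lemma cos_transform_unique d1 d2 (T1 : measurableType d1) (T2 : measurableType d2)
    (P1 : probability T1 R) (P2 : probability T2 R) (Y1 : T1 -> R) (Y2 : T2 -> R) :
  measurable_fun setT Y1 -> measurable_fun setT Y2 ->
  (forall s b, Ex P1 (fun w => cos (s * Y1 w + b)) = Ex P2 (fun w => cos (s * Y2 w + b))) ->
  forall h, bmf h -> Ex P1 (fun w => h (Y1 w)) = Ex P2 (fun w => h (Y2 w)).
Proof.
move=> mY1 mY2 hcos.
have hcont (g : R -> R) : continuous g -> (forall x, `|g x| <= 1) ->
    Ex P1 (fun w => g (Y1 w)) = Ex P2 (fun w => g (Y2 w)).
  move=> cg g1; pose g' (x : 'rV[R]_1) := g (x ord0 ord0).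
  have cg' : continuous g'.
    move=> x; apply: (@continuous_comp _ _ _ (fun x : 'rV[R]_1 => x ord0 ord0) g).
      exact: coord_continuous.
    exact: cg.
  have := @cvg_Ex_continuous R 1 (fun=> d1) (fun=> T1) (fun=> P1) (fun _ _ => Y1)
    d2 T2 P2 (fun=> Y2) g' 1 (fun _ _ => mY1) (fun=> mY2).
  have E d0 (T0 : measurableType d0) (P0 : probability T0 R) (Z : T0 -> R) :
      Ex P0 (fun w => g' (\row__ Z w)) = Ex P0 (fun w => g (Z w)).
    by apply: eq_Ex => w; rewrite /g' mxE.
  rewrite !E => H.
  have {}H : (fun _ : nat => Ex P1 (fun w => g (Y1 w))) @ \oo -->
      Ex P2 (fun w => g (Y2 w)).
    apply: H => // [e e0|t b|x]; last exact: g1.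
      by have [M hM] := tight_rv P1 mY1 e0; exists M => _; exact: nearW.
    rewrite (_ : (fun _ : nat => _) = cst (Ex P2
      (fun w => cos (\sum_k t k * Y2 w + b)))); first exact: cvg_cst.
    apply/funext => _ /=.
    have E' d0 (T0 : measurableType d0) (P0 : probability T0 R) (Z : T0 -> R) :
        Ex P0 (fun w => cos (\sum_(k < 1) t k * Z w + b)) =
        Ex P0 (fun w => cos (t ord0 * Z w + b)).
      by apply: eq_Ex => w; rewrite big_ord1.
    by rewrite !E'.
  apply: cvg_unique H => //; exact: cvg_cst.
have E d0 (T0 : measurableType d0) (P0 : probability T0 R) (Z : T0 -> R) f :
    Ex P0 (fun w => f (Z w)) = Ex P0 (fun w => f (Z w) * cst 1 w).
  by apply: eq_Ex => w; rewrite mulr1.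
move=> h hh; rewrite !E.
apply: (@weighted_law_unique _ _ _ T1 T2 R R P1 P2 Y1 Y2 (cst 1) (cst 1) GG) => //.
- move=> A B [[x ->]|->]; last by rewrite setTI.
  move=> [[y ->]|->]; last by rewrite setIT; left; exists x.
  left; exists (Num.min x y); apply/seteqP; split => z /=; rewrite !in_itv/= lt_min.
    by move=> [-> ->].
  by move=> /andP.
- by right.
- exact: bmf_cst.
- exact: bmf_cst.
move=> A [[a ->]|->]; last first.
  by rewrite -!E; apply: (hcont \1_setT) => [x|x]; rewrite indicT ?normr1//; exact: cvg_cst.
rewrite -!E.
(* For positive [n], a ramp equal to 0 from [a] on and to 1 up to [a - 1 / n]; it tends pointwise to
   the indicator of []-oo, a[]. *)
pose r (n : nat) (x : R) : R := Num.min 1 (Num.max 0 (n%:R * (a - x))).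
have cr n : continuous (r n).
  move=> x; pose f0 : R -> R^o := fun y => n%:R * (a - y).
  have c0 : {for x, continuous f0}.
    apply: cvgM; first exact: cvg_cst.
    by apply: cvgB; [exact: cvg_cst|exact: cvg_id].
  have c1 : {for x, continuous ((fun=> 0 : R^o) \max f0)}.
    by apply: continuous_max => //; exact: cvg_cst.
  have c2 : {for x, continuous ((fun=> 1 : R^o) \min ((fun=> 0 : R^o) \max f0))}.
    by apply: continuous_min => //; exact: cvg_cst.
  exact: c2.
have r1 n x : `|r n x| <= 1.
  rewrite ger0_norm; first by rewrite /r ge_min lexx.
  by rewrite /r le_min ler01 le_max lexx.
have cvgr d0 (T0 : measurableType d0) (P0 : probability T0 R) (Z : T0 -> R) :
    measurable_fun setT Z ->
    Ex P0 (fun w => r n (Z w)) @[n --> \oo] --> Ex P0 (fun w => \1_(`]-oo, a[) (Z w)).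
  move=> mZ.
  have hr n : bmf (fun w => r n (Z w)).
    split; last by exists 1.
    apply: measurableT_comp => //; exact: continuous_measurable_fun.
  have hi : bmf (fun w => \1_(`]-oo, a[) (Z w) : R).
    by apply: bmf_comp => //; apply: bmf_indic; exact: measurable_itv.
  have [|||||_ _] := @dominated_convergence _ T0 R P0 setT measurableT
      (fun n w => (r n (Z w))%:E) (fun w => (\1_(`]-oo, a[) (Z w))%:E) (fun=> 1%E).
  - by move=> n; apply/measurable_EFinP; have [] := hr n.
  - by apply/measurable_EFinP; have [] := hi.
  - apply: aeW => w _; apply: cvg_near_cst; near=> n; congr (_%:E).
    have [Za|aZ] := ltP (Z w) a; last first.
      rewrite indicE memNset /=; last by rewrite in_itv/= ltNge aZ.
      rewrite /r; apply/eqP; rewrite eq_le le_min ler01 le_max lexx/= andbT.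
      by rewrite ge_min ge_max lexx /= mulr_ge0_le0 ?orbT// subr_le0.
    rewrite indicE mem_set /=; last by rewrite in_itv.
    apply/eqP; rewrite eq_le ge_min lexx/= le_min lexx/= le_max; apply/orP; right.
    rewrite -ler_pdivrMr ?subr_gt0// mul1r.
    by near: n; exact: nbhs_infty_ger.
  - exact: (bmf_integrable P0 (bmf_cst 1)).
  - by apply: aeW => w n _; rewrite lee_fin.
  - by rewrite EFin_Ex// => /fine_cvgP[_].
apply: cvg_unique (cvgr _ _ P1 _ mY1) _ => //.
rewrite (_ : (fun n : nat => _) = (fun n => Ex P2 (fun w => r n (Y2 w)))).
  exact: cvgr.
by apply/funext => n; exact: hcont.
Unshelve. all: by end_near. Qed.

End uniqueness.

(** * The normal law *)

Section integral_of_derivative.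
Context {R : realType}.
Notation mu := (@lebesgue_measure R).

(** The fundamental theorem on [[- n, n]], then dominated convergence; limits along the integers
    suffice because [f] is integrable. *)
Lemma Rintegral_derive_eq0 (F f : R -> R) :
  (forall x : R, is_derive x 1 F (f x)) -> continuous f ->
  mu.-integrable setT (EFin \o f) ->
  F n%:R @[n --> \oo] --> 0 -> F (- n%:R) @[n --> \oo] --> 0 ->
  \int[mu]_x f x = 0.
Proof.
move=> dF cf intf F1 F2.
have mf : measurable_fun setT f by apply: continuous_measurable_fun.
have cF x : {for x, continuous F}.
  have [dFx _] := dF x; exact/differentiable_continuous/derivable1_diffP.
have ftc (n : nat) : (0 < n)%N ->
    (\int[mu]_(x in `[(- n%:R)%R, n%:R%R]) (f x)%:E = (F n%:R - F (- n%:R))%:E)%E.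
  move=> n0; rewrite EFinB; apply: continuous_FTC2 => //.
  - by rewrite gtrN// ltr0n.
  - exact: continuous_subspaceT.
  - split.
    + by move=> x _; have [] := dF x.
    + by apply: cvg_at_right_filter; exact: cF.
    + by apply: cvg_at_left_filter; exact: cF.
  - by move=> x _; rewrite derive1E; have [_ ->] := dF x.
have [|||||_ _ H] := @dominated_convergence _ _ R mu setT measurableT
    (fun (n : nat) (x : R) => (f x * \1_(`[- n%:R, n%:R]%classic : set R) x)%:E) (EFin \o f)
    (fun x => `|f x|%:E).
- move=> n; apply/measurable_EFinP; apply: measurable_funM; first exact: mf.
  by apply: measurable_indic; exact: measurable_itv.
- exact/measurable_EFinP.
- apply: aeW => x _; apply: cvg_near_cst; near=> n.
  rewrite /= indicE mem_set ?mulr1//= in_itv/= -ler_norml.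
  by near: n; exact: nbhs_infty_ger.
- exact: integrable_norm intf.
- apply: aeW => x n _; rewrite lee_fin normrM ler_piMr// indicE.
  by case: (_ \in _); rewrite ?normr1 ?normr0.
have {}H : (F n%:R - F (- n%:R))%:E @[n --> \oo] --> (\int[mu]_x (f x)%:E)%E.
  apply: cvg_trans H; apply: near_eq_cvg; near=> n.
  rewrite /= -ftc//; last by near: n; exact: nbhs_infty_gt.
  rewrite [RHS]integral_mkcond; apply: eq_integral => x _.
  by rewrite patchE indicE; case: ifPn => _; rewrite ?mulr1 ?mulr0.
have H0 : (F n%:R - F (- n%:R))%:E @[n --> \oo] --> 0%:E.
  by apply: cvg_EFin; [exact: nearW|rewrite -[X in _ --> X](subrr 0); exact: cvgB].
have := cvg_unique _ H H0; rewrite /Rintegral => ->//.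
Unshelve. all: by end_near. Qed.

End integral_of_derivative.

Section normal_characteristic_function.
Context {R : realType}.
Variables (s th : R).
Hypothesis s0 : s != 0.
Notation mu := (@lebesgue_measure R).
Let p : R -> R := normal_pdf 0 s.

Let pE x : p x = normal_peak s * expR (- (x ^+ 2 / (s ^+ 2 *+ 2))).
Proof. by rewrite /p normal_pdfE// /normal_fun subr0 mulNr. Qed.

Let p0 x : 0 <= p x. Proof. exact: normal_pdf_ge0. Qed.

Let s20 : 0 < s ^+ 2. Proof. by rewrite exprn_even_gt0. Qed.

Let cp : continuous p. Proof. by apply: continuous_normal_pdf. Qed.

Let mp : measurable_fun setT p. Proof. exact: measurable_normal_pdf. Qed.

Let intp : mu.-integrable setT (EFin \o p). Proof. exact: integrable_normal_pdf. Qed.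

Let dp (x : R) : is_derive x 1 p (- (x / s ^+ 2) * p x).
Proof.
have -> : p = fun x => normal_peak s * expR (- (x ^+ 2 / (s ^+ 2 *+ 2))).
  by apply/funext => y; exact: pE.
have d1 : is_derive x 1 (fun x : R => - (x ^+ 2 / (s ^+ 2 *+ 2))) (- (x / s ^+ 2)).
  apply: is_derive_eq; rewrite !scaler0 add0r /GRing.scale/=.
  by field.
have d2 := @is_derive1_comp R expR (fun x => - (x ^+ 2 / (s ^+ 2 *+ 2))) x _ _
    (is_derive_expR _) d1.
have d3 := is_deriveZ (normal_peak s) d2.
by apply: (is_derive_eq d3); rewrite /GRing.scale/=; ring.
Qed.

Let p_decay n : p n.+1%:R <= normal_peak s * (s ^+ 2 *+ 2) * n.+1%:R^-1.
Proof.
have n0 : 0 < n.+1%:R :> R by rewrite ltr0n.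
have n1 : 1 <= n.+1%:R :> R by rewrite ler1n.
have S0 : 0 < s ^+ 2 *+ 2 by rewrite mulrn_wgt0.
rewrite pE -mulrA ler_wpM2l ?normal_peak_ge0// expRN -[leRHS]invrK.
rewrite lef_pV2 ?posrE ?expR_gt0 ?invr_gt0 ?mulr_gt0 ?invr_gt0//.
apply: le_trans (_ : 1 + n.+1%:R ^+ 2 / (s ^+ 2 *+ 2) <= _); last exact: expR_ge1Dx.
rewrite ler_wpDl// invfM invrK mulrC ler_pM2r ?invr_gt0//.
by rewrite expr2 ler_peMr// ltW.
Qed.

Let F (u : R) (x : R) : R := cos (u * x + th) * p x.

Let p2 : R -> R := normal_pdf 0 (Num.sqrt 2 * s).

(** Majorant for the [u]-derivative of the integrand [F u x]: half of the Gaussian exponent absorbs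
    the factor [|x|], the other half is proportional to the normal density of variance [2 s^2]. *)
Let G x : R := (1 + s ^+ 2 *+ 4) * (normal_peak s / normal_peak (Num.sqrt 2 * s)) * p2 x.

Let s20' : Num.sqrt 2 * s != 0.
Proof. by rewrite mulf_neq0// gt_eqF// sqrtr_gt0. Qed.

Let intG : mu.-integrable setT (EFin \o G).
Proof.
rewrite (_ : EFin \o G = (fun x => ((1 + s ^+ 2 *+ 4) *
    (normal_peak s / normal_peak (Num.sqrt 2 * s)))%:E * (p2 x)%:E)%E).
  by apply: integrableZl => //; exact: integrable_normal_pdf.
by apply/funext => x; rewrite /= EFinM.
Qed.

Let G_ge0 x : 0 <= G x.
Proof.
rewrite /G !mulr_ge0// ?invr_ge0 ?normal_peak_ge0//; last exact: normal_pdf_ge0.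
by rewrite addr_ge0// mulrn_wge0// ltW.
Qed.

(** With [y = x^2 / (4 s^2)], one has [|x| <= 1 + x^2 = 1 + 4 s^2 y], and both [exp (- y)] and
    [y exp (- y)] are at most 1; hence the constant [1 + 4 s^2]. *)
Let xp_le x : `|x| * p x <= G x.
Proof.
have P20 : 0 < normal_peak (Num.sqrt 2 * s) by exact: normal_peak_gt0.
rewrite /G /p2 normal_pdfE// /normal_fun subr0 pE exprMn sqr_sqrtr//.
have -> : - x ^+ 2 / ((2 * s ^+ 2) *+ 2) = - (x ^+ 2 / (s ^+ 2 *+ 4)).
  by rewrite mulNr; congr (- (_ / _)); ring.
have -> : - (x ^+ 2 / (s ^+ 2 *+ 2)) =
    - (x ^+ 2 / (s ^+ 2 *+ 4)) - (x ^+ 2 / (s ^+ 2 *+ 4)).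
  by field.
rewrite expRD; set y := x ^+ 2 / _; set E := expR (- y).
have E0 : 0 < E by exact: expR_gt0.
have -> : (1 + s ^+ 2 *+ 4) * (normal_peak s / normal_peak (Num.sqrt 2 * s)) *
    (normal_peak (Num.sqrt 2 * s) * E) = normal_peak s * E * (1 + s ^+ 2 *+ 4).
  by field; rewrite gt_eqF.
rewrite [leLHS](_ : _ = normal_peak s * E * (`|x| * E)); last by ring.
rewrite ler_wpM2l//.
  by rewrite mulr_ge0 ?normal_peak_ge0// ltW.
have S4 : 0 < s ^+ 2 *+ 4 by rewrite mulrn_wgt0.
have xy : x ^+ 2 = s ^+ 2 *+ 4 * y by rewrite /y mulrCA divff ?mulr1// gt_eqF.
have y0 : 0 <= y by rewrite divr_ge0 ?sqr_ge0// ltW.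
have xle : `|x| <= 1 + x ^+ 2.
  by rewrite -[x ^+ 2]real_normK ?num_real//; have := normr_ge0 x; nra.
have Ey : E * (1 + y) <= 1.
  by rewrite /E expRN mulrC ler_pdivrMr ?expR_gt0// mul1r; exact: expR_ge1Dx.
apply: le_trans (_ : (1 + x ^+ 2) * E <= _); first by rewrite ler_wpM2r// ltW.
rewrite xy; nra.
Qed.

Let mF u : measurable_fun setT (F u).
Proof.
apply: measurable_funM => //; apply: measurableT_comp.
  by apply: continuous_measurable_fun; exact: continuous_cos.
by apply: measurable_funD => //; exact: measurable_funM.
Qed.

Let intF u : mu.-integrable setT (EFin \o F u).
Proof.
apply: (@le_integrable _ _ _ mu _ measurableT _ (EFin \o p)) => //.
  by apply/measurable_EFinP; exact: mF.
move=> x _; rewrite lee_fin normrM ler_piMl// ler_norml.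
by rewrite cos_geN1 cos_le1.
Qed.

Let dF (u x : R) : is_derive u 1 (F^~ x) (- (x * sin (u * x + th)) * p x).
Proof.
have d1 : is_derive u 1 (fun u : R => u * x + th) x.
  by apply: is_derive_eq; rewrite !scaler0 add0r addr0 /GRing.scale/= mulr1.
have d2 := @is_derive1_comp R cos (fun u => u * x + th) u _ _ (is_derive_cos _) d1.
have -> : F^~ x = p x \*: (cos \o (fun u => u * x + th)).
  by apply/funext => v; rewrite /F /= mulrC.
apply: (is_derive_eq (is_deriveZ (p x) d2)); rewrite /GRing.scale/=.
ring.
Qed.

Let phi u : R := \int[mu]_x F u x.

Let dphi (u : R) : is_derive u 1 phi (\int[mu]_x (- (x * sin (u * x + th)) * p x)).
Proof.
have Iu : `]u - 1, u + 1[%classic u by rewrite /= in_itv/= gtrBl ltrDl ltr01.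
have h1 x : `]u - 1, u + 1[%classic x -> mu.-integrable setT (EFin \o F x).
  by move=> _; exact: intF.
have h2 x y : `]u - 1, u + 1[%classic x -> setT y -> derivable (F ^~ y) x 1.
  by move=> _ _; have [] := dF x y.
have h3 x y : `]u - 1, u + 1[%classic x -> setT y -> `|partial1of2 F x y| <= G y.
  move=> _ _; rewrite partial1of2E; have [_ ->] := dF x y.
  rewrite mulNr normrN normrM (ger0_norm (p0 _)) normrM.
  apply: le_trans (xp_le y); rewrite ler_wpM2r// ler_piMr//.
  by rewrite ler_norml sin_geN1 sin_le1.
split; first exact: (derivable_under_integral measurableT Iu h1 h2 G_ge0 intG h3).
rewrite -derive1E.
rewrite (differentiation_under_integral measurableT Iu h1 h2 G_ge0 intG h3).
apply: eq_Rintegral => x _; rewrite partial1of2E.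
by have [_ ->] := dF u x.
Qed.

Let intS u : mu.-integrable setT (EFin \o (fun x => - (x * sin (u * x + th)) * p x)).
Proof.
apply: (@le_integrable _ _ _ mu _ measurableT _ (EFin \o G)) => //.
  apply/measurable_EFinP; apply: measurable_funM => //.
  apply: measurableT_comp => //; apply: measurable_funM => //.
  apply: measurableT_comp; first by apply: continuous_measurable_fun; exact: continuous_sin.
  by apply: measurable_funD => //; exact: measurable_funM.
move=> x _; rewrite lee_fin mulNr normrN normrM (ger0_norm (p0 _)) normrM.
rewrite (ger0_norm (G_ge0 _)); apply: le_trans (xp_le x); rewrite ler_wpM2r// ler_piMr//.
by rewrite ler_norml sin_geN1 sin_le1.
Qed.

(** Integration by parts: [H] vanishes at infinity, and its derivative combines the two integrands.
    Together with [dphi] this is the differential equation [phi' = - s^2 u phi]. *)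
Let parts u : \int[mu]_x (- (x * sin (u * x + th)) * p x) = - (s ^+ 2 * u) * phi u.
Proof.
pose H x := sin (u * x + th) * p x.
pose H' x := u * F u x + s ^- 2 * (- (x * sin (u * x + th)) * p x).
have dH (x : R) : is_derive x 1 H (H' x).
  have d1 : is_derive x 1 (fun x : R => u * x + th) u.
    by apply: is_derive_eq; rewrite /GRing.scale/=; ring.
  have d2 := @is_derive1_comp R sin (fun x => u * x + th) x _ _ (is_derive_sin _) d1.
  have d3 := is_deriveM d2 (dp x).
  by apply: (is_derive_eq d3); rewrite /H' /F /GRing.scale/=; field.
have clin : continuous (fun x : R => u * x + th).
  move=> x; apply: cvgD; last exact: cvg_cst.
  by apply: cvgM; [exact: cvg_cst|exact: cvg_id].
have ccos : continuous (fun x : R => cos (u * x + th)).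
  by move=> x; apply: (@continuous_comp _ _ _ (fun x : R => u * x + th) cos);
    [exact: clin|exact: continuous_cos].
have csin : continuous (fun x : R => sin (u * x + th)).
  by move=> x; apply: (@continuous_comp _ _ _ (fun x : R => u * x + th) sin);
    [exact: clin|exact: continuous_sin].
have cH' : continuous H'.
  move=> x; apply: cvgD; apply: cvgM; try exact: cvg_cst.
    by apply: cvgM; [exact: ccos|exact: cp].
  apply: cvgM; last exact: cp.
  by apply: cvgN; apply: cvgM; [exact: cvg_id|exact: csin].
have i1 : mu.-integrable setT (fun x => (u%:E * (F u x)%:E)%E).
  by apply: integrableZl => //; exact: intF.
have i2 : mu.-integrable setT
    (fun x => ((s ^- 2)%:E * (- (x * sin (u * x + th)) * p x)%:E)%E).
  by apply: integrableZl => //; exact: intS.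
have iH' : mu.-integrable setT (EFin \o H').
  rewrite (_ : EFin \o H' = (fun x => u%:E * (F u x)%:E)%E \+
     (fun x => ((s ^- 2)%:E * (- (x * sin (u * x + th)) * p x)%:E)%E)).
    exact: integrableD.
  by apply/funext => x; rewrite /= EFinD !EFinM.
have Hle x : `|H x| <= p x.
  rewrite normrM (ger0_norm (p0 _)) ler_piMl// ler_norml.
  by rewrite sin_geN1 sin_le1.
have c0 : normal_peak s * (s ^+ 2 *+ 2) * n.+1%:R^-1 @[n --> \oo] --> (0 : R).
  rewrite -[X in _ --> X](mulr0 (normal_peak s * (s ^+ 2 *+ 2))).
  by apply: cvgM; [exact: cvg_cst|exact: cvg_harmonic].
have Hn (e : R) : `|e| = 1 -> H (e * n%:R) @[n --> \oo] --> 0.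
  move=> e1; rewrite -(cvg_shiftS (fun n => H (e * n%:R))); apply/norm_cvg0P.
  apply: (squeeze_cvgr _ (cvg_cst 0) c0).
  apply: nearW => n; rewrite normr_ge0/=; apply: (le_trans (Hle _)).
  have -> : p (e * n.+1%:R) = p n.+1%:R.
    by rewrite !pE exprMn -(real_normK (num_real e)) e1 expr1n mul1r.
  exact: p_decay.
have := Rintegral_derive_eq0 dH cH' iH'.
have e1 : H n%:R @[n --> \oo] --> 0.
  have := Hn 1 (normr1 _); apply: cvg_trans; apply: near_eq_cvg.
  by apply: nearW => n; rewrite mul1r.
have e2 : H (- n%:R) @[n --> \oo] --> 0.
  have := Hn (-1) (normrN1 _); apply: cvg_trans; apply: near_eq_cvg.
  by apply: nearW => n; rewrite mulN1r.
move=> /(_ e1 e2); rewrite RintegralD// RintegralZl// RintegralZl//.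
rewrite -/(phi u); set J := \int[mu]_x _ => E.
have -> : J = s ^+ 2 * (s ^- 2 * J) by field.
have -> : s ^- 2 * J = - (u * phi u) by apply/eqP; rewrite -addr_eq0 addrC E.
ring.
Qed.

(** The product of [phi] with [exp (s^2 u^2 / 2)] has derivative 0, so it keeps its value [cos th]
    at [u = 0]. *)
Lemma Rintegral_cos_normal u :
  \int[mu]_x (cos (u * x + th) * normal_pdf 0 s x) =
  expR (- ((s * u) ^+ 2 / 2)) * cos th.
Proof.
pose psi v := phi v * expR ((s * v) ^+ 2 / 2).
have dpsi (v : R) : is_derive v 1 psi 0.
  have d1 : is_derive v 1 (fun v : R => (s * v) ^+ 2 / 2) (s ^+ 2 * v).
    have -> : (fun v : R => (s * v) ^+ 2 / 2) = fun v : R => s ^+ 2 / 2 * v ^+ 2.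
      by apply/funext => w; rewrite exprMn mulrAC.
    by apply: is_derive_eq; rewrite /GRing.scale/=; field.
  have d2 := @is_derive1_comp R expR (fun v => (s * v) ^+ 2 / 2) v _ _
    (is_derive_expR _) d1.
  have d3 := is_deriveM (dphi v) d2.
  by apply: (is_derive_eq d3); rewrite parts /GRing.scale/=; ring.
have := is_derive_0_is_cst u 0 dpsi.
rewrite /psi mulr0 expr0n/= mul0r expR0 mulr1.
have -> : phi 0 = cos th.
  transitivity (\int[mu]_x (cos th * p x)).
    by apply: eq_Rintegral => x _; rewrite /F mul0r add0r.
  by rewrite RintegralZl// /Rintegral integral_normal_pdf mulr1.
move=> <-; rewrite mulrC -mulrA -expRD subrr expR0 mulr1.
by [].
Qed.

End normal_characteristic_function.

Section normal_transform.
Context {R : realType}.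
Notation mu := (@lebesgue_measure R).

(** For indicators this is the definition of the law. Simple functions approximate [h] uniformly,
    and since the density has mass 1 both sides move by at most the same error. *)
Lemma Ex_normal_prob (m s : R) (h : R -> R) : bmf h ->
  Ex (normal_prob m s) h = \int[mu]_x (h x * normal_pdf m s x).
Proof.
move=> hh; pose p : R -> R := normal_pdf m s.
have p0 x : 0 <= p x by exact: normal_pdf_ge0.
have intp : mu.-integrable setT (EFin \o p) by exact: integrable_normal_pdf.
have mp : measurable_fun setT p by exact: measurable_normal_pdf.
have int (f : R -> R) : bmf f -> mu.-integrable setT (EFin \o (fun x => f x * p x)).
  move=> [mf [C hC]].
  apply: (@le_integrable _ _ _ mu _ measurableT _ (fun x => (`|C|%:E * (p x)%:E)%E)).
  - by apply/measurable_EFinP; exact: measurable_funM.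
  - move=> x _; rewrite lee_fin !normrM normr_id ler_wpM2r//.
    by rewrite (le_trans (hC x))// ler_norm.
  - exact: integrableZl.
have intp1 : \int[mu]_x p x = 1 by rewrite /Rintegral integral_normal_pdf.
have simple n (a : 'I_n -> R) (A : 'I_n -> set R) : (forall i, measurable (A i)) ->
    Ex (normal_prob m s) (fun x => \sum_(i < n) a i * \1_(A i) x) =
    \int[mu]_x ((\sum_(i < n) a i * \1_(A i) x) * p x).
  move=> mA; rewrite Ex_sum; last by move=> i _; apply: bmfZ; apply: bmf_indic; exact: mA.
  have -> : \int[mu]_x ((\sum_(i < n) a i * \1_(A i) x) * p x) =
      \sum_(i < n) \int[mu]_x (a i * \1_(A i) x * p x).
    elim: n a A mA => [|n IHn] a A mA.
      rewrite big_ord0; transitivity (\int[mu]_x (0 : R)).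
        by apply: eq_Rintegral => x _; rewrite big_ord0 mul0r.
      by rewrite Rintegral_cst// mul0r.
    rewrite big_ord_recr/= -IHn; last by move=> i; exact: mA.
    rewrite -RintegralD//.
    - by apply: eq_Rintegral => x _; rewrite big_ord_recr/= mulrDl.
    - by apply: int; apply: bmf_sum => i _; apply: bmfZ; apply: bmf_indic; exact: mA.
    - by apply: int; apply: bmfZ; apply: bmf_indic; exact: mA.
  apply: eq_bigr => i _; rewrite ExZ; last by apply: bmf_indic; exact: mA.
  rewrite Ex_indic; last exact: mA.
  transitivity (\int[mu]_x (a i * (\1_(A i) x * p x))).
    rewrite RintegralZl//; last by apply: int; apply: bmf_indic; exact: mA.
    congr (_ * _); rewrite /normal_prob /Rintegral; congr fine.
    rewrite [LHS]integral_mkcond; apply: eq_integral => x _.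
    by rewrite patchE indicE; case: ifPn; rewrite ?mul1r ?mul0r.
  by apply: eq_Rintegral => x _; rewrite mulrA.
apply/eqP; rewrite -subr_eq0 -normr_eq0 eq_le normr_ge0 andbT.
apply/ler_addgt0Pl => e e0; rewrite addr0.
have e20 : 0 < e / 2 by rewrite divr_gt0.
have [n [a [A [mA hA]]]] := bmf_simple_approx hh e20.
pose f x := \sum_(i < n) a i * \1_(A i) x.
have hf : bmf f by apply: bmf_sum => i _; apply: bmfZ; apply: bmf_indic; exact: mA.
have -> : Ex (normal_prob m s) h - \int[mu]_x (h x * normal_pdf m s x) =
   Ex (normal_prob m s) (fun x => h x - f x) - \int[mu]_x ((h x - f x) * p x).
  have -> : \int[mu]_x ((h x - f x) * p x) = \int[mu]_x (h x * p x - f x * p x).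
    by apply: eq_Rintegral => x _; rewrite mulrBl.
  by rewrite ExB// RintegralB// ?simple//; [ring|exact: int|exact: int].
rewrite (le_trans (ler_normB _ _))// [leRHS](_ : e = e / 2 + e / 2); last by lra.
rewrite lerD//; first by apply: Ex_norm_le => [|x]; [exact: bmfB|exact: hA].
rewrite (le_trans (le_normr_Rintegral _ _))//; first by apply: int; exact: bmfB.
rewrite (@le_trans _ _ (\int[mu]_x (e / 2 * p x)))//.
  apply: le_Rintegral => //.
  - by apply: integrable_norm; apply: int; exact: bmfB.
  - rewrite (_ : EFin \o _ = fun x => ((e / 2)%:E * (p x)%:E)%E); last exact/funext.
    exact: integrableZl.
  - by move=> x _; rewrite normrM (ger0_norm (p0 x)) ler_wpM2r//; exact: hA.
by rewrite RintegralZl// intp1 mulr1.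
Qed.

Lemma Ex_cos_normal (s u th : R) : s != 0 ->
  Ex (normal_prob 0 s) (fun x => cos (u * x + th)) =
  expR (- ((s * u) ^+ 2 / 2)) * cos th.
Proof.
move=> s0; rewrite Ex_normal_prob ?Rintegral_cos_normal//.
by apply: bmf_cos; apply: measurable_funD => //; exact: measurable_funM.
Qed.

End normal_transform.

Section gaussian_law_of_transform.
Context {d} {T : measurableType d} {R : realType} (P : probability T R).
Variables (Y : T -> R) (s : R).
Hypothesis mY : measurable_fun setT Y.
Hypothesis cosY : forall u th,
  Ex P (fun w => cos (u * Y w + th)) = expR (- ((s * u) ^+ 2 / 2)) * cos th.

(** The transform of [Y] is that of the normal law, or of the Dirac mass at 0 when [s = 0], and
    transforms determine laws. *)
Lemma gaussian_law_of_cos A : measurable A -> P (Y @^-1` A) = gaussian_law 0 s A.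
Proof.
move=> mA.
have mYA : measurable (Y @^-1` A).
  by rewrite -[X in measurable X]setTI; exact: mY.
have H d2 (T2 : measurableType d2) (Q : probability T2 R) (V : T2 -> R) :
    measurable_fun setT V ->
    (forall u th, Ex Q (fun x => cos (u * V x + th)) =
      expR (- ((s * u) ^+ 2 / 2)) * cos th) -> P (Y @^-1` A) = Q (V @^-1` A).
  move=> mV hQ.
  have mVA : measurable (V @^-1` A).
    by rewrite -[X in measurable X]setTI; exact: mV.
  have := cos_transform_unique mY mV (fun u b => etrans (cosY u b) (esym (hQ u b)))
    (bmf_indic mA).
  have -> : Ex P (fun w => \1_A (Y w)) = Ex P \1_(Y @^-1` A) by [].
  have -> : Ex Q (fun w => \1_A (V w)) = Ex Q \1_(V @^-1` A) by [].
  rewrite (Ex_indic P mYA) (Ex_indic Q mVA) => e.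
  by rewrite -[LHS]fineK ?e ?fineK//; exact: fin_num_measure.
rewrite /gaussian_law; have [s0|s0] := eqVneq s 0; last first.
  apply: (H _ (measurableTypeR R) (normal_prob 0 s) id) => // u th.
  exact: Ex_cos_normal.
have hd := (H _ _ (dirac (0:R)) (id : R -> R)).
apply: hd => // u th.
have hb : bmf (fun x : R => cos (u * x + th)).
  by apply: bmf_cos; apply: measurable_funD => //; exact: measurable_funM.
rewrite s0 mul0r expr0n/= mul0r oppr0 expR0 mul1r /Ex /Rintegral.
rewrite integral_dirac//; last by apply/measurable_EFinP; have [] := hb.
by rewrite diracT mul1e mulr0 add0r.
Qed.

(* Both moments come from [(2 - 2 cos (u Y)) / u ^+ 2 --> Y ^+ 2] as [u --> 0]:
   the left-hand side is at most [Y ^+ 2], and Fatou's lemma gives the converse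
   bound. *)
Let un (n : nat) : R := n.+1%:R^-1.
Let cn (n : nat) (w : T) : R := un n ^- 2 * (2 - 2 * cos (un n * Y w)).

Let un0 n : 0 < un n. Proof. by rewrite invr_gt0 ltr0n. Qed.

Let un_cvg : un n @[n --> \oo] --> 0. Proof. exact: cvg_harmonic. Qed.

Let hcn n : bmf (cn n).
Proof.
apply: bmfZ; apply: bmfB; first exact: bmf_cst.
by apply: bmfZ; apply: bmf_cos; exact: measurable_funM.
Qed.

Let cn_ge0 n w : 0 <= cn n w.
Proof.
apply: mulr_ge0; first by rewrite invr_ge0 exprn_ge0// ltW.
by have := cos_le1 (un n * Y w); lra.
Qed.

Let cosB1_le2 (x : R) : 2 - 2 * cos x <= x ^+ 2.
Proof.
have -> : cos x = 1 - sin (x / 2) ^+ 2 *+ 2.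
  rewrite {1}(_ : x = x / 2 *+ 2); last by field.
  by rewrite cos_mulr2n cos2sin2; ring.
have : sin (x / 2) ^+ 2 <= (x / 2) ^+ 2.
  rewrite -[leLHS]real_normK ?num_real// -[leRHS]real_normK ?num_real//.
  by rewrite ler_pXn2r ?nnegrE//; exact: norm_sin_le.
by rewrite exprMn; lra.
Qed.

Let cn_le n w : cn n w <= Y w ^+ 2.
Proof.
rewrite /cn mulrC ler_pdivrMr ?exprn_gt0//.
by have := cosB1_le2 (un n * Y w); rewrite exprMn [X in _ <= X]mulrC.
Qed.

Let cn_cvg w : cn n w @[n --> \oo] --> Y w ^+ 2.
Proof.
have bound n : Y w ^+ 2 - 2 * un n ^+ 2 * Y w ^+ 4 <= cn n w.
  rewrite /cn [leRHS]mulrC ler_pdivlMr ?exprn_gt0//.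
  have := norm_cos_taylor_le (un n * Y w); rewrite ler_norml => /andP[_].
  rewrite !exprMn; set c := cos _ => h.
  have : c <= 1 - un n ^+ 2 * Y w ^+ 2 / 2 + un n ^+ 4 * Y w ^+ 4 by lra.
  have -> : un n ^+ 4 = un n ^+ 2 * un n ^+ 2 by ring.
  nra.
have c : Y w ^+ 2 - 2 * un n ^+ 2 * Y w ^+ 4 @[n --> \oo] --> Y w ^+ 2; last first.
  apply: (squeeze_cvgr _ c (cvg_cst _)).
  by apply: nearW => n; rewrite bound cn_le.
rewrite -[X in _ --> X]subr0; apply: cvgB; first exact: cvg_cst.
rewrite -(mul0r (Y w ^+ 4)) -[X in X * _](mulr0 2) -(mulr0 0).
apply: cvgM; last exact: cvg_cst.
apply: cvgM; first exact: cvg_cst.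
rewrite (_ : (fun n => un n ^+ 2) = (fun n => un n * un n)).
  exact: cvgM.
by apply/funext => n; rewrite expr2.
Qed.

Let Ex_cn n : Ex P (cn n) = un n ^- 2 * (2 - 2 * expR (- ((s * un n) ^+ 2 / 2))).
Proof.
rewrite /cn ExZ; last first.
  apply: bmfB; first exact: bmf_cst.
  by apply: bmfZ; apply: bmf_cos; exact: measurable_funM.
rewrite (ExB _ (bmf_cst 2)); last first.
  by apply: bmfZ; apply: bmf_cos; exact: measurable_funM.
rewrite Ex_cst ExZ; last by apply: bmf_cos; exact: measurable_funM.
have := cosY (un n) 0; rewrite cos0 mulr1 => <-.
by congr (_ * (_ - _ * _)); apply: eq_Ex => w; rewrite addr0.
Qed.

Let Ex_cn_cvg : Ex P (cn n) @[n --> \oo] --> s ^+ 2.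
Proof.
have E n : s ^+ 2 - un n ^+ 2 * s ^+ 4 <= Ex P (cn n) <= s ^+ 2.
  rewrite Ex_cn; set y := (s * un n) ^+ 2 / 2.
  have y0 : 0 <= y by rewrite divr_ge0// sqr_ge0.
  have := norm_expRN_taylor_le y0; rewrite ler_norml => /andP[h1 h2].
  have := expR_ge1Dx (- y) => h3.
  rewrite [_ ^- 2 * _]mulrC ler_pdivlMr ?exprn_gt0// ler_pdivrMr ?exprn_gt0//.
  have yE : y = s ^+ 2 * un n ^+ 2 / 2 by rewrite /y exprMn.
  have -> : (s ^+ 2 - un n ^+ 2 * s ^+ 4) * un n ^+ 2 = 2 * y - 4 * y ^+ 2.
    by rewrite yE; field.
  have -> : s ^+ 2 * un n ^+ 2 = 2 * y by rewrite yE; field.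
  apply/andP; split; nra.
have c : s ^+ 2 - un n ^+ 2 * s ^+ 4 @[n --> \oo] --> s ^+ 2; last first.
  apply: (squeeze_cvgr _ c (cvg_cst _)).
  by apply: nearW => n; exact: E.
rewrite -[X in _ --> X]subr0; apply: cvgB; first exact: cvg_cst.
rewrite -(mul0r (s ^+ 4)) -[X in X * _](mul0r 0).
apply: cvgM; last exact: cvg_cst.
rewrite (_ : (fun n => un n ^+ 2) = (fun n => un n * un n)).
  exact: cvgM.
by apply/funext => n; rewrite expr2.
Qed.

Lemma integral_sqr_of_cos : (\int[P]_w (Y w ^+ 2)%:E = (s ^+ 2)%:E)%E.
Proof.
have mY2 : measurable_fun setT (fun w => (Y w ^+ 2)%:E).
  by apply/measurable_EFinP; exact: measurable_funX.
have Hc : (\int[P]_w (cn n w)%:E)%E @[n --> \oo] --> (s ^+ 2)%:E.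
  rewrite (_ : (fun n => _) = (fun n => (Ex P (cn n))%:E)).
    by apply: cvg_EFin => //; exact: nearW.
  by apply/funext => n; rewrite EFin_Ex.
apply/eqP; rewrite eq_le; apply/andP; split; last first.
  apply: (cvge_le _ Hc); apply: nearW => n.
  apply: ge0_le_integral => //.
  - by move=> w _; rewrite lee_fin.
  - by apply/measurable_EFinP; have [] := hcn n.
  - by move=> w _; rewrite lee_fin.
have := @fatou _ T R P setT measurableT (fun n w => (cn n w)%:E)
  (fun n => (measurable_EFinP _ _).2 (hcn n).1) (fun n w _ => cn_ge0 n w).
rewrite (cvg_limn_einf_sup Hc).1.
apply: le_trans; rewrite le_eqVlt; apply/orP; left; apply/eqP.
apply: eq_integral => w _.
have c : (cn n w)%:E @[n --> \oo] --> (Y w ^+ 2)%:E.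
  by apply: cvg_EFin; [exact: nearW|exact: cn_cvg].
by rewrite (cvg_limn_einf_sup c).1.
Qed.

Lemma integrable_sqr_of_cos : P.-integrable setT (fun w => (Y w ^+ 2)%:E).
Proof.
apply/integrableP; split; first by apply/measurable_EFinP; exact: measurable_funX.
rewrite (eq_integral (fun w => (Y w ^+ 2)%:E)) ?integral_sqr_of_cos ?ltry//.
by move=> w _; rewrite gee0_abs// lee_fin sqr_ge0.
Qed.

Lemma integrable_of_cos : P.-integrable setT (EFin \o Y).
Proof.
apply: (@le_integrable _ _ _ P _ measurableT _ (fun w => (1 + Y w ^+ 2)%:E)).
- exact/measurable_EFinP.
- move=> w _; rewrite lee_fin [leRHS]ger0_norm ?addr_ge0 ?sqr_ge0//.
  by rewrite -[Y w ^+ 2]real_normK ?num_real//; have := normr_ge0 (Y w); nra.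
- rewrite (_ : (fun w => _) = (cst 1%E \+ (fun w => (Y w ^+ 2)%:E))%E).
    apply: integrableD => //; last exact: integrable_sqr_of_cos.
    exact: (bmf_integrable P (bmf_cst 1)).
  by apply/funext => w; rewrite /= EFinD.
Qed.

(** [sin (u Y) / u] has mean 0, by the transform at phase [- pi / 2], and tends to [Y] as [u] tends
    to 0, dominated by [|Y|]. *)
Lemma integral_of_cos : (\int[P]_w (Y w)%:E = 0)%E.
Proof.
have hs n : bmf (fun w => (un n)^-1 * sin (un n * Y w)).
  by apply: bmfZ; apply: bmf_sin; exact: measurable_funM.
have i2 : P.-integrable setT (fun w => `|Y w|%:E).
  exact: (integrable_norm integrable_of_cos).
have [|||||_ _ H] := @dominated_convergence _ T R P setT measurableT
  (fun n w => ((un n)^-1 * sin (un n * Y w))%:E) (EFin \o Y) (fun w => `|Y w|%:E).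
- by move=> n; apply/measurable_EFinP; have [] := hs n.
- exact/measurable_EFinP.
- apply: aeW => w _; apply: cvg_EFin; first exact: nearW.
  apply/cvgrPdist_le => e e0.
  have c : un n * `|Y w| ^+ 3 @[n --> \oo] --> 0.
    by rewrite -(mul0r (`|Y w| ^+ 3)); apply: cvgM => //; exact: cvg_cst.
  move/cvgrPdist_le : c => /(_ _ e0); apply: filterS => n.
  rewrite sub0r normrN (ger0_norm (mulr_ge0 (ltW (un0 n)) _)) ?exprn_ge0//.
  apply: le_trans; have -> : Y w - (un n)^-1 * sin (un n * Y w) =
      - ((un n)^-1 * (sin (un n * Y w) - un n * Y w)).
    by field; rewrite gt_eqF.
  rewrite normrN normrM gtr0_norm ?invr_gt0// ler_pdivrMl//.
  apply: (le_trans (norm_sinB_le _)).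
  rewrite normrM (gtr0_norm (un0 n)) exprMn -[Y w ^+ 2]real_normK ?num_real//.
  have un1 : un n <= 1 by rewrite invf_le1 ?ltr0n// ler1n.
  rewrite [leLHS](_ : _ = un n * (un n * `|Y w| ^+ 3) * un n); last by ring.
  by rewrite ler_piMr// !mulr_ge0 ?exprn_ge0// ltW.
- exact: i2.
- apply: aeW => w n _; rewrite lee_fin normrM gtr0_norm ?invr_gt0// ler_pdivrMl//.
  by rewrite (le_trans (norm_sin_le _))// normrM (gtr0_norm (un0 n)).
have H0 : (\int[P]_w ((un n)^-1 * sin (un n * Y w))%:E)%E @[n --> \oo] --> 0%E.
  rewrite (_ : (fun n => _) = cst 0%E); first exact: cvg_cst.
  apply/funext => n; rewrite EFin_Ex// ExZ; last first.
    by apply: bmf_sin; exact: measurable_funM.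
  have := cosY (un n) (- (pi / 2)); rewrite cosN cos_pihalf mulr0.
  have -> : Ex P (fun w => cos (un n * Y w + - (pi / 2))) =
      Ex P (fun w => sin (un n * Y w)).
    by apply: eq_Ex => w; rewrite -sinDpihalf subrK.
  by move=> ->; rewrite mulr0.
by apply: cvg_unique H H0.
Qed.

End gaussian_law_of_transform.

(** * Gaussian vectors *)

Section gaussian_vector.
Context {R : realType}.

(** Each step adds one normal factor to a product space. Besides measurability only the joint
    transform is recorded, being all that is used later. *)
Lemma standard_normal_sequence (N : nat) :
  exists d (T : measurableType d) (P : probability T R) (Z : 'I_N -> T -> R),
    (forall k, measurable_fun setT (Z k)) /\
    forall (t : 'I_N -> R) b, Ex P (fun w => cos (\sum_k t k * Z k w + b)) =
      expR (- ((\sum_k t k ^+ 2) / 2)) * cos b.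
Proof.
elim: N => [|N [d [T [P [Z [mZ hZ]]]]]].
  exists default_measure_display, R, (dirac (0 : R)), (fun _ _ => 0).
  split=> // t b; rewrite !big_ord0 mul0r oppr0 expR0 mul1r -[RHS](Ex_cst (dirac (0 : R))).
  by apply: eq_Ex => w; rewrite add0r.
pose Q := normal_prob (0 : R) 1.
pose Z' (k : 'I_N.+1) (w : T * measurableTypeR R) : R :=
  if unlift ord0 k is Some j then Z j w.1 else w.2.
have mZ' k : measurable_fun setT (Z' k).
  rewrite /Z'; case: (unlift ord0 k) => [j|]; last exact: measurable_snd.
  exact: (measurableT_comp (mZ j) measurable_fst).
exists _, (T * measurableTypeR R)%type, (prod_prob P Q), Z'; split=> // t b.
pose t' j := t (lift ord0 j).
have E w : \sum_k t k * Z' k w = t ord0 * w.2 + \sum_j t' j * Z j w.1.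
  rewrite big_ord_recl /Z' unlift_none; congr (_ + _).
  by apply: eq_bigr => j _; rewrite liftK.
have hC : bmf (fun w => cos (\sum_k t k * Z' k w + b)).
  by apply: bmf_cos; apply: measurable_funD => //; exact: bmf_lin.
rewrite Ex_prod1// (_ : \sum_k _ = t ord0 ^+ 2 + \sum_j t' j ^+ 2); last first.
  by rewrite big_ord_recl.
rewrite mulrDl opprD expRD -mulrA -hZ -ExZ; last first.
  by apply: bmf_cos; apply: measurable_funD => //; exact: bmf_lin.
apply: eq_Ex => w; rewrite -[in RHS](mul1r (t ord0)) -Ex_cos_normal//.
by apply: eq_Ex => x; rewrite E addrA.
Qed.

Definition quad_form {n} (S : 'M[R]_n) (t : 'I_n -> R) :=
  \sum_i \sum_j t i * t j * S i j.

Lemma quad_formE n (S : 'M[R]_n) (t : 'I_n -> R) :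
  quad_form S t = ((\row_i t i) *m S *m (\row_i t i)^T) ord0 ord0.
Proof.
rewrite /quad_form exchange_big/= mxE; apply: eq_bigr => j _.
rewrite !mxE mulr_suml; apply: eq_bigr => i _; rewrite !mxE; ring.
Qed.

(** Elimination of the first coordinate. If its diagonal entry is 0, semidefiniteness forces the
    rest of its row to vanish; otherwise the induction continues with the Schur complement. *)
Lemma cholesky n (S : 'M[R]_n) : S^T = S -> (forall t, 0 <= quad_form S t) ->
  exists A : 'M[R]_n, A *m A^T = S.
Proof.
move=> symS psdS.
have {}psdS (x : 'rV[R]_n) : 0 <= (x *m S *m x^T) ord0 ord0.
  have := psdS (fun i => x ord0 i); rewrite quad_formE.
  by rewrite (_ : \row_i x ord0 i = x)//; apply/rowP => i; rewrite mxE.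
elim: n S symS psdS => [|n IHn] S symS psdS.
  by exists 0; apply/matrixP => -[].
move: S symS psdS; rewrite -[n.+1]/(1 + n)%N => S symS psdS.
pose a := ulsubmx S; pose b := ursubmx S; pose C := drsubmx S.
have SE : S = block_mx a b b^T C.
  by rewrite /a /b /C trmx_ursub symS submxK.
have symC : C^T = C by rewrite /C trmx_drsub symS.
have q (x : 'rV[R]_1) (y : 'rV[R]_n) : 0 <=
    (x *m a *m x^T + y *m b^T *m x^T + (x *m b *m y^T + y *m C *m y^T)) ord0 ord0.
  have := psdS (row_mx x y).
  by rewrite SE mul_row_block tr_row_mx mul_row_col !mulmxDl.
have aE : a = (a ord0 ord0)%:M by exact: mx11_scalar.
set a0 := a ord0 ord0 in aE.
have a00 : 0 <= a0.
  have := q 1%:M 0.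
  by rewrite trmx0 !mul0mx !mulmx0 !addr0 trmx1 mulmx1 mul1mx.
have [a0z|a0nz] := eqVneq a0 0.
  have b0 : b = 0.
    apply/rowP => i; rewrite [RHS]mxE; apply/eqP; apply/negPn/negP => bi.
    pose e : 'rV[R]_n := delta_mx 0 i.
    pose c := (e *m C *m e^T) ord0 ord0.
    (* Chosen so that the form would take the value [-1] at [(s, e)]. *)
    pose s := - (c + 1) / (2 * b ord0 i).
    have := q s%:M e.
    have -> : (s%:M *m a *m (s%:M)^T + e *m b^T *m (s%:M)^T +
        (s%:M *m b *m e^T + e *m C *m e^T)) ord0 ord0 = 2 * s * b ord0 i + c.
      rewrite aE a0z raddf0 mulmx0 mul0mx add0r tr_scalar_mx mul_mx_scalar mul_scalar_mx.
      have -> : e *m b^T = (b *m e^T)^T by rewrite trmx_mul trmxK.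
      have -> : b *m e^T = (b ord0 i)%:M.
        by rewrite trmx_delta -colE; apply/matrixP => u v; rewrite !ord1 !mxE eqxx mulr1n.
      rewrite -scalemxAl.
      have -> : b *m e^T = (b ord0 i)%:M.
        by rewrite trmx_delta -colE; apply/matrixP => u v; rewrite !ord1 !mxE eqxx mulr1n.
      rewrite tr_scalar_mx /c; move: (e *m C *m e^T) => Q.
      by rewrite !mxE eqxx mulr1n; ring.
    have -> : 2 * s * b ord0 i + c = -1 by rewrite /s; field.
    by rewrite oppr_ge0 leNgt ltr01.
  have [y|A hA] := IHn C symC.
    have := q 0 y; rewrite !mul0mx trmx0 !mulmx0 !add0r.
    by [].
  exists (block_mx 0 0 0 A).
  rewrite tr_block_mx mulmx_block !trmx0 !mul0mx !mulmx0 !addr0 !add0r hA SE b0 aE a0z.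
  by rewrite trmx0 raddf0.
have a0gt : 0 < a0 by rewrite lt_neqAle eq_sym a0nz.
have [||A hA] := IHn (C - a0^-1 *: (b^T *m b)).
- by rewrite linearB/= linearZ/= trmx_mul trmxK symC.
- move=> y.
  pose z := (b *m y^T) ord0 ord0.
  have zE : b *m y^T = z%:M by exact: mx11_scalar.
  have zE' : y *m b^T = z%:M by rewrite -(trmxK y) -trmx_mul zE tr_scalar_mx.
  (* This first coordinate minimizes the form for given [y], and the minimum is the form of the
     Schur complement at [y]. *)
  have := q (- (z / a0))%:M y.
  have -> : (- (z / a0))%:M *m b *m y^T = (- (z / a0) * z)%:M.
    by rewrite -mulmxA zE scalar_mxM.
  rewrite zE' aE !tr_scalar_mx -!scalar_mxM.
  have -> : y *m (C - a0^-1 *: (b^T *m b)) *m y^T =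
      y *m C *m y^T - (a0^-1 * (z * z))%:M.
    have e2 : y *m (b^T *m b) *m y^T = (z * z)%:M.
      by rewrite mulmxA zE' -mulmxA zE scalar_mxM.
    by rewrite mulmxBr mulmxBl -scalemxAr -scalemxAl e2 scale_scalar_mx.
  move: (y *m C *m y^T) => Q.
  rewrite !mxE !eqxx !mulr1n.
  have -> : - (z / a0) * a0 * - (z / a0) + z * - (z / a0) + (- (z / a0) * z + Q ord0 ord0) =
    Q ord0 ord0 - a0^-1 * (z * z) by field.
  by [].
pose r := Num.sqrt a0.
have r2 : r * r = a0 by rewrite -expr2 sqr_sqrtr.
have r0 : r != 0 by rewrite gt_eqF// sqrtr_gt0.
exists (block_mx r%:M 0 (r^-1 *: b^T) A).
rewrite tr_block_mx mulmx_block !trmx0 !mulmx0 !mul0mx !addr0 SE.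
rewrite tr_scalar_mx -scalar_mxM r2 -aE; congr block_mx.
- by rewrite linearZ/= trmxK mul_scalar_mx scalerA divff// scale1r.
- by rewrite mul_mx_scalar scalerA divff// scale1r.
- rewrite hA linearZ/= trmxK -scalemxAl -scalemxAr scalerA -invfM r2.
  by rewrite addrC subrK.
Qed.

(** Every linear form in the vector is treated as a single variable: its law, mean and second moment
    follow from its transform, and covariances follow by polarization. *)
Lemma centered_gaussian_vector_exists l (S : 'M[R]_l) :
  S^T = S -> (forall t, 0 <= quad_form S t) ->
  exists d (T : measurableType d) (P : probability T R) (X : 'I_l -> {RV P >-> R}),
    centered_gaussian_vector X S /\
    forall (t : 'I_l -> R) b, Ex P (fun w => cos (\sum_k t k * X k w + b)) =
      expR (- (quad_form S t / 2)) * cos b.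
Proof.
move=> symS psdS; have [A hA] := cholesky symS psdS.
have [d [T [P [Z [mZ hZ]]]]] := standard_normal_sequence l.
have mX k : measurable_fun setT (fun w => \sum_j A k j * Z j w) by exact: bmf_lin.
pose X k : {RV P >-> R} :=
  HB.pack (fun w => \sum_j A k j * Z j w) (isMeasurableFun.Build _ _ _ _ _ (mX k)).
have linX (t : 'I_l -> R) w :
    \sum_k t k * X k w = \sum_j (\sum_k t k * A k j) * Z j w.
  rewrite /X/=; under eq_bigr do rewrite mulr_sumr.
  rewrite exchange_big; apply: eq_bigr => j _ /=.
  by rewrite mulr_suml; apply: eq_bigr => k _; rewrite mulrA.
have quadX (t : 'I_l -> R) : \sum_j (\sum_k t k * A k j) ^+ 2 = quad_form S t.
  rewrite quad_formE -hA mulmxA -mulmxA -trmx_mul.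
  pose v := (\row_i t i) *m A.
  have vE j : v ord0 j = \sum_k t k * A k j.
    by rewrite mxE; apply: eq_bigr => k _; rewrite mxE.
  rewrite -/v mxE; apply: eq_bigr => j _.
  by rewrite [v^T _ _]mxE vE expr2.
have cosX (t : 'I_l -> R) b : Ex P (fun w => cos (\sum_k t k * X k w + b)) =
      expR (- (quad_form S t / 2)) * cos b.
  rewrite -quadX -hZ; apply: eq_Ex => w; by rewrite linX.
have mlin t : measurable_fun setT (fun w => \sum_k t k * X k w).
  by apply: bmf_lin => k; exact: mX.
have cosl (t : 'I_l -> R) u b :
    Ex P (fun w => cos (u * (\sum_k t k * X k w) + b)) =
    expR (- ((Num.sqrt (quad_form S t) * u) ^+ 2 / 2)) * cos b.
  have := cosX (fun k => u * t k) b.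
  have -> : quad_form S (fun k => u * t k) = (Num.sqrt (quad_form S t) * u) ^+ 2.
    rewrite exprMn sqr_sqrtr// mulrC /quad_form mulr_sumr; apply: eq_bigr => i _.
    by rewrite mulr_sumr; apply: eq_bigr => j _; ring.
  move=> <-; apply: eq_Ex => w; congr (cos (_ + _)).
  by rewrite mulr_sumr; apply: eq_bigr => k _; rewrite mulrA.
(* The linear form selecting coordinate [a]; statements on coordinates become instances of those on
   linear forms. *)
pose dl (a k : 'I_l) : R := (k == a)%:R.
have lin_dl a w : \sum_k dl a k * X k w = X a w.
  rewrite (bigD1 a)//= [X in _ + X]big1 => [|k /negbTE ka].
    by rewrite addr0 /dl eqxx mul1r.
  by rewrite /dl ka mul0r.
have quad_dl a b : \sum_i \sum_j dl a i * dl b j * S i j = S a b.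
  rewrite (bigD1 a)//= [X in _ + X]big1 ?addr0 => [|i /negbTE ia]; last first.
    by rewrite big1// => j _; rewrite /dl ia !mul0r.
  rewrite (bigD1 b)//= [X in _ + X]big1 ?addr0 => [|j /negbTE jb]; last first.
    by rewrite /dl jb mulr0 mul0r.
  by rewrite /dl !eqxx !mul1r.
exists d, T, P, X; split=> //; split=> [t|k|i j].
- exists 0, (Num.sqrt (quad_form S t)); split=> [|B mB]; first exact: sqrtr_ge0.
  have hg := gaussian_law_of_cos (mlin t) (cosl t) mB.
  exact: hg.
- rewrite unlock -[RHS](integral_of_cos (mlin (dl k)) (cosl (dl k))).
  by apply: eq_integral => w _; rewrite lin_dl.
have EX k : ('E_P[X k] = 0)%E.
  rewrite unlock -[RHS](integral_of_cos (mlin (dl k)) (cosl (dl k))).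
  by apply: eq_integral => w _; rewrite lin_dl.
have sq t := integral_sqr_of_cos (mlin t) (cosl t).
have isq t := integrable_sqr_of_cos (mlin t) (cosl t).
have Rsq t : \int[P]_w (\sum_k t k * X k w) ^+ 2 = quad_form S t.
  by rewrite /Rintegral sq /= sqr_sqrtr.
pose t2 k := dl i k + dl j k.
have lin2 w : \sum_k t2 k * X k w = X i w + X j w.
  rewrite -(lin_dl i) -(lin_dl j) -big_split; apply: eq_bigr => k _ /=.
  by rewrite mulrDl.
have q2 : quad_form S t2 = S i i + S j j + 2 * S i j.
  rewrite -(quad_dl i i) -(quad_dl j j) -(quad_dl i j).
  have -> : 2 * (\sum_u \sum_v dl i u * dl j v * S u v) =
     (\sum_u \sum_v dl i u * dl j v * S u v) + (\sum_u \sum_v dl j u * dl i v * S u v).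
    have symij : S j i = S i j by rewrite -{1}symS mxE.
    by rewrite !quad_dl symij; ring.
  rewrite -!big_split; apply: eq_bigr => u _ /=.
  by rewrite -!big_split; apply: eq_bigr => v _ /=; rewrite /t2; ring.
rewrite unlock !EX unlock.
pose g t w := (\sum_k t k * X k w) ^+ 2.
(* Polarization expresses [X i * X j] by squares of linear forms, whose integrals are already
   known. *)
pose f w := 2^-1 * (g t2 w - (g (dl i) w + g (dl j) w)).
have i1 : P.-integrable setT (EFin \o (fun w => g (dl i) w + g (dl j) w)).
  exact: (integrableD measurableT (isq (dl i)) (isq (dl j))).
have i2 : P.-integrable setT (EFin \o (fun w => g t2 w - (g (dl i) w + g (dl j) w))).
  exact: (integrableB measurableT (isq t2) i1).
have i3 : P.-integrable setT (EFin \o f).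
  exact: (integrableZl measurableT (2^-1) i2).
have -> : (\int[P]_w (((X i \- cst (fine 0)) * (X j \- cst (fine 0)))%R w)%:E =
    \int[P]_w (f w)%:E)%E.
  apply: eq_integral => w _; congr (_%:E).
  rewrite /f /g lin2 !lin_dl; transitivity ((X i w - 0) * (X j w - 0)) => //.
  by move: (X i w) (X j w) => x y; field.
rewrite -[LHS]fineK; last exact: integrable_fin_num.
rewrite -[fine _]/(\int[P]_w f w) /f RintegralZl// RintegralB//; [|exact: isq].
rewrite RintegralD//; [|exact: isq|exact: isq].
rewrite !Rsq q2 -(quad_dl i i) -(quad_dl j j) /quad_form.
by congr (_%:E); field.
Qed.

End gaussian_vector.

(** * Orthogonality of degenerate kernels *)

Section degenerate_kernels.
Context {d} {T : measurableType d} {R : realType} {P : probability T R}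
  {I : finType} (X : I -> {RV P >-> R}) (L : I -> probability R R).
Hypothesis indepX : mutually_independent X.
Hypothesis lawX : forall c, has_law (X c) (L c).

Lemma bmf_pair c c' (F : R * R -> R) : bmf F -> bmf (fun w => F (X c w, X c' w)).
Proof. by move=> hF; apply: bmf_comp hF; exact: measurable_fun_pair. Qed.

Lemma Ex_indep2 c c' (g h : R -> R) : c' != c -> bmf g -> bmf h ->
  Ex P (fun w => g (X c w) * h (X c' w)) = Ex (L c) g * Ex (L c') h.
Proof.
move=> cc' hg hh.
have hs z : List.In z [:: (c', h)] -> z.1 != c /\ bmf z.2 by case=> // <-.
have := Ex_indep_seq indepX lawX hg hs.
have -> : Ex P (fun w => \prod_(z <- [:: (c', h)]) z.2 (X z.1 w)) = Ex (L c') h.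
  by rewrite -(Ex_law (lawX c') hh); apply: eq_Ex => w; rewrite big_seq1.
by move=> <-; apply: eq_Ex => w; rewrite big_seq1.
Qed.

(** [X c0] occurs in [F] alone and averages to 0 there; on rectangles [Ex_freeze] integrates it
    first. The indices [c1], [c2], [c3] may coincide, as they do for overlapping pairs of faces. *)
Lemma Ex_degenerate c0 c1 c2 c3 (F G : R * R -> R) :
  c1 != c0 -> c2 != c0 -> c3 != c0 -> bmf F -> bmf G ->
  (forall y, Ex (L c0) (fun x => F (x, y)) = 0) ->
  Ex P (fun w => G (X c2 w, X c3 w) * F (X c0 w, X c1 w)) = 0.
Proof.
move=> c10 c20 c30 hF hG F0.
transitivity (Ex P (fun w => G (X c2 w, X c3 w) * cst 0 w)); last first.
  by rewrite -[RHS](Ex_cst P); apply: eq_Ex => w; rewrite mulr0.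
apply: (@weighted_law_unique _ _ _ T T (R * R)%type R P P
  (fun w => (X c2 w, X c3 w)) (fun w => (X c2 w, X c3 w))
  (fun w => F (X c0 w, X c1 w)) (cst 0)
  [set A `*` B | A in measurable & B in measurable]) => //.
- exact: measurable_prod_measurableType.
- move=> _ _ [A1 mA1 [B1 mB1 <-]] [A2 mA2 [B2 mB2 <-]].
  exists (A1 `&` A2); first exact: measurableI.
  by exists (B1 `&` B2); [exact: measurableI|rewrite setXI].
- by exists setT => //; exists setT => //; rewrite setXTT.
- exact: measurable_fun_pair.
- exact: measurable_fun_pair.
- exact: bmf_pair.
- exact: bmf_cst.
move=> _ [A mA [B mB <-]].
transitivity (0 : R); last first.
  by rewrite -[LHS](Ex_cst P); apply: eq_Ex => w; rewrite mulr0.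
pose s := [:: (c2, \1_A : R -> R); (c3, \1_B : R -> R)].
have hs z : List.In z s -> z.1 != c0 /\ bmf z.2.
  by move=> /= [<-|[<-|//]]; split => //; exact: bmf_indic.
have := @Ex_freeze _ _ _ _ _ _ _ indepX lawX c0 c1 F s c10 hF hs.
have -> : Ex P (fun w => Ex (L c0) (fun x => F (x, X c1 w)) *
    \prod_(z <- s) z.2 (X z.1 w)) = 0.
  by rewrite -[RHS](Ex_cst P); apply: eq_Ex => w; rewrite F0 mul0r.
move=> <-; apply: eq_Ex => w.
rewrite big_cons big_seq1 mulrC; congr (_ * _) => /=.
by rewrite !indicE in_setX/=; case: (_ \in _); rewrite ?mul1r ?mul0r.
Qed.

Lemma Ex_sqr_sum (u : I -> R -> R) (u' : I -> R -> R) :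
  (forall c, bmf (u c)) -> (forall c, bmf (u' c)) ->
  (forall c, Ex (L c) (u c) = 0) -> (forall c, Ex (L c) (u' c) = 0) ->
  Ex P (fun w => (\sum_c u c (X c w)) * (\sum_c u' c (X c w))) =
  \sum_c Ex (L c) (fun x => u c x * u' c x).
Proof.
move=> hu hu' u0 u'0.
have bu c : bmf (fun w => u c (X c w)) by exact: bmf_comp.
have bu' c : bmf (fun w => u' c (X c w)) by exact: bmf_comp.
transitivity (Ex P (fun w => \sum_c \sum_c' u c (X c w) * u' c' (X c' w))).
  by apply: eq_Ex => w; rewrite mulr_suml; apply: eq_bigr => c _; rewrite mulr_sumr.
rewrite Ex_sum => [|c _]; last by apply: bmf_sum => c' _; exact: bmfM.
apply: eq_bigr => c _; rewrite Ex_sum => [|c' _]; last exact: bmfM.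
rewrite (bigD1 c)//= big1 ?addr0 => [|c' cc'].
  by rewrite -(Ex_law (lawX c))//; exact: bmfM.
by rewrite Ex_indep2// u0 mul0r.
Qed.

End degenerate_kernels.

(** * Distances in mean *)

Section cauchy_schwarz.
Context {d} {T : measurableType d} {R : realType} (P : probability T R).

(** Nonnegativity of the variance of [|Z|]. *)
Lemma Ex_norm_le_sqr (Z : T -> R) (c : R) : bmf Z -> 0 <= c ->
  Ex P (fun w => Z w * Z w) <= c ^+ 2 -> Ex P (fun w => `|Z w|) <= c.
Proof.
move=> hZ c0 Zc; set e := Ex P (fun w => `|Z w|).
have bZ := bmf_norm hZ.
have : 0 <= Ex P (fun w => (`|Z w| - e) ^+ 2) by apply: Ex_ge0 => w; exact: sqr_ge0.
have -> : Ex P (fun w => (`|Z w| - e) ^+ 2) =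
    Ex P (fun w => Z w * Z w + ((- (2 * e)) * `|Z w| + e ^+ 2)).
  apply: eq_Ex => w; rewrite -expr2 -[Z w ^+ 2]real_normK ?num_real//; ring.
rewrite ExD; [|exact: bmfM|by apply: bmfD; [exact: bmfZ|exact: bmf_cst]].
rewrite ExD; [|exact: bmfZ|exact: bmf_cst].
rewrite ExZ// (Ex_cst P (e ^+ 2)) -/e => h.
have e0 : 0 <= e by exact: Ex_ge0.
rewrite -(@ler_pXn2r _ 2)// ?nnegrE//; lra.
Qed.

(** The cosine is 1-Lipschitz, so closeness in mean is enough to compare transforms. *)
Lemma Ex_cos_dist (A B : T -> R) : measurable_fun setT A -> measurable_fun setT B ->
  bmf (fun w => A w - B w) ->
  `|Ex P (fun w => cos (A w)) - Ex P (fun w => cos (B w))| <= Ex P (fun w => `|A w - B w|).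
Proof.
move=> mA mB hAB.
have hA := bmf_cos mA; have hB := bmf_cos mB.
rewrite -ExB// (le_trans (Ex_norm _ (bmfB hA hB)))//.
apply: le_Ex => [||w]; [exact: bmf_norm (bmfB hA hB)|exact: bmf_norm|].
have hd (z : R) : is_derive z 1 (fun z => cos (B w + z)) (- sin (B w + z)).
  have d1 : is_derive z 1 (fun z : R => B w + z) 1.
    by apply: is_derive_eq; rewrite add0r mulr1.
  have := @is_derive1_comp R cos (fun z => B w + z) z _ _ (is_derive_cos _) d1.
  by rewrite mulr1.
have [c _] := mean_value0 (A w - B w) hd.
rewrite addr0 (_ : B w + (A w - B w) = A w); last by ring.
move=> ->; rewrite normrM normrN ler_piMl//.
by rewrite ler_norml sin_geN1 sin_le1.
Qed.

End cauchy_schwarz.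

(** * The Hoeffding decomposition *)

Section winning_kernel.
Context {R : realType}.

Definition win (z : R * R) : R := ((z.2 < z.1)%R : nat)%:R.

Lemma bmf_win : bmf win.
Proof.
by apply: bmf_bool; apply: measurable_fun_ltr; [exact: measurable_snd|exact: measurable_fst].
Qed.

Lemma bmf_win_comp d (T : measurableType d) (f g : T -> R) :
  measurable_fun setT f -> measurable_fun setT g -> bmf (fun w => win (f w, g w)).
Proof. by move=> mf mg; apply: bmf_comp bmf_win; exact: measurable_fun_pair. Qed.

Lemma win01 z : 0 <= win z <= 1.
Proof. by rewrite /win; case: (_ < _); rewrite ?lexx ?ler01. Qed.

(** Measurability of [A] is inherited from [h], of which it is the level set at 1. *)
Lemma Ex_set d (T : measurableType d) (P : probability T R) (A : set T) (h : T -> R) :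
  bmf h -> (forall w, h w = \1_A w) -> fine (P A) = Ex P h.
Proof.
move=> hh hA; rewrite -Ex_indic; first by apply: eq_Ex => w; rewrite hA.
have -> : A = h @^-1` [set 1].
  apply/seteqP; split => w /=; rewrite hA indicE.
    by move=> Aw; rewrite mem_set.
  have [//|nA] := pselect (A w).
  by rewrite memNset// => /eqP; rewrite eq_sym oner_eq0.
by rewrite -[X in measurable X]setTI; apply: hh.1.
Qed.

End winning_kernel.

Section dice_laws.
Context {R : realType} {l : nat}.
Variable L : 'I_l -> probability R R.

(** Conditional probabilities that die [k] wins: given its own face for [wina], given the face of
    die [k + 1] for [winb]. *)
Definition wina k x : R := Ex (L (ordS k)) (fun y => win (x, y)).
Definition winb k y : R := Ex (L k) (fun x => win (x, y)).
(* Hoeffding decomposition [win - p_ L k = fa + fb + frr] of the kernel. *)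
Definition fa k x : R := wina k x - p_ L k.
Definition fb k y : R := winb k y - p_ L k.
Definition frr k (z : R * R) : R := win z - fa k z.1 - fb k z.2 - p_ L k.

Lemma p_E k : p_ L k = Ex (prod_prob (L k) (L (ordS k))) win.
Proof.
apply: (@Ex_set R _ _ (prod_prob (L k) (L (ordS k))) _ _ bmf_win) => z.
rewrite /win indicE; have [h|h] := boolP (z.2 < z.1); first by rewrite mem_set.
by rewrite memNset//=; apply/negP.
Qed.

Lemma bmf_wina k : bmf (wina k).
Proof. exact: (bmf_Ex1 (L (ordS k)) (L (ordS k)) bmf_win). Qed.

Lemma bmf_winb k : bmf (winb k).
Proof. exact: (bmf_Ex2 (L k) (L k) bmf_win). Qed.

Lemma Ex_wina k : Ex (L k) (wina k) = p_ L k.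
Proof. by rewrite p_E Ex_prod1//; exact: bmf_win. Qed.

Lemma Ex_winb k : Ex (L (ordS k)) (winb k) = p_ L k.
Proof. by rewrite p_E Ex_prod2//; exact: bmf_win. Qed.

Lemma bmf_fa k : bmf (fa k).
Proof. by apply: bmfB; [exact: bmf_wina|exact: bmf_cst]. Qed.

Lemma bmf_fb k : bmf (fb k).
Proof. by apply: bmfB; [exact: bmf_winb|exact: bmf_cst]. Qed.

Lemma bmf_frr k : bmf (frr k).
Proof.
have h1 : bmf (fun z : R * R => fa k z.1).
  by apply: bmf_comp (bmf_fa k); exact: measurable_fst.
have h2 : bmf (fun z : R * R => fb k z.2).
  by apply: bmf_comp (bmf_fb k); exact: measurable_snd.
exact: (bmfB (bmfB (bmfB bmf_win h1) h2) (bmf_cst (p_ L k))).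
Qed.

Lemma Ex_fa k : Ex (L k) (fa k) = 0.
Proof.
by rewrite (ExB _ (bmf_wina k) (bmf_cst _)) Ex_wina Ex_cst subrr.
Qed.

Lemma Ex_fb k : Ex (L (ordS k)) (fb k) = 0.
Proof.
by rewrite (ExB _ (bmf_winb k) (bmf_cst _)) Ex_winb Ex_cst subrr.
Qed.

Lemma Ex_frr1 k y : Ex (L k) (fun x => frr k (x, y)) = 0.
Proof.
have hw : bmf (fun x => win (x, y)) by exact: bmf_section1 bmf_win.
have h1 := bmfB hw (bmf_fa k).
rewrite (ExB _ (bmfB h1 (bmf_cst (fb k y))) (bmf_cst (p_ L k))).
rewrite (ExB _ h1 (bmf_cst (fb k y))).
rewrite (ExB _ hw (bmf_fa k)) Ex_fa !Ex_cst /fb -/(winb k y) /=; ring.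
Qed.

Lemma Ex_frr2 k x : Ex (L (ordS k)) (fun y => frr k (x, y)) = 0.
Proof.
have hw : bmf (fun y => win (x, y)) by exact: bmf_section2 bmf_win.
have h1 := bmfB hw (bmf_cst (fa k x)).
rewrite (ExB _ (bmfB h1 (bmf_fb k)) (bmf_cst (p_ L k))).
rewrite (ExB _ h1 (bmf_fb k)) (ExB _ hw (bmf_cst (fa k x))) Ex_fb !Ex_cst.
by rewrite /fa -/(wina k x) /=; ring.
Qed.

Lemma p_01 k : 0 <= p_ L k <= 1.
Proof.
rewrite p_E Ex_ge0/=; last by move=> z; have /andP[] := win01 z.
rewrite -[leRHS](Ex_cst (prod_prob (L k) (L (ordS k)))); apply: le_Ex.
- exact: bmf_win.
- exact: bmf_cst.
- by move=> z; have /andP[] := win01 z.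
Qed.

Lemma wina01 k x : 0 <= wina k x <= 1.
Proof.
rewrite Ex_ge0/=; last by move=> y; have /andP[] := win01 (x, y).
rewrite -[leRHS](Ex_cst (L (ordS k))); apply: le_Ex.
- exact: bmf_section2 bmf_win.
- exact: bmf_cst.
- by move=> y; have /andP[] := win01 (x, y).
Qed.

Lemma winb01 k y : 0 <= winb k y <= 1.
Proof.
rewrite Ex_ge0/=; last by move=> x; have /andP[] := win01 (x, y).
rewrite -[leRHS](Ex_cst (L k)); apply: le_Ex.
- exact: bmf_section1 bmf_win.
- exact: bmf_cst.
- by move=> x; have /andP[] := win01 (x, y).
Qed.

Lemma fa_le1 k x : `|fa k x| <= 1.
Proof.
have /andP[? ?] := wina01 k x; have /andP[? ?] := p_01 k.
by rewrite ler_norml /fa; apply/andP; split; lra.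
Qed.

Lemma fb_le1 k y : `|fb k y| <= 1.
Proof.
have /andP[? ?] := winb01 k y; have /andP[? ?] := p_01 k.
by rewrite ler_norml /fb; apply/andP; split; lra.
Qed.

Lemma frr_le4 k z : `|frr k z| <= 4.
Proof.
have /andP[? ?] := win01 z; have /andP[? ?] := p_01 k.
have := fa_le1 k z.1; have := fb_le1 k z.2.
rewrite !ler_norml /frr => /andP[? ?] /andP[? ?].
by apply/andP; split; lra.
Qed.

(** Given the face of die [k], the two comparisons are independent with the same conditional
    probability. The formulas for [q_] and [s_] arise likewise, by conditioning on the face shared
    by the two comparisons. *)
Lemma r_E k : r_ L k = Ex (L k) (fun x => wina k x * wina k x).
Proof.
pose h (x : R * R * R) := win (x.1.1, x.1.2) * win (x.1.1, x.2).
have m11 : measurable_fun setT (fun x : R * R * R => x.1.1).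
  exact: (measurableT_comp measurable_fst measurable_fst).
have m12 : measurable_fun setT (fun x : R * R * R => x.1.2).
  exact: (measurableT_comp measurable_snd measurable_fst).
have bh : bmf h.
  by apply: bmfM; apply: bmf_win_comp => //; exact: measurable_snd.
transitivity (Ex (prod_prob (prod_prob (L k) (L (ordS k))) (L (ordS k))) h).
  apply: (@Ex_set R _ _ (prod_prob (prod_prob (L k) (L (ordS k))) (L (ordS k)))) => //.
  move=> w; rewrite /h /win indicE /=.
  have [h1|h1] := boolP (w.1.2 < w.1.1); last first.
    by rewrite mul0r memNset//= => -[h2 _]; rewrite h2 in h1.
  have [h2|h2] := boolP (w.2 < w.1.1); last first.
    by rewrite mulr0 memNset//= => -[_ h3]; rewrite h3 in h2.
  by rewrite mulr1 mem_set.
have h1 : bmf (fun z : R * R => win z * wina k z.1).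
  apply: bmfM; first exact: bmf_win.
  by apply: bmf_comp (bmf_wina k); exact: measurable_fst.
rewrite Ex_prod1//; transitivity (Ex (prod_prob (L k) (L (ordS k)))
  (fun z => win z * wina k z.1)).
  apply: eq_Ex => -[x y] /=; rewrite /h /= ExZ//.
  exact: bmf_section2 bmf_win.
rewrite Ex_prod1//; apply: eq_Ex => x /=; rewrite -ExZ; last first.
  exact: bmf_section2 bmf_win.
by apply: eq_Ex => y; rewrite mulrC.
Qed.

Lemma q_E k : q_ L k = Ex (L (ordS k)) (fun y => winb k y * winb k y).
Proof.
pose h (x : R * R * R) := win (x.1.1, x.2) * win (x.1.2, x.2).
have m11 : measurable_fun setT (fun x : R * R * R => x.1.1).
  exact: (measurableT_comp measurable_fst measurable_fst).
have m12 : measurable_fun setT (fun x : R * R * R => x.1.2).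
  exact: (measurableT_comp measurable_snd measurable_fst).
have bh : bmf h.
  by apply: bmfM; apply: bmf_win_comp => //; exact: measurable_snd.
transitivity (Ex (prod_prob (prod_prob (L k) (L k)) (L (ordS k))) h).
  apply: (@Ex_set R _ _ (prod_prob (prod_prob (L k) (L k)) (L (ordS k)))) => //.
  move=> w; rewrite /h /win indicE /=.
  have [h1|h1] := boolP (w.2 < w.1.1); last first.
    by rewrite mul0r memNset//= => -[h2 _]; rewrite h2 in h1.
  have [h2|h2] := boolP (w.2 < w.1.2); last first.
    by rewrite mulr0 memNset//= => -[_ h3]; rewrite h3 in h2.
  by rewrite mulr1 mem_set.
rewrite Ex_prod2//; apply: eq_Ex => y; rewrite /h /=.
have b1 : bmf (fun x => win (x, y)) by exact: bmf_section1 bmf_win.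
have b2 : bmf (fun x : R * R => win (x.1, y) * win (x.2, y)).
  by apply: bmfM; [apply: bmf_comp b1; exact: measurable_fst|
    apply: bmf_comp b1; exact: measurable_snd].
rewrite Ex_prod1//= -ExZ//; apply: eq_Ex => x.
by rewrite ExZ// mulrC.
Qed.

(** Indexed by the middle die as [ordS k], so that [ord_pred] cancels against [ordS]. *)
Lemma s_E k : s_ L (ordS k) =
  Ex (L (ordS k)) (fun x => winb k x * wina (ordS k) x).
Proof.
rewrite /s_ ordSK; set j := ordS k.
pose h (x : R * R * R) := win (x.1.1, x.1.2) * win (x.1.2, x.2).
have m11 : measurable_fun setT (fun x : R * R * R => x.1.1).
  exact: (measurableT_comp measurable_fst measurable_fst).
have m12 : measurable_fun setT (fun x : R * R * R => x.1.2).
  exact: (measurableT_comp measurable_snd measurable_fst).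
have bh : bmf h.
  by apply: bmfM; apply: bmf_win_comp => //; exact: measurable_snd.
transitivity (Ex (prod_prob (prod_prob (L k) (L j)) (L (ordS j))) h).
  apply: (@Ex_set R _ _ (prod_prob (prod_prob (L k) (L j)) (L (ordS j)))) => //.
  move=> w; rewrite /h /win indicE /=.
  have [h1|h1] := boolP (w.1.2 < w.1.1); last first.
    by rewrite mul0r memNset//= => -[h2 _]; rewrite h2 in h1.
  have [h2|h2] := boolP (w.2 < w.1.2); last first.
    by rewrite mulr0 memNset//= => -[_ h3]; rewrite h3 in h2.
  by rewrite mulr1 mem_set.
have h1 : bmf (fun z : R * R => win z * wina j z.2).
  apply: bmfM; first exact: bmf_win.
  by apply: bmf_comp (bmf_wina j); exact: measurable_snd.
rewrite Ex_prod1//; transitivity (Ex (prod_prob (L k) (L j))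
  (fun z => win z * wina j z.2)).
  apply: eq_Ex => -[x y] /=; rewrite /h /= ExZ//.
  exact: bmf_section2 bmf_win.
rewrite Ex_prod2//; apply: eq_Ex => x /=; rewrite mulrC -ExZ; last first.
  exact: bmf_section1 bmf_win.
by apply: eq_Ex => y; rewrite mulrC.
Qed.

Let Ex_centered (Q : probability R R) (u v : R -> R) (p p' : R) : bmf u -> bmf v ->
  Ex Q u = p -> Ex Q v = p' ->
  Ex Q (fun x => (u x - p) * (v x - p')) = Ex Q (fun x => u x * v x) - p * p'.
Proof.
move=> hu hv up vp.
have -> : Ex Q (fun x => (u x - p) * (v x - p')) =
    Ex Q (fun x => u x * v x - (p * v x + (p' * u x - p * p'))).
  by apply: eq_Ex => x; ring.
rewrite ExB; [|exact: bmfM|]; last first.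
  by apply: bmfD; [exact: bmfZ|apply: bmfB; [exact: bmfZ|exact: bmf_cst]].
rewrite ExD; [|exact: bmfZ|by apply: bmfB; [exact: bmfZ|exact: bmf_cst]].
rewrite ExB; [|exact: bmfZ|exact: (bmf_cst (p * p'))].
by rewrite (ExZ _ p hv) (ExZ _ p' hu) up vp (Ex_cst Q (p * p')); ring.
Qed.

Lemma Ex_fa2 k : Ex (L k) (fun x => fa k x * fa k x) = r_ L k - p_ L k ^+ 2.
Proof.
by rewrite r_E expr2; apply: Ex_centered; rewrite ?Ex_wina//; exact: bmf_wina.
Qed.

Lemma Ex_fb2 k : Ex (L (ordS k)) (fun y => fb k y * fb k y) = q_ L k - p_ L k ^+ 2.
Proof.
by rewrite q_E expr2; apply: Ex_centered; rewrite ?Ex_winb//; exact: bmf_winb.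
Qed.

Lemma Ex_fba k : Ex (L (ordS k)) (fun x => fb k x * fa (ordS k) x) =
  s_ L (ordS k) - p_ L k * p_ L (ordS k).
Proof.
rewrite s_E; apply: Ex_centered; rewrite ?Ex_winb ?Ex_wina//.
  exact: bmf_winb.
exact: bmf_wina.
Qed.

End dice_laws.

Lemma ordS_neq l (k : 'I_l) : (2 <= l)%N -> ordS k != k.
Proof.
move=> l2; apply/eqP => /(congr1 val) /= e; have kl := ltn_ord k.
have [kl'|] := ltnP k.+1 l; first by rewrite modn_small// in e; lia.
move=> lk; have kE : k.+1 = l by apply/eqP; rewrite eqn_leq kl lk.
by rewrite kE modnn in e; lia.
Qed.

(** Consequently [N_k] and [N_(k+1)] share die [k + 1] only; with two dice, [k + 2] would be [k]. *)
Lemma ordSS_neq l (k : 'I_l) : (3 <= l)%N -> ordS (ordS k) != k.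
Proof.
move=> l3; apply/eqP => /(congr1 val) /= e; have kl := ltn_ord k.
have [kl'|lk] := ltnP k.+1 l.
  rewrite (modn_small kl') in e.
  have [kl''|lk'] := ltnP k.+2 l; first by rewrite modn_small// in e; lia.
  have kE : k.+2 = l by apply/eqP; rewrite eqn_leq kl' lk'.
  by rewrite kE modnn in e; lia.
have kE : k.+1 = l by apply/eqP; rewrite eqn_leq kl lk.
by rewrite kE modnn modn_small in e; lia.
Qed.

(** * Covariances of the projections *)

Section dice_projection.
Context {R : realType} {l : nat}.
Variables (hl : (3 <= l)%N) (L : 'I_l -> probability R R) (n : 'I_l -> nat).

(* The contribution of a face of die [j] with value [x] to the Hajek projection
   of [N_ D k - 'E[N_ D k]]. *)
Definition xi k j x : R :=
  (j == k)%:R * (n (ordS k))%:R * fa L k x +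
  (j == ordS k)%:R * (n k)%:R * fb L k x.

(** The covariance of the projections of [N_i] and [N_j]: by independence only products over the
    same face survive, and the [n k] faces of die [k] contribute equally. Laws and face counts
    suffice to define it. *)
Definition cov_xi i j : R :=
  \sum_k (n k)%:R * Ex (L k) (fun x => xi i k x * xi j k x).

Lemma bmf_xi k j : bmf (xi k j).
Proof. exact: (bmfD (bmfZ _ (bmf_fa L k)) (bmfZ _ (bmf_fb L k))). Qed.

Lemma Ex_xi k j : Ex (L j) (xi k j) = 0.
Proof.
have ha := bmf_fa L k; have hb := bmf_fb L k.
rewrite (ExD _ (bmfZ _ ha) (bmfZ _ hb)) !ExZ//.
have [->|jk] := eqVneq j k; first rewrite Ex_fa mulr0 add0r.
  by rewrite eq_sym (negbTE (ordS_neq _ _)) ?mul0r//; lia.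
have [->|jk'] := eqVneq j (ordS k); first by rewrite Ex_fb !mul0r mulr0 add0r.
by rewrite !mul0r add0r.
Qed.

Lemma xi_le k j x (m : R) : (forall i, (n i)%:R <= m) -> `|xi k j x| <= 2 * m.
Proof.
move=> nm; have m0 : 0 <= m by apply: le_trans (nm k).
have aux (b : bool) i y : `|y| <= 1 -> `|b%:R * (n i)%:R * y| <= m.
  move=> y1; rewrite !normrM -[leRHS]mulr1 ler_pM//.
  case: b; rewrite ?normr1 ?mul1r ?normr0 ?mul0r//.
  by rewrite ger0_norm.
rewrite (le_trans (ler_normD _ _))// [leRHS](_ : _ = m + m); last by ring.
by rewrite lerD// aux ?fa_le1 ?fb_le1.
Qed.

(** Only dice [k] and [k + 1] contribute; in each term one face count is the number of summands, and
    the squared one is the number of opponents of a face. *)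
Lemma cov_xi_diag k : cov_xi k k =
  (n k)%:R * (n (ordS k))%:R ^+ 2 * (r_ L k - p_ L k ^+ 2) +
  (n (ordS k))%:R * (n k)%:R ^+ 2 * (q_ L k - p_ L k ^+ 2).
Proof.
have Sk : ordS k != k by apply: ordS_neq; lia.
rewrite /cov_xi (bigD1 k)//= (bigD1 (ordS k))//=.
rewrite [X in _ + (_ + X)]big1 => [|j /andP[/negbTE jk /negbTE jSk]]; last first.
  rewrite (eq_Ex _ (Y := cst 0)) ?Ex_cst ?mulr0// => x.
  by rewrite /xi jk jSk !mul0r addr0 mul0r.
rewrite addr0 -Ex_fa2 -Ex_fb2; congr (_ + _); rewrite -mulrA; congr (_ * _).
  rewrite -ExZ; last by apply: bmfM; exact: bmf_fa.
  apply: eq_Ex => x; rewrite /xi eqxx eq_sym (negbTE Sk) !mul1r !mul0r; ring.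
rewrite -ExZ; last by apply: bmfM; exact: bmf_fb.
by apply: eq_Ex => x; rewrite /xi eqxx (negbTE Sk) !mul1r !mul0r; ring.
Qed.

Lemma cov_xi_next k : cov_xi k (ordS k) =
  (n k)%:R * (n (ordS k))%:R * (n (ordS (ordS k)))%:R *
  (s_ L (ordS k) - p_ L k * p_ L (ordS k)).
Proof.
have Sk : ordS k != k by apply: ordS_neq; lia.
have SSk : ordS (ordS k) != k by exact: ordSS_neq.
have SSk' : ordS (ordS k) != ordS k by apply: ordS_neq; lia.
rewrite /cov_xi (bigD1 (ordS k))//= big1 => [|j /negbTE jSk]; last first.
  rewrite (eq_Ex _ (Y := cst 0)) ?Ex_cst ?mulr0// => x; rewrite /xi jSk !mul0r addr0 add0r.
  (* Die [k] enters the projection of [N_k] but not that of [N_(k+1)], since [k + 2] is not [k]. *)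
  have [->|_] := eqVneq j k; first by rewrite eq_sym (negbTE SSk) !mul0r mulr0.
  by rewrite !mul0r.
rewrite addr0 -Ex_fba -ExZ; last by apply: bmfM; exact: bmf_xi.
rewrite -ExZ; last by apply: bmfM; [exact: bmf_fb|exact: bmf_fa].
apply: eq_Ex => x; rewrite /xi (negbTE Sk) eqxx [ordS k == _]eq_sym.
by rewrite (negbTE SSk') !mul1r !mul0r; ring.
Qed.

Lemma cov_xiC i j : cov_xi i j = cov_xi j i.
Proof.
apply: eq_bigr => k _; congr (_ * _); apply: eq_Ex => x; exact: mulrC.
Qed.

Lemma cov_xi_far i j : j != i -> j != ordS i -> i != ordS j -> cov_xi i j = 0.
Proof.
move=> ji jSi iSj; rewrite /cov_xi big1// => k _.
rewrite (eq_Ex _ (Y := cst 0)) ?Ex_cst ?mulr0// => x; rewrite /xi.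
have [->|ki] := eqVneq k i.
  by rewrite [i == j]eq_sym (negbTE ji) (negbTE iSj) !mul0r addr0 mulr0.
have [->|kj] := eqVneq k (ordS i).
  rewrite [ordS i == j]eq_sym (negbTE jSi).
  have -> : (ordS i == ordS j) = false.
    by apply/negbTE; rewrite (inj_eq (can_inj (@ordSK _))) eq_sym.
  by rewrite !mul0r addr0 mulr0.
by rewrite !mul0r addr0 mul0r.
Qed.

End dice_projection.

Section dice.
Context {d} {T : measurableType d} {R : realType} {P : probability T R} {l : nat}.
Variables (hl : (3 <= l)%N) (n : 'I_l -> nat) (L : 'I_l -> probability R R).
Variable D : forall k : 'I_l, 'I_(n k) -> {RV P >-> R}.
Hypothesis hD : independent_random_dice L D.

Let I : finType := {k : 'I_l & 'I_(n k)}.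
Let X (c : I) : {RV P >-> R} := D (tagged c).
Let LX (c : I) := L (tag c).
Let face k (i : 'I_(n k)) : I := Tagged (fun k => 'I_(n k)) i.

Let indepX : mutually_independent X. Proof. exact: hD.2. Qed.
Let lawX c : has_law (X c) (LX c). Proof. exact: hD.1. Qed.

Definition hajek k w : R := \sum_(c : {k : 'I_l & 'I_(n k)})
  xi L n k (tag c) (D (tagged c) w).

Definition remainder k w : R :=
  \sum_(i < n k) \sum_(j < n (ordS k)) frr L k (D i w, D j w).

Let sum_face (F : 'I_l -> R -> R) w :
  \sum_(c : I) F (tag c) (X c w) = \sum_k \sum_(i < n k) F k (D i w).
Proof. by rewrite (sig_big_dep _ _ (fun k i => F k (D i w))). Qed.

Let sum_tag (F : 'I_l -> R) : \sum_(c : I) F (tag c) = \sum_k (n k)%:R * F k.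
Proof.
transitivity (\sum_k \sum_(i < n k) F k).
  by rewrite (sig_big_dep _ _ (fun k (i : 'I_(n k)) => F k)).
by apply: eq_bigr => k _; rewrite sumr_const card_ord mulr_natl.
Qed.

Let bX c : measurable_fun setT (X c). Proof. exact: measurable_funPT. Qed.

Lemma bmf_hajek k : bmf (hajek k).
Proof. by apply: bmf_sum => c _; apply: bmf_comp (bmf_xi L n k (tag c)). Qed.

Let bmf_frr_face k (i : 'I_(n k)) (j : 'I_(n (ordS k))) :
  bmf (fun w => frr L k (D i w, D j w)).
Proof. exact: (bmf_pair X (face i) (face j) (bmf_frr L k)). Qed.

Lemma bmf_remainder k : bmf (remainder k).
Proof. by apply: bmf_sum => i _; apply: bmf_sum => j _; exact: bmf_frr_face. Qed.

(** Over all pairs, [fa] of a face of die [k] is counted once for each of its [n (ordS k)]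
    opponents, and symmetrically for [fb]; these multiplicities are the weights in [xi]. *)
Lemma N_decomposition k w :
  N_ D k w = (n k)%:R * (n (ordS k))%:R * p_ L k + (hajek k w + remainder k w).
Proof.
have Sk : ordS k != k by apply: ordS_neq; lia.
have -> : hajek k w = \sum_(i < n k) \sum_(j < n (ordS k)) (fa L k (D i w) + fb L k (D j w)).
  rewrite /hajek (sum_face (xi L n k)) (bigD1 k)//= (bigD1 (ordS k))//=.
  rewrite [X in _ + (_ + X)]big1 => [|j /andP[/negbTE jk /negbTE jSk]]; last first.
    by rewrite big1// => i _; rewrite /xi jk jSk !mul0r addr0.
  rewrite addr0; under [RHS]eq_bigr do rewrite big_split/=.
  rewrite [RHS]big_split/=; congr (_ + _).
    apply: eq_bigr => i _; rewrite sumr_const card_ord /xi eqxx eq_sym (negbTE Sk).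
    by rewrite mul1r !mul0r addr0 mulr_natl.
  rewrite sumr_const card_ord -mulr_natl mulr_sumr; apply: eq_bigr => j _.
  by rewrite /xi eqxx (negbTE Sk) mul1r !mul0r add0r.
have -> : (n k)%:R * (n (ordS k))%:R * p_ L k =
    \sum_(i < n k) \sum_(j < n (ordS k)) p_ L k.
  by rewrite !sumr_const !card_ord -natrM mulr_natl mulnC mulrnA.
rewrite -!big_split; apply: eq_bigr => i _; rewrite -!big_split.
by apply: eq_bigr => j _ /=; rewrite /frr /win /=; ring.
Qed.

Lemma Ex_hajek k : Ex P (hajek k) = 0.
Proof.
rewrite Ex_sum => [|c _]; last by apply: bmf_comp (bmf_xi L n k (tag c)); exact: bX.
apply: big1 => c _.
by rewrite (Ex_law (lawX c) (bmf_xi L n k (tag c))) Ex_xi.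
Qed.

Lemma Ex_hajek_hajek i j : Ex P (fun w => hajek i w * hajek j w) = cov_xi L n i j.
Proof.
rewrite (Ex_sqr_sum indepX lawX (u := fun c => xi L n i (tag c))
  (u' := fun c => xi L n j (tag c))) => [|c|c|c|c].
- exact: (sum_tag (fun k => Ex (L k) (fun x => xi L n i k x * xi L n j k x))).
- exact: bmf_xi.
- exact: bmf_xi.
- exact: Ex_xi.
- exact: Ex_xi.
Qed.

Let face_neq k k' (i : 'I_(n k)) (j : 'I_(n k')) : k' != k -> face j != face i.
Proof. by apply: contraNneq => /(congr1 tag) /= ->. Qed.

(** [G] misses one of the two faces, and [frr] averages to 0 over that face with the other one held
    fixed. *)
Let frr_orth k (i : 'I_(n k)) (j : 'I_(n (ordS k))) c2 c3 (G : R * R -> R) : bmf G ->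
  (c2 != face i /\ c3 != face i) \/ (c2 != face j /\ c3 != face j) ->
  Ex P (fun w => G (X c2 w, X c3 w) * frr L k (D i w, D j w)) = 0.
Proof.
have Sk : ordS k != k by apply: ordS_neq; lia.
move=> hG [[h2 h3]|[h2 h3]].
  apply: (Ex_degenerate indepX lawX (c0 := face i) (c1 := face j) _ h2 h3 (bmf_frr L k) hG).
    exact: face_neq.
  by move=> y; exact: Ex_frr1.
(* [Ex_degenerate] integrates the first argument, so the arguments of [frr] are swapped. *)
have hF : bmf (fun z => frr L k (z.2, z.1)).
  apply: bmf_comp (bmf_frr L k); apply: measurable_fun_pair.
    exact: measurable_snd.
  exact: measurable_fst.
apply: (Ex_degenerate indepX lawX (c0 := face j) (c1 := face i) _ h2 h3 hF hG).
  by rewrite eq_sym; exact: face_neq.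
by move=> x; exact: Ex_frr2.
Qed.

Lemma Ex_remainder k : Ex P (remainder k) = 0.
Proof.
have Sk : ordS k != k by apply: ordS_neq; lia.
rewrite Ex_sum => [|i _]; last by apply: bmf_sum => j _; exact: bmf_frr_face.
apply: big1 => i _; rewrite Ex_sum => [|j _]; last exact: bmf_frr_face.
apply: big1 => j _.
have := @frr_orth k i j (face j) (face j) (cst 1) (bmf_cst 1).
by move=> <-; [apply: eq_Ex => w; rewrite mul1r|left; split; exact: face_neq].
Qed.

(** The two faces of a pair belong to different dice, so a single face differs from at least one of
    them. *)
Lemma Ex_hajek_remainder i k : Ex P (fun w => hajek i w * remainder k w) = 0.
Proof.
have Sk : ordS k != k by apply: ordS_neq; lia.
transitivity (Ex P (fun w => \sum_(c : I) \sum_(u < n k) \sum_(v < n (ordS k))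
    xi L n i (tag c) (X c w) * frr L k (D u w, D v w))).
  apply: eq_Ex => w; rewrite mulr_suml; apply: eq_bigr => c _.
  by rewrite mulr_sumr; apply: eq_bigr => u _; rewrite mulr_sumr.
have bt (c : I) (u : 'I_(n k)) (v : 'I_(n (ordS k))) :
    bmf (fun w => xi L n i (tag c) (X c w) * frr L k (D u w, D v w)).
  apply: bmfM; last exact: bmf_frr_face.
  by apply: bmf_comp (bmf_xi L n i (tag c)); exact: bX.
rewrite Ex_sum => [|c _]; last by apply: bmf_sum => u _; apply: bmf_sum => v _; exact: bt.
apply: big1 => c _; rewrite Ex_sum => [|u _]; last by apply: bmf_sum => v _; exact: bt.
apply: big1 => u _; rewrite Ex_sum => [|v _]; last exact: bt.
apply: big1 => v _.
have hG : bmf (fun z : R * R => xi L n i (tag c) z.1).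
  by apply: bmf_comp (bmf_xi L n i (tag c)); exact: measurable_fst.
apply: (@frr_orth k u v c c _ hG).
have [cu|cu] := eqVneq c (face u); last by left.
by right; rewrite cu eq_sym; split; exact: face_neq.
Qed.

(** Two distinct pairs differ in some position, and the face of one pair there does not occur in the
    other, so cross terms vanish. Each diagonal term is at most [4^2 = 16]. *)
Lemma Ex_remainder2 k : Ex P (fun w => remainder k w * remainder k w) <=
  16 * ((n k)%:R * (n (ordS k))%:R).
Proof.
have Sk : ordS k != k by apply: ordS_neq; lia.
pose f (u : 'I_(n k) * 'I_(n (ordS k))) w := frr L k (D u.1 w, D u.2 w).
have bf u : bmf (f u) by exact: bmf_frr_face.
have remE w : remainder k w = \sum_u f u w.
  by rewrite /remainder (pair_big_dep _ _ (fun i j => frr L k (D i w, D j w))).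
have -> : Ex P (fun w => remainder k w * remainder k w) = \sum_u Ex P (fun w => f u w * f u w).
  transitivity (Ex P (fun w => \sum_u \sum_v f v w * f u w)).
    apply: eq_Ex => w; rewrite remE mulr_sumr; apply: eq_bigr => u _.
    by rewrite mulr_suml.
  rewrite Ex_sum => [|u _]; last by apply: bmf_sum => v _; exact: bmfM.
  apply: eq_bigr => u _; rewrite Ex_sum => [|v _]; last exact: bmfM.
  rewrite (bigD1 u)//= big1 ?addr0// => v vu.
  apply: (@frr_orth k u.1 u.2 (face v.1) (face v.2) (frr L k) (bmf_frr L k)).
  have [e1|e1] := eqVneq v.1 u.1; last first.
    left; split; last exact: face_neq.
    by apply: contra_neq e1 => /eqP; rewrite eq_Tagged => /eqP.
  right; split; first by rewrite eq_sym; exact: face_neq.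
  apply: contraNneq vu => /eqP; rewrite eq_Tagged/= => /eqP e2.
  by apply/eqP; case: v u e1 e2 => [v1 v2] [u1 u2] /= -> ->.
rewrite (@le_trans _ _ (\sum_(u : 'I_(n k) * 'I_(n (ordS k))) 16))//; last first.
  by rewrite sumr_const card_prod !card_ord -natrM mulr_natr.
apply: ler_sum => u _; rewrite -[leRHS](Ex_cst P); apply: le_Ex.
- exact: bmfM.
- exact: bmf_cst.
move=> w; rewrite -expr2 -real_normK ?num_real//.
have := frr_le4 L k (D u.1 w, D u.2 w); rewrite -/(f u w) => h.
by have := normr_ge0 (f u w); rewrite /cst; nra.
Qed.

Let Y k := standardize P (N_ D k).

Let bmf_N k : bmf (N_ D k).
Proof.
apply: (@eq_bmf _ _ _ (fun w => (n k)%:R * (n (ordS k))%:R * p_ L k +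
  (hajek k w + remainder k w))) => [w|]; first by rewrite N_decomposition.
by apply: bmfD; [exact: bmf_cst|apply: bmfD; [exact: bmf_hajek|exact: bmf_remainder]].
Qed.

Let rho k := Ex P (fun w => remainder k w * remainder k w).

Let rho_ge0 k : 0 <= rho k.
Proof. by apply: Ex_ge0 => w; rewrite -expr2 sqr_ge0. Qed.

(** Projection and remainder are centered and orthogonal, so the variance of [N_k] is the sum of
    their second moments. *)
Lemma standardize_N k w :
  standardize P (N_ D k) w =
  (hajek k w + remainder k w) / Num.sqrt (cov_xi L n k k +
    Ex P (fun w => remainder k w * remainder k w)).
Proof.
have hM := bmf_hajek k; have hR := bmf_remainder k.
have hMR := bmfD hM hR.
have EN : Ex P (N_ D k) = (n k)%:R * (n (ordS k))%:R * p_ L k.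
  rewrite (eq_Ex _ (N_decomposition k)) (ExD _ (bmf_cst _) hMR) ExD//.
  by rewrite Ex_hajek Ex_remainder !addr0 Ex_cst.
have EE : ('E_P[N_ D k] = ((n k)%:R * (n (ordS k))%:R * p_ L k)%:E)%E.
  by rewrite expectationEx ?EN.
have VN : fine ('V_P[N_ D k])%E = cov_xi L n k k + rho k.
  rewrite /variance unlock EE /=.
  have E z : (((N_ D k \- cst ((n k)%:R * (n (ordS k))%:R * p_ L k)) *
      (N_ D k \- cst ((n k)%:R * (n (ordS k))%:R * p_ L k))) z =
      hajek k z * hajek k z + (2 * (hajek k z * remainder k z) +
      remainder k z * remainder k z))%R.
    transitivity ((N_ D k z - (n k)%:R * (n (ordS k))%:R * p_ L k) *
      (N_ D k z - (n k)%:R * (n (ordS k))%:R * p_ L k)) => //.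
    by rewrite N_decomposition; ring.
  have b2 : bmf (fun z => 2 * (hajek k z * remainder k z)) by apply: bmfZ; exact: bmfM.
  have b3 : bmf (fun z => hajek k z * hajek k z + (2 * (hajek k z * remainder k z) +
      remainder k z * remainder k z)).
    by apply: bmfD; [exact: bmfM|apply: bmfD => //; exact: bmfM].
  rewrite expectationEx/=; last by apply: eq_bmf b3 => z; rewrite E.
  rewrite (eq_Ex _ E) ExD; [|exact: bmfM|by apply: bmfD => //; exact: bmfM].
  rewrite (ExD _ b2); last exact: bmfM.
  rewrite ExZ; last exact: bmfM.
  by rewrite Ex_hajek_hajek Ex_hajek_remainder mulr0 add0r.
rewrite /standardize VN EE /= N_decomposition.
by rewrite [_ + (_ + _)]addrC addrK.
Qed.

Lemma bmf_standardize k : bmf (standardize P (N_ D k)).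
Proof.
apply: (@eq_bmf _ _ _ (fun w => (Num.sqrt (cov_xi L n k k + rho k))^-1 *
  (hajek k w + remainder k w))) => [w|]; first by rewrite standardize_N mulrC.
by apply: bmfZ; apply: bmfD; [exact: bmf_hajek|exact: bmf_remainder].
Qed.

Let quadratic k (a b : R) :
  Ex P (fun w => (a * hajek k w + b * remainder k w) * (a * hajek k w + b * remainder k w))
  = a ^+ 2 * cov_xi L n k k + b ^+ 2 * rho k.
Proof.
have hM := bmf_hajek k; have hR := bmf_remainder k.
have b1 : bmf (fun w => a ^+ 2 * (hajek k w * hajek k w)) by apply: bmfZ; exact: bmfM.
have b2 : bmf (fun w => 2 * a * b * (hajek k w * remainder k w)) by apply: bmfZ; exact: bmfM.
have b3 : bmf (fun w => b ^+ 2 * (remainder k w * remainder k w)) by apply: bmfZ; exact: bmfM.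
transitivity (Ex P (fun w => a ^+ 2 * (hajek k w * hajek k w) +
   (2 * a * b * (hajek k w * remainder k w) + b ^+ 2 * (remainder k w * remainder k w)))).
  by apply: eq_Ex => w; ring.
rewrite ExD//; last exact: bmfD.
rewrite ExD// !ExZ; [|exact: bmfM..].
by rewrite Ex_hajek_hajek Ex_hajek_remainder mulr0 add0r.
Qed.

Variables (k : 'I_l) (v : R).
Hypotheses (v0 : 0 < v) (vE : v ^+ 2 = cov_xi L n k k).

(** Positivity of [v] keeps the variance away from 0, where the quotient would be 0 by convention.
    This is the input for tightness. *)
Lemma Ex_standardize2 :
  Ex P (fun w => standardize P (N_ D k) w * standardize P (N_ D k) w) = 1.
Proof.
pose s := Num.sqrt (cov_xi L n k k + rho k).
have s2 : s ^+ 2 = cov_xi L n k k + rho k.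
  by rewrite sqr_sqrtr// -vE addr_ge0// sqr_ge0.
have s0 : 0 < s by rewrite sqrtr_gt0 -vE ltr_pwDl// exprn_gt0.
transitivity (Ex P (fun w => (s^-1 * hajek k w + s^-1 * remainder k w) *
    (s^-1 * hajek k w + s^-1 * remainder k w))).
  by apply: eq_Ex => w; rewrite standardize_N -/(rho k) -/s; ring.
rewrite quadratic -mulrDr -s2 exprVn mulVf// expf_neq0// gt_eqF//.
Qed.

Lemma Ex_standardizeB_hajek2 :
  Ex P (fun w => (standardize P (N_ D k) w - hajek k w / v) *
                 (standardize P (N_ D k) w - hajek k w / v)) <=
  32 * ((n k)%:R * (n (ordS k))%:R) / v ^+ 2.
Proof.
pose s := Num.sqrt (cov_xi L n k k + rho k).
have s2 : s ^+ 2 = v ^+ 2 + rho k by rewrite vE sqr_sqrtr// -vE addr_ge0// sqr_ge0.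
have s0 : 0 < s by rewrite sqrtr_gt0 -vE ltr_pwDl// exprn_gt0.
rewrite (eq_Ex _ (Y := fun w =>
  ((s^-1 - v^-1) * hajek k w + s^-1 * remainder k w) *
  ((s^-1 - v^-1) * hajek k w + s^-1 * remainder k w))) => [|w]; last first.
  by rewrite standardize_N -/(rho k) -/s; ring.
rewrite quadratic -vE.
have r0 := rho_ge0 k.
have vs : v <= s by rewrite -(@ler_pXn2r _ 2) ?nnegrE ?(ltW v0) ?(ltW s0)// s2 lerDl.
(* In terms of this ratio of standard deviations the left side is [2 (1 - x)], at most
   [2 (1 - x^2) = 2 rho k / s^2]; the bound 16 on the remainder then yields 32. *)
pose x := v / s.
have x0 : 0 < x by rewrite divr_gt0.
have x1 : x <= 1 by rewrite ler_pdivrMr// mul1r.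
have -> : (s^-1 - v^-1) ^+ 2 * v ^+ 2 + s^-1 ^+ 2 * rho k = (x - 1) ^+ 2 + (1 - x ^+ 2).
  have -> : rho k = s ^+ 2 - v ^+ 2 by rewrite s2; ring.
  by rewrite /x; field; rewrite !gt_eqF.
have h1 : (x - 1) ^+ 2 + (1 - x ^+ 2) <= 2 * (1 - x ^+ 2) by nra.
apply: (le_trans h1).
have -> : 1 - x ^+ 2 = rho k / s ^+ 2.
  have -> : rho k = s ^+ 2 - v ^+ 2 by rewrite s2; ring.
  by rewrite /x; field; rewrite gt_eqF.
have h2 : rho k / s ^+ 2 <= rho k / v ^+ 2.
  rewrite ler_wpM2l// lef_pV2 ?posrE ?exprn_gt0//.
  by rewrite ler_pXn2r ?nnegrE ?(ltW v0) ?(ltW s0).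
have h3 : rho k / v ^+ 2 <= 16 * ((n k)%:R * (n (ordS k))%:R) / v ^+ 2.
  by rewrite ler_wpM2r ?invr_ge0 ?sqr_ge0//; exact: Ex_remainder2.
lra.
Qed.

End dice.

(** * Asymptotic normality *)

Section fixed_dice_clt.
Context {d} {T : measurableType d} {R : realType} {P : probability T R} {l : nat}.
Variables (hl : (3 <= l)%N) (n : 'I_l -> nat) (L : 'I_l -> probability R R).
Variable D : forall k : 'I_l, 'I_(n k) -> {RV P >-> R}.
Hypothesis hD : independent_random_dice L D.
Variable v : 'I_l -> R.

Let I : finType := {k : 'I_l & 'I_(n k)}.
Let X (c : I) : {RV P >-> R} := D (tagged c).
Let LX (c : I) := L (tag c).
Let indepX : mutually_independent X. Proof. exact: hD.2. Qed.
Let lawX c : has_law (X c) (LX c). Proof. exact: hD.1. Qed.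

(** The normalization [v] is free here; it becomes the standard deviation of the projections, and
    the matrix their correlation matrix. *)
Definition hajek_corr : 'M[R]_l := \matrix_(i, j) (cov_xi L n i j / (v i * v j)).

Let W (t : 'I_l -> R) w := \sum_k t k * (hajek L D k w / v k).

Let bmf_hajek_div k : bmf (fun w => hajek L D k w / v k).
Proof.
by apply: (@eq_bmf _ _ _ (fun w => (v k)^-1 * hajek L D k w)) => [w|];
  [exact: mulrC|exact/bmfZ/bmf_hajek].
Qed.

Let bmf_W t : bmf (W t).
Proof. by apply: bmf_sum => k _; exact: bmfZ. Qed.

(** The form is the variance of [W t]: this gives its sign, and makes it the exponent of the
    Gaussian transform. *)
Lemma quad_form_hajek_corr t :
  quad_form hajek_corr t = Ex P (fun w => W t w * W t w).
Proof.
have hh i j : bmf (fun w => hajek L D i w * hajek L D j w).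
  by apply: bmfM; exact: bmf_hajek.
rewrite (eq_Ex _ (Y := fun w => \sum_i \sum_j
    (t i * t j / (v i * v j)) * (hajek L D i w * hajek L D j w))); last first.
  move=> w; rewrite mulr_suml; apply: eq_bigr => i _.
  rewrite mulr_sumr; apply: eq_bigr => j _; rewrite invfM; ring.
rewrite Ex_sum => [|i _]; last by apply: bmf_sum => j _; exact: bmfZ.
apply: eq_bigr => i _; rewrite Ex_sum => [|j _]; last exact: bmfZ.
apply: eq_bigr => j _; rewrite ExZ// Ex_hajek_hajek// mxE; ring.
Qed.

Lemma quad_form_hajek_corr_ge0 t : 0 <= quad_form hajek_corr t.
Proof. by rewrite quad_form_hajek_corr Ex_ge0// => w; rewrite -expr2 sqr_ge0. Qed.

(** The total contribution of one face to [W t]. A face enters the projections of two consecutive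
    counts, and grouping by faces makes the summands independent. *)
Let u t (c : I) x := \sum_k (t k / v k) * xi L n k (tag c) x.

Let bmf_u t c : bmf (u t c).
Proof. by apply: bmf_sum => k _; exact/bmfZ/bmf_xi. Qed.

Let Ex_u t c : Ex (LX c) (u t c) = 0.
Proof.
rewrite Ex_sum => [|k _]; last exact/bmfZ/bmf_xi.
by apply: big1 => k _; rewrite ExZ ?Ex_xi ?mulr0//; exact: bmf_xi.
Qed.

Let W_sum t w : W t w = \sum_c u t c (X c w).
Proof.
rewrite exchange_big/=; apply: eq_bigr => k _.
rewrite /hajek mulr_suml mulr_sumr; apply: eq_bigr => c _; ring.
Qed.

Lemma Ex_cos_hajek t b delta : 0 <= delta ->
  (forall j x, `|\sum_k (t k / v k) * xi L n k j x| <= delta) ->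
  `|Ex P (fun w => cos (W t w + b)) - expR (- (quad_form hajek_corr t / 2)) * cos b|
    <= (delta + 2 * delta ^+ 2) * quad_form hajek_corr t.
Proof.
move=> d0 hd.
have -> : quad_form hajek_corr t = \sum_c Ex (LX c) (fun x => u t c x ^+ 2).
  rewrite quad_form_hajek_corr (eq_Ex _ (Y := fun w =>
    (\sum_c u t c (X c w)) * (\sum_c u t c (X c w)))) => [|w]; last by rewrite W_sum.
  rewrite (Ex_sqr_sum indepX lawX (bmf_u t) (bmf_u t) (Ex_u t) (Ex_u t)).
  by apply: eq_bigr => c _; apply: eq_Ex => x.
rewrite (eq_Ex _ (Y := fun w => cos (\sum_c u t c (X c w) + b))) => [|w]; last first.
  by rewrite W_sum.
exact: (Ex_cos_sum_le indepX lawX (bmf_u t) d0 (fun c => hd (tag c)) (Ex_u t)).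
Qed.

Variable m : R.
Hypotheses (nm : forall k, (n k)%:R <= m) (v0 : forall k, 0 < v k).
Hypothesis vE : forall k, v k ^+ 2 = cov_xi L n k k.

(** One face contributes at most [delta = 2 e] since [xi] is at most [2 m], and [delta + 2 delta^2]
    is [2 e + 8 e^2]. The term [6 e] pays for replacing the standardized counts by the
    projections. *)
Lemma Ex_cos_standardize t b (e := \sum_k `|t k| * (m / v k)) :
  `|Ex P (fun w => cos (\sum_k t k * standardize P (N_ D k) w + b)) -
    expR (- (quad_form hajek_corr t / 2)) * cos b|
    <= (2 * e + 8 * e ^+ 2) * quad_form hajek_corr t + 6 * e.
Proof.
have m0 (k : 'I_l) : 0 <= m by rewrite (le_trans _ (nm k)).
have e0 : 0 <= e.
  by apply: sumr_ge0 => k _; rewrite mulr_ge0// divr_ge0 ?(m0 k)// ltW.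
have he j x : `|\sum_k (t k / v k) * xi L n k j x| <= 2 * e.
  rewrite (le_trans (ler_norm_sum _ _ _))// mulr_sumr ler_sum// => k _.
  rewrite normrM normrM normfV (gtr0_norm (v0 k)).
  have := xi_le L k j x nm => h.
  have -> : 2 * (`|t k| * (m / v k)) = `|t k| / v k * (2 * m) by ring.
  by rewrite ler_wpM2l// divr_ge0// ltW.
have e20 : 0 <= 2 * e by rewrite mulr_ge0.
have h1 := Ex_cos_hajek b e20 he.
have bY k := bmf_standardize hl hD k.
have bS : bmf (fun w => \sum_k t k * standardize P (N_ D k) w).
  by apply: bmf_sum => k _; exact: bmfZ.
have bd k : bmf (fun w => standardize P (N_ D k) w - hajek L D k w / v k) by exact: bmfB.
have bdt k : bmf (fun w => t k * (standardize P (N_ D k) w - hajek L D k w / v k)).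
  exact: bmfZ.
have E w : (\sum_k t k * standardize P (N_ D k) w + b) - (W t w + b) =
    \sum_k t k * (standardize P (N_ D k) w - hajek L D k w / v k).
  transitivity (\sum_k t k * standardize P (N_ D k) w - W t w); first by ring.
  by rewrite -sumrB; apply: eq_bigr => k _; ring.
have bE : bmf (fun w => (\sum_k t k * standardize P (N_ D k) w + b) - (W t w + b)).
  by apply: (eq_bmf (fun w => esym (E w))); apply: bmf_sum => k _; exact: bdt.
have h2 : `|Ex P (fun w => cos (\sum_k t k * standardize P (N_ D k) w + b)) -
    Ex P (fun w => cos (W t w + b))| <= 6 * e.
  have ma : measurable_fun setT (fun w => \sum_k t k * standardize P (N_ D k) w + b).
    by have [] := bmfD bS (bmf_cst b).
  have mb : measurable_fun setT (fun w => W t w + b).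
    by have [] := bmfD (bmf_W t) (bmf_cst b).
  rewrite (le_trans (Ex_cos_dist _ ma mb bE))//.
  rewrite (@le_trans _ _ (Ex P (fun w => \sum_k `|t k| *
      `|standardize P (N_ D k) w - hajek L D k w / v k|)))//.
    apply: le_Ex => [||w]; [exact: bmf_norm| |].
      by apply: bmf_sum => k _; exact/bmfZ/bmf_norm.
    rewrite E (le_trans (ler_norm_sum _ _ _))// ler_sum// => k _.
    by rewrite normrM.
  rewrite Ex_sum => [|k _]; last exact/bmfZ/bmf_norm.
  rewrite mulr_sumr ler_sum// => k _.
  rewrite ExZ; last exact: bmf_norm.
  rewrite mulrCA ler_wpM2l//; apply: Ex_norm_le_sqr => //.
    by rewrite mulr_ge0// divr_ge0 ?(m0 k)// ltW.
  rewrite (le_trans (Ex_standardizeB_hajek2 hl hD (v0 k) (vE k)))//.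
  (* The square root of 32 is rounded up to 6. *)
  have -> : (6 * (m / v k)) ^+ 2 = 36 * (m * m) / v k ^+ 2.
    by field; rewrite gt_eqF.
  rewrite ler_wpM2r ?invr_ge0 ?sqr_ge0// ler_pM ?mulr_ge0 ?ler_nat//.
  by rewrite ler_pM.
set A := Ex P _ in h2 *; set B := Ex P _ in h1 h2.
set G := _ * cos b in h1 *.
rewrite (_ : A - G = (A - B) + (B - G)); last by ring.
rewrite (le_trans (ler_normD _ _))// addrC lerD//.
by rewrite (le_trans h1)// exprMn le_eqVlt; apply/orP; left; apply/eqP; ring.
Qed.

End fixed_dice_clt.

(** * Normalization by powers of [m] *)

Section dice_scaling.
Context {R : realType} {l : nat}.
Variables (hl : (3 <= l)%N) (n : 'I_l -> nat) (L : 'I_l -> probability R R).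
Variables (m : R) (f : 'I_l -> R).
Hypotheses (m0 : 0 < m) (hf : forall k, f k = (n k)%:R / m).
Hypothesis sigma0 : forall k, 0 < sigma_ L f k.

Definition hajek_sd k := Num.sqrt (m ^+ 3) * sigma_ L f k.

Let sm : Num.sqrt (m ^+ 3) ^+ 2 = m ^+ 3.
Proof. by rewrite sqr_sqrtr// exprn_ge0// ltW. Qed.

Lemma hajek_sd_gt0 k : 0 < hajek_sd k.
Proof. by rewrite mulr_gt0// sqrtr_gt0 exprn_gt0. Qed.

Lemma sqr_hajek_sd k : hajek_sd k ^+ 2 = cov_xi L n k k.
Proof.
(* The radicand of [sigma_] is positive because its square root is, [sqrt] being 0 on negative
   numbers. *)
rewrite exprMn sm sqr_sqrtr; last by rewrite ltW// -sqrtr_gt0; exact: sigma0.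
by rewrite cov_xi_diag// !hf; field; rewrite gt_eqF.
Qed.

Lemma div_hajek_sd k : m / hajek_sd k = (Num.sqrt m)^-1 / sigma_ L f k.
Proof.
have s0 : 0 < Num.sqrt m by rewrite sqrtr_gt0.
have -> : hajek_sd k = m * Num.sqrt m * sigma_ L f k.
  by rewrite /hajek_sd exprSr sqrtrM ?sqr_ge0// sqrtr_sqr gtr0_norm.
by field; rewrite !gt_eqF.
Qed.

Let corr_next k : cov_xi L n k (ordS k) / (hajek_sd k * hajek_sd (ordS k)) =
  gamma_ L f (ordS k).
Proof.
rewrite cov_xi_next// /gamma_ ordSK !hf.
have -> : hajek_sd k * hajek_sd (ordS k) =
    m ^+ 3 * (sigma_ L f k * sigma_ L f (ordS k)).
  by rewrite -sm /hajek_sd; ring.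
by field; rewrite !gt_eqF.
Qed.

Lemma hajek_corr_cyclic : hajek_corr n L hajek_sd = cyclic_cov (gamma_ L f).
Proof.
apply/matrixP => i j; rewrite !mxE.
have [->|ji] := eqVneq j i.
  by rewrite -sqr_hajek_sd -expr2 divff// expf_neq0// gt_eqF// hajek_sd_gt0.
have [->|jSi] := eqVneq j (ordS i); first exact: corr_next.
have [->|iSj] := eqVneq i (ordS j).
  by rewrite cov_xiC mulrC [_ (ordS j) * _]mulrC mulrC corr_next.
by rewrite cov_xi_far// mul0r.
Qed.

End dice_scaling.

Lemma cvg_quad_form {R : realType} l (S : nat -> 'M[R]_l) (S' : 'M[R]_l) t :
  (forall i j, S m i j @[m --> \oo] --> S' i j) ->
  quad_form (S m) t @[m --> \oo] --> quad_form S' t.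
Proof.
move=> h; apply: cvg_sumr => i; apply: cvg_sumr => j.
by apply: cvgM; [exact: cvg_cst|exact: h].
Qed.

Lemma cvg_cyclic_cov {R : realType} l (g : nat -> 'I_l -> R) (g' : 'I_l -> R) i j :
  (forall k, g m k @[m --> \oo] --> g' k) ->
  cyclic_cov (g m) i j @[m --> \oo] --> cyclic_cov g' i j.
Proof.
move=> h; under eq_fun do rewrite mxE; rewrite mxE.
by do 3 (case: ifP => _; [exact: h || exact: cvg_cst|]); exact: cvg_cst.
Qed.

(** The entries are chosen by nested tests. For [3 <= l], [j = i + 1] and [i = j + 1] exclude each
    other, so the order of the tests is immaterial. *)
Lemma tr_cyclic_cov {R : realType} l (g : 'I_l -> R) : (3 <= l)%N ->
  (cyclic_cov g)^T = cyclic_cov g.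
Proof.
move=> hl; apply/matrixP => i j; rewrite !mxE eq_sym.
have [//|ji] := eqVneq j i.
have [->|iSj] := eqVneq i (ordS j); last by case: eqVneq.
by rewrite eq_sym (negbTE (ordSS_neq _ _)).
Qed.

Theorem theorem5 (R : realType) (l : nat) (hl : (3 <= l)%N)
    (d : nat -> measure_display) (T : forall m, measurableType (d m))
    (P : forall m, probability (T m) R)
    (n : nat -> 'I_l -> nat) (hn : forall m k, (n m k <= m)%N)
    (L : nat -> 'I_l -> probability R R)
    (D : forall m (k : 'I_l), 'I_(n m k) -> {RV (P m) >-> R})
    (hD : forall m, independent_random_dice (L m) (D m))
    (f : nat -> 'I_l -> R) (hf : forall m k, f m k = (n m k)%:R / m%:R)
    (foo poo sigmaoo gammaoo : 'I_l -> R)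
    (hfoo : forall k, 0 < foo k <= 1)
    (hpoo : forall k, 0 < poo k <= 1)
    (hsigmaoo : forall k, 0 < sigmaoo k)
    (hgammaoo : forall k, -1 <= gammaoo k <= 1)
    (cvg_f : forall k, f m k @[m --> \oo] --> foo k)
    (cvg_p : forall k, p_ (L m) k @[m --> \oo] --> poo k)
    (cvg_sigma : forall k, sigma_ (L m) (f m) k @[m --> \oo] --> sigmaoo k)
    (cvg_gamma : forall k, gamma_ (L m) (f m) k @[m --> \oo] --> gammaoo k) :
  exists (d' : measure_display) (T' : measurableType d')
    (P' : probability T' R) (X : 'I_l -> {RV P' >-> R}),
    centered_gaussian_vector X (cyclic_cov gammaoo) /\
    cvg_in_distribution P
      (fun m k => standardize (P m) (N_ (D m) k)) P' X.
Proof.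
pose S m := cyclic_cov (gamma_ (L m) (f m)).
have cvg_S t : quad_form (S m) t @[m --> \oo] --> quad_form (cyclic_cov gammaoo) t.
  by apply: cvg_quad_form => i j; exact: cvg_cyclic_cov.
(* For small [m] the number [sigma_] may vanish, as it does at [m = 0] where [f] is a division by 0;
   all estimates are used eventually. *)
have sigma_gt0 : \forall m \near \oo, forall k, 0 < sigma_ (L m) (f m) k.
  by apply: filter_forall => k; exact: (cvgr_gt _ (cvg_sigma k) _ (hsigmaoo k)).
have m_gt0 : \forall m \near \oo, 0 < m%:R :> R.
  by near=> m; rewrite ltr0n; near: m; exact: nbhs_infty_gt.
have psd t : 0 <= quad_form (cyclic_cov gammaoo) t.
  apply: (cvgr_to_ge (cvg_S t)); near=> m.
  have m0 : 0 < m%:R :> R by near: m.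
  have s0 : forall k, 0 < sigma_ (L m) (f m) k by near: m.
  rewrite /S -(hajek_corr_cyclic hl m0 (hf m) s0).
  exact: (quad_form_hajek_corr_ge0 hl (hD m)).
have [d' [T' [P' [X [gX cosX]]]]] :=
  centered_gaussian_vector_exists (tr_cyclic_cov gammaoo hl) psd.
(* [bounded_fun] gives a bound by every number strictly above [K], of which [K + 1] is one. *)
exists d', T', P', X; split=> // g cg [K [_ /(_ (K + 1))]].
rewrite ltrDl ltr01 => /(_ isT) gK.
have {}gK x : `|g x| <= K + 1 by exact: gK.
pose Y m k := standardize (P m) (N_ (D m) k).
have bY m k : bmf (Y m k) by exact: (bmf_standardize hl (hD m)).
have mY m k : measurable_fun setT (Y m k) by have [] := bY m k.
have mX k : measurable_fun setT (X k) by exact: measurable_funPT.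
suff H : Ex (P m) (fun w => g (\row_k Y m k w)) @[m --> \oo] -->
    Ex P' (fun w => g (\row_k X k w)).
  rewrite expectationEx; last exact: bmf_continuous.
  under eq_fun do rewrite (expectationEx _ (bmf_continuous (mY _) cg gK)).
  by apply: cvg_EFin => //; exact: nearW.
apply: (cvg_Ex_continuous mY mX _ _ cg gK) => [e e0|t b].
  (* Standardized counts have second moment 1, so the tail is at most [M ^- 2 <= M^-1 <= e]. *)
  exists (Num.max 1 e^-1) => k; near=> m.
  have m0 : 0 < m%:R :> R by near: m.
  have s0 : forall k, 0 < sigma_ (L m) (f m) k by near: m.
  set M := Num.max _ _.
  have M1 : 1 <= M by rewrite le_max lexx.
  have Me : e^-1 <= M by rewrite le_max lexx orbT.
  have M0 : 0 < M by rewrite (lt_le_trans ltr01).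
  rewrite (le_trans (markov_sqr _ (bY m k) M0))//.
  rewrite (Ex_standardize2 hl (hD m) (hajek_sd_gt0 m0 s0 k)
    (sqr_hajek_sd hl m0 (hf m) s0 k)) mulr1 expr2 invfM.
  rewrite -[leRHS]mulr1 ler_pM ?invr_ge0 ?(ltW M0)//.
    by rewrite -[leRHS]invrK lef_pV2 ?posrE ?invr_gt0.
  by rewrite invf_le1.
rewrite cosX.
(* The parameter [e] of [Ex_cos_standardize], in the form given by [div_hajek_sd]; it is of order
   [m^(-1/2)] because [sigma_] has a positive limit. *)
pose e m := \sum_k `|t k| * ((Num.sqrt m%:R)^-1 / sigma_ (L m) (f m) k).
pose B m := (2 * e m + 8 * e m ^+ 2) * quad_form (S m) t + 6 * e m.
pose G m := expR (- (quad_form (S m) t / 2)) * cos b.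
have cvg_e : e m @[m --> \oo] --> (0 : R).
  rewrite [X in _ --> X](_ : 0 = \sum_k `|t k| * (0 / sigmaoo k)); last first.
    by rewrite big1// => k _; rewrite mul0r mulr0.
  apply: cvg_sumr => k; apply: cvgM; first exact: cvg_cst.
  apply: cvgM; last by apply: cvgV; [rewrite gt_eqF|].
  apply/cvgrPdist_le => eps eps0; near=> m.
  have m0 : 0 < m%:R :> R by near: m.
  rewrite sub0r normrN ger0_norm ?invr_ge0 ?sqrtr_ge0//.
  rewrite -[leRHS]invrK lef_pV2 ?posrE ?invr_gt0 ?sqrtr_gt0//.
  rewrite -(@ler_pXn2r _ 2) ?nnegrE ?invr_ge0 ?sqrtr_ge0 ?(ltW eps0)//.
  rewrite sqr_sqrtr ?ler0n//; near: m; exact: nbhs_infty_ger.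
have cvg_B : B m @[m --> \oo] --> (0 : R).
  rewrite [X in _ --> X](_ : 0 = (2 * 0 + 8 * (0 * 0)) *
    quad_form (cyclic_cov gammaoo) t + 6 * 0); last by ring.
  have h c : c * e m @[m --> \oo] --> c * 0 by apply: cvgM; [exact: cvg_cst|].
  apply: cvgD; last exact: h.
  apply: cvgM; last exact: cvg_S.
  apply: cvgD; first exact: h.
  by apply: cvgM; [exact: cvg_cst|exact: cvgM].
have cvg_G : G m @[m --> \oo] -->
    expR (- (quad_form (cyclic_cov gammaoo) t / 2)) * cos b.
  apply: cvgM; last exact: cvg_cst.
  apply: continuous_cvg; first exact: continuous_expR.
  by apply: cvgN; apply: cvgM; [exact: cvg_S|exact: cvg_cst].
have close : \forall m \near \oo, G m - B m <=
    Ex (P m) (fun w => cos (\sum_k t k * Y m k w + b)) <= G m + B m.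
  near=> m.
  have m0 : 0 < m%:R :> R by near: m.
  have s0 : forall k, 0 < sigma_ (L m) (f m) k by near: m.
  have nm k : (n m k)%:R <= m%:R :> R by rewrite ler_nat.
  have /= := Ex_cos_standardize hl (hD m) nm (hajek_sd_gt0 m0 s0)
    (sqr_hajek_sd hl m0 (hf m) s0) t b.
  rewrite (hajek_corr_cyclic hl m0 (hf m) s0).
  under eq_bigr do rewrite div_hajek_sd//.
  rewrite -/(e m) -/(S m) -/(B m) -/(G m) ler_norml => /andP[h1 h2].
  by apply/andP; split; lra.
apply: (squeeze_cvgr close).
  by rewrite -[X in _ --> X]subr0; exact: cvgB.
by rewrite -[X in _ --> X]addr0; exact: cvgD.
Unshelve. all: by end_near.
Qed.
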